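(* Let $g:[1,\infty[\to\mathbb{R}$ be continuous with $g(1)=1$ and suppose that $g$ determines a causal kernel, i.e. that $$K(k,p)=\frac{\epsilon(k)+\epsilon(p)}{2\sqrt{\epsilon(k)\epsilon(p)}}\,g\big(\epsilon(k)\epsilon(p)-kp\big)$$ is a positive definite kernel on $\mathbb{R}^3$. Let $\breve g(k,p):=g(\epsilon(k)\epsilon(p)-kp)$. Then $\breve g\in\mathcal{G}^{P}$, but $\breve g$ is not an extreme point of the convex set $\mathcal{G}$.
   Context: Put $\epsilon(p)=\sqrt{1+|p|^2}$ for $p\in\mathbb{R}^3$; $kp$ is the Euclidean scalar product. A kernel $G$ on $\mathbb{R}^3$ is positive definite if $\sum_{i,j}\overline{c_i}c_jG(p_i,p_j)\ge0$ for all finite families $c_i\in\mathbb{C}$, $p_i\in\mathbb{R}^3$. For $L$ in the proper orthochronous Lorentz group $O(1,3)_0$ and $p\in\mathbb{R}^3$, $L\cdot p\in\mathbb{R}^3$ denotes the spatial part of $L(\epsilon(p),p)$. $\mathcal{G}$ is the set of measurable positive definite kernels $G$ on $\mathbb{R}^3$ with $G(L\cdot k,L\cdot p)=G(k,p)$ for all $L\in O(1,3)_0$, $k,p\in\mathbb{R}^3$, and $G(0,0)=1$. $\mathcal{G}^{P}$ is the set of $G\in\mathcal{G}$ of the form $G(k,p)=g(\epsilon(k)\epsilon(p)-kp)$ with $$g(t)=\int_{[0,\infty[}\frac{\sin\lambda\kappa}{\lambda\sinh\kappa}\,d\mu(\lambda),\qquad \kappa=\cosh^{-1}t,\ t\ge1,$$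 for some probability Borel measure $\mu$ on $[0,\infty[$ (the integrand being extended continuously: it is $\kappa/\sinh\kappa$ at $\lambda=0$ and $1$ at $\kappa=0$). *)

(* Defs.v *)
From mathcomp Require Export all_boot all_order all_algebra.
From mathcomp Require Export all_classical all_reals all_analysis.
From mathcomp Require Export complex.
From mathcomp Require Import ring.

Set Implicit Arguments.
Unset Strict Implicit.
Unset Printing Implicit Defensive.

Import Order.TTheory GRing.Theory Num.Theory.
Import numFieldNormedType.Exports.

Local Open Scope classical_set_scope.
Local Open Scope complex_scope.
Local Open Scope ring_scope.

(* The library norm on column vectors is the sup norm, so the Euclidean
   structure is spelled out by the scalar product. *)
Definition dotv (R : realType) (k p : 'cV[R]_3) : R :=
  \sum_(i < 3) k i 0 * p i 0.

Definition energy (R : realType) (p : 'cV[R]_3) : R :=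
  Num.sqrt (1 + dotv p p).

Definition kernel (R : realType) : Type := 'cV[R]_3 -> 'cV[R]_3 -> R[i].

(* In R[i], [0 <= z] means that z is real and nonnegative. *)
Definition positive_definite (R : realType) (G : kernel R) : Prop :=
  forall (n : nat) (c : 'I_n -> R[i]) (p : 'I_n -> 'cV[R]_3),
    0 <= \sum_(i < n) \sum_(j < n) (c i)^* * c j * G (p i) (p j).

(* Joint Borel measurability on R^3 x R^3; [g_sigma_algebraType open] carries
   the sigma-algebra generated by the open sets. *)
Definition measurable_kernel (R : realType) (G : kernel R) : Prop :=
  let borelR3xR3 := g_sigma_algebraType (@open ('cV[R]_3 * 'cV[R]_3)%type) in
  measurable_fun [set: borelR3xR3] (fun x : borelR3xR3 => complex.Re (G x.1 x.2)) /\
  measurable_fun [set: borelR3xR3] (fun x : borelR3xR3 => complex.Im (G x.1 x.2)).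

(* diag (1, -1, -1, -1) *)
Definition minkowski (R : realType) : 'M[R]_(1 + 3) :=
  block_mx 1%:M 0 0 (- 1%:M).

(* The proper orthochronous Lorentz group O(1,3)_0. *)
Definition lorentz (R : realType) : set 'M[R]_(1 + 3) :=
  [set L | [/\ L^T *m minkowski R *m L = minkowski R,
               \det L = 1 & 0 < L ord0 ord0]].

Definition lorentz_act (R : realType) (L : 'M[R]_(1 + 3)) (p : 'cV[R]_3) :
    'cV[R]_3 :=
  dsubmx (L *m col_mx (energy p)%:M p).

Definition calG (R : realType) : set (kernel R) :=
  [set G : kernel R | [/\ measurable_kernel G, positive_definite G,
    forall L : 'M[R]_(1 + 3), lorentz L -> forall k p : 'cV[R]_3,
      G (lorentz_act L k) (lorentz_act L p) = G k p
    & G 0 0 = 1]].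

(* Only the values of g on [1, +oo[ matter, since
   energy k * energy p - dotv k p >= 1. *)
Definition breve (R : realType) (g : R -> R) : kernel R :=
  fun k p => (g (energy k * energy p - dotv k p))%:C.

Definition causal_kernel (R : realType) (g : R -> R) : kernel R :=
  fun k p => ((energy k + energy p) / (2 * Num.sqrt (energy k * energy p))
              * g (energy k * energy p - dotv k p))%:C.

Definition cosh (R : realType) (x : R) : R := (expR x + expR (- x)) / 2.

Definition sinh (R : realType) (x : R) : R := (expR x - expR (- x)) / 2.

(* The inverse of cosh from [1, +oo[ to [0, +oo[, see [coshK], [arcoshK]. *)
Definition arcosh (R : realType) (t : R) : R := ln (t + Num.sqrt (t ^+ 2 - 1)).

Lemma arcosh_ge0 (R : realType) (t : R) : 1 <= t -> 0 <= arcosh t.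
Proof. by move=> t1; rewrite ln_ge0// (le_trans t1)// lerDl sqrtr_ge0. Qed.

Lemma arcoshK (R : realType) (t : R) : 1 <= t -> cosh (arcosh t) = t.
Proof.
move=> t1; have t2 : 0 <= t ^+ 2 - 1 by rewrite subr_ge0 exprn_ege1.
have u0 : 0 < t + Num.sqrt (t ^+ 2 - 1).
  by rewrite ltr_wpDr ?sqrtr_ge0// (lt_le_trans ltr01).
rewrite /cosh /arcosh expRN lnK ?posrE//.
have -> : (t + Num.sqrt (t ^+ 2 - 1))^-1 = t - Num.sqrt (t ^+ 2 - 1).
  apply: (mulfI (lt0r_neq0 u0)); rewrite divff ?lt0r_neq0//.
  by rewrite mulrC -subr_sqr sqr_sqrtr// opprB addrC subrK.
by field.
Qed.

Lemma coshK (R : realType) (x : R) : 0 <= x -> arcosh (cosh x) = x.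
Proof.
move=> x0; rewrite /arcosh.
have e1 : expR x * expR (- x) = 1 by rewrite expRxMexpNx_1.
have -> : cosh x ^+ 2 - 1 = sinh x ^+ 2 + (expR x * expR (- x) - 1).
  by rewrite /cosh /sinh; field.
rewrite e1 subrr addr0.
rewrite sqrtr_sqr ger0_norm.
  have -> : cosh x + sinh x = expR x by rewrite /cosh /sinh; field.
  exact: expRK.
by rewrite divr_ge0// subr_ge0 ler_expR (le_trans _ x0)// oppr_le0.
Qed.

(* sin (lambda kappa) / (lambda sinh kappa), extended continuously to
   kappa = 0 and to lambda = 0. *)
Definition principal_integrand (R : realType) (lambda kappa : R) : R :=
  if kappa == 0 then 1
  else if lambda == 0 then kappa / sinh kappa
  else sin (lambda * kappa) / (lambda * sinh kappa).

(* A probability measure on [0, +oo[ is given as a Borel probability measure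
   on R concentrated on [0, +oo[. *)
Definition calGP (R : realType) : set (kernel R) :=
  [set G : kernel R | calG G /\ exists g : R -> R, G = breve g /\
    exists mu : probability (measurableTypeR R) R,
      mu [set` `[0, +oo[] = 1%E /\
      forall t : R, 1 <= t ->
        (g t)%:E = (\int[mu]_(lambda in `[0%R, +oo[)
                      (principal_integrand lambda (arcosh t))%:E)%E].

Definition extreme_point (R : realType) (S : set (kernel R)) (G : kernel R) :
    Prop :=
  S G /\ forall (A B : kernel R) (t : R), S A -> S B -> 0 < t < 1 ->
    (forall k p, G k p = t%:C * A k p + (1 - t)%:C * B k p) ->
    A = G /\ B = G.

(* Main.v *)
(** On the mass hyperboloid, with horospherical coordinates (x, s), a boost of
    rapidity tending to infinity turns the causal kernel into
    (e^-s + e^-s') g(k.p), k.p being the Minkowski product.  Averaging over x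
    with Gaussian weights replaces g by Laplace transforms of f(r) = g(1 + r), and
    the 2x2 minors of the resulting kernels in s bound these transforms uniformly.
    Hence the integral A(s) of f over [cosh s - 1, +oo[ converges; A is even,
    integrable and of positive type, and A'(s) = - g(cosh s) sinh s.  So A is the
    cosine transform of some a >= 0, and since A(0) - A(d) = O(d^2), l^2 a(l) is
    integrable.  Differentiating, g(cosh k) sinh k is the integral of
    sin(l k) / l against a density rho proportional to l^2 a(l), of mass 1
    because g(1) = 1.

    Conversely each kernel sin(l k) / (l sinh k), cosh k being the Minkowski
    product, is positive definite: 1 / (cosh k + cosh(b - b')) is an average of
    squared Cauchy kernels over the light-like directions, and its Fourier
    transform in b - b' is a positive multiple of sin(l k) / (l sinh k).  Thus
    every density yields an element of calG, and splitting rho by the factor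
    1 / (1 + l^2) exhibits g as a proper convex combination: by expansion at
    k = 0 the two parts have different second moments. *)

From HB Require Import structures.
Require Import Defs.
From mathcomp Require Import ring lra measurable_realfun.

Set Implicit Arguments.
Unset Strict Implicit.
Unset Printing Implicit Defensive.

Import Order.TTheory GRing.Theory Num.Theory.
Import numFieldNormedType.Exports.

Local Open Scope classical_set_scope.
Local Open Scope ring_scope.

Implicit Type R : realType.

(** * Positive definite kernels *)

(** The obstacle is that f is known only to be bounded by 1: without decay its integral over a
    horosphere need not converge. Gaussian weights make it converge, but they do not respect the
    scaling in s: the average at (s, s') has Laplace parameter eta e^(s + s'). The minor at (a, -a)
    therefore compares a transform with parameter eta to those with parameters eta e^(2a) and eta
    e^(-2a), and a uniform bound comes from playing this inequality against the trivial bound 1 /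
    eta. The weights e^-s + e^-s' can be divided out in the end because 1 / (a + a') is itself a
    positive definite kernel for a > 0. One function, psi(x) = 1 / (1 + cosh x), serves twice: as
    the damping factor in the Fourier inversion, because its cosine transform tau is positive and
    integrable, and as the case t = 1 of 1 / (t + cosh x), whose transform is tau(l) times the
    principal integrand. The positivity of tau comes from a recursion over the powers of psi. *)

Lemma eq_ge0 R (x y : R) : x = y -> 0 <= x -> 0 <= y.
Proof. by move=> ->. Qed.

Lemma eq_cvgr R (T : Type) (F : set_system T) (f g : T -> R)
    (l l' : R) :
  (forall x, f x = g x) -> l = l' -> f x @[x --> F] --> l ->
  g x @[x --> F] --> l'.
Proof. by move=> /funext -> ->. Qed.

(** Real coefficients are enough for real symmetric kernels, and a sequence of weighted points
    allows repetitions and concatenation without index bookkeeping. *)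
Definition pd R (X : Type) (K : X -> X -> R) : Prop :=
  forall s : seq (R * X),
    0 <= \sum_(x <- s) \sum_(y <- s) x.1 * y.1 * K x.2 y.2.

Lemma pd_map R (X Y : Type) (K : X -> X -> R) (f : Y -> R)
    (h : Y -> X) :
  pd K -> pd (fun x y => f x * f y * K (h x) (h y)).
Proof.
move=> pK s; have := pK [seq (x.1 * f x.2, h x.2) | x <- s].
rewrite big_map; under eq_bigr do rewrite big_map.
apply: eq_ge0.
by apply: eq_bigr => x _; apply: eq_bigr => y _ /=; ring.
Qed.

Lemma pd_comp R (X Y : Type) (K : X -> X -> R) (h : Y -> X) :
  pd K -> pd (fun x y => K (h x) (h y)).
Proof.
move=> /(@pd_map _ _ _ _ (fun=> 1) h) pK s; apply: eq_ge0 (pK s).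
by apply: eq_bigr => x _; apply: eq_bigr => y _ /=; ring.
Qed.

Lemma eq_pd R (X : Type) (K K' : X -> X -> R) :
  (forall x y, K x y = K' x y) -> pd K -> pd K'.
Proof. by move=> KK'; rewrite (_ : K' = K)//; apply/funext => x; apply/funext => y; rewrite KK'. Qed.

Lemma pdD R (X : Type) (K K' : X -> X -> R) :
  pd K -> pd K' -> pd (fun x y => K x y + K' x y).
Proof.
move=> pK pK' s; have := addr_ge0 (pK s) (pK' s).
apply: eq_ge0.
rewrite -big_split/=; apply: eq_bigr => x _.
by rewrite -big_split/=; apply: eq_bigr => y _ /=; ring.
Qed.

Lemma pd_scale R (X : Type) (K : X -> X -> R) (c : R) :
  0 <= c -> pd K -> pd (fun x y => c * K x y).
Proof.
move=> c0 pK s; have := mulr_ge0 c0 (pK s).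
apply: eq_ge0.
rewrite mulr_sumr; apply: eq_bigr => x _; rewrite mulr_sumr.
by apply: eq_bigr => y _ /=; ring.
Qed.

Lemma pd0 R (X : Type) : pd (fun _ _ : X => 0 : R).
Proof.
by move=> s; rewrite big1// => x _; rewrite big1// => y _; rewrite mulr0.
Qed.

Lemma pd_bigsum R (X : Type) (K : nat -> X -> X -> R) (n : nat) :
  (forall k, pd (K k)) -> pd (fun x y => \sum_(0 <= k < n) K k x y).
Proof.
move=> pK; elim: n => [|n IH].
  by apply: eq_pd (@pd0 R X) => x y; rewrite big_geq.
by apply: eq_pd (pdD IH (pK n)) => x y; rewrite big_nat_recr.
Qed.

Lemma cvgn_sum R (I : Type) (s : seq I) (F : nat -> I -> R)
    (l : I -> R) :
  (forall i, F ^~ i @ \oo --> l i) ->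
  \sum_(i <- s) F n i @[n --> \oo] --> \sum_(i <- s) l i.
Proof.
move=> Fl; apply: cvg_big => [|i _]; [exact: add_continuous|exact: Fl].
Qed.

Lemma pd_lim R (X : Type) (K_ : nat -> X -> X -> R)
    (K : X -> X -> R) :
  (forall n, pd (K_ n)) -> (forall x y, (fun n => K_ n x y) @ \oo --> K x y) ->
  pd K.
Proof.
move=> pK cK s.
have cvgs : \sum_(x <- s) \sum_(y <- s) x.1 * y.1 * K_ n x.2 y.2 @[n --> \oo]
    --> \sum_(x <- s) \sum_(y <- s) x.1 * y.1 * K x.2 y.2.
  apply: cvgn_sum => x; apply: cvgn_sum => y.
  by apply: cvgM; [exact: cvg_cst|exact: cK].
rewrite -(cvg_lim _ cvgs)//; apply: limr_ge.
  by apply/cvg_ex; eexists; exact: cvgs.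
by apply: nearW => n; exact: pK.
Qed.

Lemma le_lim_seq R (u v : nat -> R) (a b : R) :
  u @ \oo --> a -> v @ \oo --> b -> (forall n, u n <= v n) -> a <= b.
Proof.
move=> ua vb uv; rewrite -(cvg_lim _ ua)// -(cvg_lim _ vb)//; apply: ler_lim.
- by apply/cvg_ex; exists a.
- by apply/cvg_ex; exists b.
- exact: nearW.
Qed.

(* With z = (a - 1) / (a + 1) one has
   1 / (a + a') = (1 - z) (1 - z') / (2 (1 - z z')), a geometric series. *)
Lemma pd_div R (X : Type) (K : X -> X -> R) (a : X -> R) :
  (forall x, 0 < a x) -> pd K -> pd (fun x y => K x y / (a x + a y)).
Proof.
move=> a0 pK.
pose z x := (a x - 1) / (a x + 1).
have z1 x : `|z x| < 1.
  have := a0 x => ax; rewrite /z normrM normfV (@gtr0_norm _ (a x + 1)); last lra.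
  by rewrite ltr_pdivrMr ?mul1r; [rewrite ltr_norml; apply/andP; split; lra|lra].
pose K_ n x y := 2^-1 * \sum_(0 <= k < n)
  ((z x ^+ k * (1 - z x)) * (z y ^+ k * (1 - z y)) * K x y).
apply: (@pd_lim _ _ K_) => [n|x y].
  apply: pd_scale; first by rewrite invr_ge0.
  apply: pd_bigsum => k.
  exact: (@pd_map _ _ _ K (fun x => z x ^+ k * (1 - z x)) id).
have zz : `|z x * z y| < 1.
  rewrite normrM (le_lt_trans _ (z1 x))// ler_piMr// ltW//.
have -> : (fun n => K_ n x y) = (fun n => 2^-1 * (1 - z x) * (1 - z y) * K x y *
    series (geometric 1 (z x * z y)) n).
  apply/funext => n; rewrite /K_ /series/= -mulrA -mulrA -mulrA; congr (_ * _).
  rewrite !mulr_sumr; apply: eq_bigr => k _.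
  rewrite mul1r; move: (z x) (z y) (K x y) => p q w.
  by rewrite exprMn; move: (p ^+ k) (q ^+ k) => u v; ring.
have -> : K x y / (a x + a y) = 2^-1 * (1 - z x) * (1 - z y) * K x y *
    (1 * (1 - z x * z y)^-1).
  have ax := a0 x; have ay := a0 y.
  have nx : a x + 1 != 0 by rewrite gt_eqF//; lra.
  have ny : a y + 1 != 0 by rewrite gt_eqF//; lra.
  have nxy : a x + a y != 0 by rewrite gt_eqF//; lra.
  have -> : 1 - z x * z y = 2 * (a x + a y) / ((a x + 1) * (a y + 1)).
    by rewrite /z; field; rewrite nx ny.
  by rewrite /z; field; rewrite nx ny nxy.
apply: cvgM; first exact: cvg_cst.
exact: cvg_geometric_series.
Qed.

Lemma pd_cos R (X : Type) (K : X -> X -> R) (b : X -> R) :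
  pd K -> pd (fun x y => cos (b x - b y) * K x y).
Proof.
move=> pK; have := pdD (@pd_map _ _ _ K (cos \o b) id pK)
  (@pd_map _ _ _ K (sin \o b) id pK).
by apply: eq_pd => x y /=; rewrite cosB; ring.
Qed.

Lemma pd_ge0 R (X : Type) (K : X -> X -> R) x : pd K -> 0 <= K x x.
Proof. by move=> /(_ [:: (1, x)]); rewrite !big_seq1/= !mul1r. Qed.

Lemma pd_CauchySchwarz R (X : Type) (K : X -> X -> R) x y :
  (forall x y, K x y = K y x) -> pd K -> K x y ^+ 2 <= K x x * K y y.
Proof.
move=> sK pK.
have q (u v : R) : 0 <= u ^+ 2 * K x x + 2 * u * v * K x y + v ^+ 2 * K y y.
  have := pK [:: (u, x); (v, y)]; rewrite !big_cons !big_nil/= (sK y x).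
  by apply: eq_ge0; ring.
have x0 := pd_ge0 x pK; have y0 := pd_ge0 y pK.
have [Kx|Kx] := eqVneq (K x x) 0.
  have h u := q u (- (K x y)); rewrite Kx in h *.
  (* With [K x x = 0] the form at (u, - K x y) is [K x y ^+ 2 * (K y y - 2 * u)]; u is chosen so
     that the last factor is -1. *)
  have : K x y ^+ 2 * (2 * ((K y y + 1) / 2) - K y y) <= 0.
    have := h ((K y y + 1) / 2).
    rewrite -oppr_ge0; move=> h1; apply: le_trans h1 _.
    by rewrite le_eqVlt; apply/orP; left; apply/eqP; ring.
  by rewrite (_ : _ - _ = 1) ?mulr1 ?mul0r//; field.
(* At these coefficients the form is [K x x] times the determinant of the 2x2 minor. *)
have := q (- K x y) (K x x).
have -> : (- K x y) ^+ 2 * K x x + 2 * (- K x y) * K x x * K x y +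
  K x x ^+ 2 * K y y = K x x * (K x x * K y y - K x y ^+ 2) by ring.
by rewrite pmulr_rge0 ?subr_ge0// lt_neqAle eq_sym Kx.
Qed.

Lemma sum_seq_ord R (X : Type) (s : seq X) (F : X -> R) (x0 : X) :
  \sum_(x <- s) F x = \sum_(i < size s) F (nth x0 s i).
Proof. by rewrite (big_nth x0) big_mkord. Qed.

(** * Real and complex positive definiteness *)

Section complex_kernels.
Local Open Scope complex_scope.

Lemma positive_definite_pd R (K : 'cV[R]_3 -> 'cV[R]_3 -> R) :
  positive_definite (fun k p => (K k p)%:C) -> pd K.
Proof.
move=> pK s.
have := pK (size s) (fun i => ((nth (0, 0) s i).1)%:C)
  (fun i => (nth (0, 0) s i).2).
rewrite (_ : \sum_(i < size s) _ =
  (\sum_(x <- s) \sum_(y <- s) x.1 * y.1 * K x.2 y.2)%:C) ?lecR//.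
rewrite (sum_seq_ord _ _ (0, 0)) rmorph_sum/=; apply: eq_bigr => i _.
rewrite (sum_seq_ord _ _ (0, 0)) rmorph_sum/=; apply: eq_bigr => j _.
rewrite /real_complex_def; apply/eqP; rewrite eq_complex/=.
by apply/andP; split; apply/eqP; ring.
Qed.

(** With c = a + i b, symmetry of K cancels the cross terms of a and b, which leaves the real forms
    of a and of b. *)
Lemma pd_positive_definite R (K : 'cV[R]_3 -> 'cV[R]_3 -> R) :
  (forall k p, K k p = K p k) -> pd K ->
  positive_definite (fun k p => (K k p)%:C).
Proof.
move=> sK pK n c p.
have q (a : 'I_n -> R) :
    0 <= \sum_(i < n) \sum_(j < n) a i * a j * K (p i) (p j).
  have := pK [seq (a i, p i) | i <- enum 'I_n].
  rewrite big_map big_enum/=; under eq_bigr do rewrite big_map big_enum/=.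
  by [].
have -> : \sum_(i < n) \sum_(j < n) (c i)^* * c j * (K (p i) (p j))%:C =
  (\sum_(i < n) \sum_(j < n) (complex.Re (c i)) * (complex.Re (c j)) * K (p i) (p j) +
   \sum_(i < n) \sum_(j < n) (complex.Im (c i)) * (complex.Im (c j)) * K (p i) (p j))%:C.
  set S := \sum_(i < n) _.
  have SE : S = \sum_(i < n) \sum_(j < n) ((complex.Re (c i)) * (complex.Re (c j)) * K (p i) (p j)
    + (complex.Im (c i)) * (complex.Im (c j)) * K (p i) (p j))%:C +
   'i * \sum_(i < n) \sum_(j < n) ((complex.Re (c i)) * (complex.Im (c j)) * K (p i) (p j)
    - (complex.Im (c i)) * (complex.Re (c j)) * K (p i) (p j))%:C.
    rewrite mulr_sumr -big_split/=; apply: eq_bigr => i _.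
    rewrite mulr_sumr -big_split/=; apply: eq_bigr => j _.
    case: (c i) (c j) => a b [a' b'] /=.
    rewrite /real_complex_def; apply/eqP; rewrite eq_complex/=.
    by apply/andP; split; apply/eqP; ring.
  rewrite SE.
  have -> : \sum_(i < n) \sum_(j < n) ((complex.Re (c i)) * (complex.Im (c j)) * K (p i) (p j)
    - (complex.Im (c i)) * (complex.Re (c j)) * K (p i) (p j))%:C = 0.
    under eq_bigr do rewrite -rmorph_sum.
    rewrite -rmorph_sum /=.
    under eq_bigr do rewrite sumrB.
    rewrite sumrB [X in _ - X]exchange_big/= -sumrB big1 ?rmorph0// => i _.
    rewrite -sumrB big1// => j _; rewrite sK; ring.
  rewrite mulr0 addr0; under eq_bigr do rewrite -rmorph_sum.
  rewrite -rmorph_sum -big_split/=; congr (_%:C); apply: eq_bigr => i _.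
  by rewrite big_split.
by rewrite lecR addr_ge0.
Qed.

End complex_kernels.

(** * The mass hyperboloid *)

Lemma dotvE R (k p : 'cV[R]_3) :
  dotv k p = k ord0 0 * p ord0 0
    + k (lift ord0 ord0) 0 * p (lift ord0 ord0) 0
    + k (lift ord0 (lift ord0 ord0)) 0 * p (lift ord0 (lift ord0 ord0)) 0.
Proof. by rewrite /dotv !big_ord_recl big_ord0 addr0 addrA. Qed.

Lemma dotv_ge0 R (k : 'cV[R]_3) : 0 <= dotv k k.
Proof. by rewrite dotvE !addr_ge0// -expr2 sqr_ge0. Qed.

Lemma dotvC R (k p : 'cV[R]_3) : dotv k p = dotv p k.
Proof. by apply: eq_bigr => i _; rewrite mulrC. Qed.

Lemma sqr_energy R (k : 'cV[R]_3) : energy k ^+ 2 = 1 + dotv k k.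
Proof. by rewrite sqr_sqrtr// addr_ge0// dotv_ge0. Qed.

Lemma energy_ge1 R (k : 'cV[R]_3) : 1 <= energy k.
Proof. by rewrite -[leLHS]sqrtr1 ler_wsqrtr// lerDl dotv_ge0. Qed.

Lemma energy_gt0 R (k : 'cV[R]_3) : 0 < energy k.
Proof. exact: lt_le_trans ltr01 (energy_ge1 k). Qed.

Lemma energyP R (k : 'cV[R]_3) (e : R) :
  0 <= e -> e ^+ 2 = 1 + dotv k k -> energy k = e.
Proof. by move=> e0 ek; rewrite /energy -ek sqrtr_sqr ger0_norm. Qed.

(* The Minkowski product of the four-momenta (energy k, k) and (energy p, p). *)
Definition lorentz_prod R (k p : 'cV[R]_3) : R :=
  energy k * energy p - dotv k p.

Lemma lorentz_prodC R (k p : 'cV[R]_3) :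
  lorentz_prod k p = lorentz_prod p k.
Proof. by rewrite /lorentz_prod mulrC dotvC. Qed.

Lemma lorentz_prod_id R (k : 'cV[R]_3) : lorentz_prod k k = 1.
Proof. by rewrite /lorentz_prod -expr2 sqr_energy addrK. Qed.

Lemma lorentz_prod_ge1 R (k p : 'cV[R]_3) : 1 <= lorentz_prod k p.
Proof.
rewrite /lorentz_prod lerBrDr.
have [d0|d0] := lerP (1 + dotv k p) 0.
  by rewrite (le_trans d0)// mulr_ge0// ltW// energy_gt0.
rewrite -(ler_pXn2r (ltn0Sn 1)) ?nnegrE; last 2 first.
- exact: ltW.
- by rewrite mulr_ge0// ltW// energy_gt0.
rewrite exprMn !sqr_energy !dotvE.
set a := k _ _; set b := k _ _; set c := k _ _.
set x := p _ _; set y := p _ _; set z := p _ _.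
rewrite -subr_ge0.
(* Lagrange's identity: the difference is |k - p|^2 plus the squared norm of the cross product of k
   and p. *)
apply: (@eq_ge0 _ ((a - x) ^+ 2 + (b - y) ^+ 2 + (c - z) ^+ 2 +
  (a * y - b * x) ^+ 2 + (a * z - c * x) ^+ 2 + (b * z - c * y) ^+ 2)).
  by ring.
by rewrite !addr_ge0// sqr_ge0.
Qed.

(* The point of the mass hyperboloid with upper half-space coordinates
   (x1, x2, e^s). *)
Definition horo R (z : R * R * R) : 'cV[R]_3 :=
  \col_(i < 3) [:: z.1.1 * expR (- z.2); z.1.2 * expR (- z.2);
    (expR z.2 + (z.1.1 ^+ 2 + z.1.2 ^+ 2 - 1) * expR (- z.2)) / 2]`_i.

Lemma energy_horo R (z : R * R * R) :
  energy (horo z) =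
  (expR z.2 + (z.1.1 ^+ 2 + z.1.2 ^+ 2 + 1) * expR (- z.2)) / 2.
Proof.
apply: energyP.
  by rewrite divr_ge0// addr_ge0 ?mulr_ge0 ?expR_ge0// !addr_ge0 ?sqr_ge0.
rewrite dotvE !mxE/=.
have e1 := expRxMexpNx_1 z.2.
move: (expR _) (expR _) e1 => u v e1; move: z.1.1 z.1.2 => x1 x2.
apply/eqP; rewrite -subr_eq0; apply/eqP.
transitivity (v * u - 1); last by rewrite e1 subrr.
by field.
Qed.

(** The coordinates x enter only through |x - x'|^2, in a term added to a function of s - s'; this
    separation is what the Gaussian averages over x exploit. *)
Lemma lorentz_prod_horo R (z z' : R * R * R) :
  lorentz_prod (horo z) (horo z') = 1 +
   (((z.1.1 - z'.1.1) ^+ 2 + (z.1.2 - z'.1.2) ^+ 2) * expR (- (z.2 + z'.2)) / 2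
     + (cosh (z.2 - z'.2) - 1)).
Proof.
rewrite /lorentz_prod !energy_horo dotvE !mxE/= /cosh.
rewrite opprB (opprD z.2) !expRD.
move: (expR _) (expR _) (expR _) (expR _) => u v u' v'.
by move: z.1.1 z.1.2 z'.1.1 z'.1.2 => x1 x2 x1' x2'; field.
Qed.

(** [expR (- z.2)] is the light-like coordinate of [horo z]: its energy minus its third
    component. *)
Definition lightlike_kernel R (g : R -> R) (z z' : R * R * R) : R :=
  (expR (- z.2) + expR (- z'.2)) * g (lorentz_prod (horo z) (horo z')).

Lemma pd_energy_kernel R (g : R -> R) :
  positive_definite (causal_kernel g) ->
  pd (fun k p : 'cV[R]_3 => (energy k + energy p) * g (lorentz_prod k p)).
Proof.
move=> /positive_definite_pd pg.
(* Congruence with the square root of the energy, and the factor 2, clear the denominator of the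
   causal kernel. *)
have := pd_scale (ler0n _ 2) (pd_map (fun k => Num.sqrt (energy k)) id pg).
apply: eq_pd => k p /=; have k0 := energy_gt0 k; have p0 := energy_gt0 p.
rewrite sqrtrM ?(ltW k0)//.
have : Num.sqrt (energy k) != 0 by rewrite gt_eqF// sqrtr_gt0.
have : Num.sqrt (energy p) != 0 by rewrite gt_eqF// sqrtr_gt0.
rewrite -/(lorentz_prod k p).
move: (Num.sqrt _) (Num.sqrt _) => u v u0 v0.
by field; rewrite u0.
Qed.

Lemma pd_breve R (g : R -> R) :
  positive_definite (causal_kernel g) ->
  pd (fun k p : 'cV[R]_3 => g (lorentz_prod k p)).
Proof.
move=> /pd_energy_kernel /(pd_div (@energy_gt0 R)).
apply: eq_pd => k p; rewrite mulrAC divff ?mul1r// gt_eqF//.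
by rewrite addr_gt0// energy_gt0.
Qed.

(* A boost of rapidity tending to infinity turns the energy into the
   lightlike coordinate e^(-s). *)
Lemma pd_lightlike_kernel R (g : R -> R) :
  positive_definite (causal_kernel g) -> pd (lightlike_kernel g).
Proof.
move=> /pd_energy_kernel pg.
(* In horospherical coordinates a boost of rapidity n is (x, s) |-> (e^-n x, s - n). It preserves
   Minkowski products, and 2 e^-n times the boosted energy tends to e^-s. *)
pose sc (n : nat) (z : R * R * R) : R * R * R :=
  ((expR (- n%:R) * z.1.1, expR (- n%:R) * z.1.2), z.2 - n%:R).
pose e n (z : R * R * R) := 2 * expR (- n%:R) * energy (horo (sc n z)).
apply: (@pd_lim _ _ (fun n z z' => (e n z + e n z') *
   g (lorentz_prod (horo z) (horo z')))) => [n|z z'].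
  have := pd_scale (mulr_ge0 (ler0n _ 2) (expR_ge0 (- n%:R)))
    (pd_comp (fun z => horo (sc n z)) pg).
  apply: eq_pd => z z'; rewrite /e.
  have -> : lorentz_prod (horo (sc n z)) (horo (sc n z')) =
    lorentz_prod (horo z) (horo z').
    rewrite !lorentz_prod_horo/=; congr (1 + (_ + (cosh _ - 1))); last by ring.
    rewrite -!mulrBr !exprMn -mulrDr.
    have -> : - (z.2 - n%:R + (z'.2 - n%:R)) = - (z.2 + z'.2) + n%:R + n%:R by ring.
    rewrite (expRD (_ + _)) (expRD (- (z.2 + z'.2))).
    have e1 := expRxMexpNx_1 (n%:R : R).
    move: (expR (- (z.2 + z'.2))) (expR _) (expR _) e1 => w u v e1.
    transitivity ((v * u) ^+ 2 *
      (((z.1.1 - z'.1.1) ^+ 2 + (z.1.2 - z'.1.2) ^+ 2) * w / 2)); first by field.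
    by rewrite e1 expr1n mul1r.
  by ring.
have eE n x : e n x = expR (- x.2) +
   expR (- n%:R) ^+ 2 * (expR x.2 + (x.1.1 ^+ 2 + x.1.2 ^+ 2) * expR (- x.2)).
  rewrite /e energy_horo/=.
  have -> : - (x.2 - n%:R) = n%:R - x.2 by ring.
  rewrite !expRD.
  have e1 := expRxMexpNx_1 (n%:R : R).
  move: (expR n%:R) (expR (- n%:R)) e1 => u v e1.
  transitivity ((u * v) * expR (- x.2) + v ^+ 2 * (expR x.2 +
     (u * v) * (x.1.1 ^+ 2 + x.1.2 ^+ 2) * expR (- x.2))); first by field.
  by rewrite e1 !mul1r.
have en : (fun n => expR (- n%:R) ^+ 2 : R) @ \oo --> (0 : R).
  have -> : (fun n => expR (- n%:R) ^+ 2 : R) = fun n => (expR (-1 : R) ^+ 2) ^+ n.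
    apply/funext => n; rewrite exprAC; congr (_ ^+ 2).
    by rewrite -expRM_natl mulrN1.
  by apply: cvg_expr; rewrite ger0_norm ?sqr_ge0// expr_lt1 ?expR_ge0.
have ce x : e n x @[n --> \oo] --> expR (- x.2).
  apply: (eq_cvgr (fun n => esym (eE n x)) (l := expR (- x.2) +
    0 * (expR x.2 + (x.1.1 ^+ 2 + x.1.2 ^+ 2) * expR (- x.2)))).
    by rewrite mul0r addr0.
  apply: cvgD; first exact: cvg_cst.
  by apply: cvgM; [exact: en|exact: cvg_cst].
by apply: cvgM; [apply: cvgD; exact: ce|exact: cvg_cst].
Qed.

(** Every t >= 1 is attained as a Minkowski product, so that facts about kernels pass to g. *)
Lemma lorentz_prod_horo_arcosh R (t : R) : 1 <= t ->
  lorentz_prod (horo ((0, 0), arcosh t)) (horo ((0, 0), 0)) = t.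
Proof.
move=> t1; rewrite lorentz_prod_horo/= subrr expr0n/= addr0 mul0r mul0r add0r.
by rewrite subr0 arcoshK// addrC subrK.
Qed.

Lemma causal_le1 R (g : R -> R) : g 1 = 1 ->
  positive_definite (causal_kernel g) -> forall t, 1 <= t -> `|g t| <= 1.
Proof.
move=> g1 /pd_breve pg t t1; rewrite -(lorentz_prod_horo_arcosh t1).
set k := horo _; set p := horo _.
have /= := pd_CauchySchwarz k p (fun k p => congr1 g (lorentz_prodC k p)) pg.
rewrite !lorentz_prod_id g1 mulr1 -{1}(expr1n R 2) -real_normK ?num_real//.
by rewrite ler_pXn2r// nnegrE.
Qed.

(** * Integration over the real line *)

Definition igr R (f : R -> R) : Prop :=
  (@lebesgue_measure R).-integrable setT (EFin \o f).

(** [Rintegral] sends an infinite integral to 0, so the value is informative only together with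
    [igr]. *)
Definition Int R (f : R -> R) : R :=
  Rintegral (@lebesgue_measure R) setT f.

Lemma igr_measurable R (f : R -> R) :
  igr f -> measurable_fun setT f.
Proof. by move=> /measurable_int /measurable_EFinP. Qed.

Lemma igr_le R (f g : R -> R) :
  measurable_fun setT f -> (forall x, `|f x| <= g x) -> igr g -> igr f.
Proof.
move=> mf fg; apply: le_integrable => //; first exact/measurable_EFinP.
move=> x _ /=; rewrite lee_fin; apply: le_trans (fg x) _; exact: ler_norm.
Qed.

Lemma igr_norm R (f : R -> R) : igr f -> igr (fun x => `|f x|).
Proof. by move=> /integrable_norm; apply. Qed.

Lemma igrD R (f g : R -> R) :
  igr f -> igr g -> igr (fun x => f x + g x).
Proof. by move=> If Ig; apply: eq_integrable (integrableD _ If Ig). Qed.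

Lemma igrZ R (c : R) (f : R -> R) :
  igr f -> igr (fun x => c * f x).
Proof. by move=> If; apply: eq_integrable (integrableZl _ c If). Qed.

Lemma igrN R (f : R -> R) : igr f -> igr (fun x => - f x).
Proof. by move=> If; apply: eq_integrable (integrableN If). Qed.

Lemma igrB R (f g : R -> R) :
  igr f -> igr g -> igr (fun x => f x - g x).
Proof. by move=> If Ig; apply: igrD => //; exact: igrN. Qed.

Lemma igr0 R : igr (fun _ : R => 0).
Proof. exact: integrable0. Qed.

Lemma igr_sum R (I : Type) (s : seq I) (F : I -> R -> R) :
  (forall i, igr (F i)) -> igr (fun x => \sum_(i <- s) F i x).
Proof.
move=> IF; elim: s => [|i s IH].
  by apply: eq_integrable (@igr0 R) => // x _ /=; rewrite big_nil.
apply: eq_integrable (igrD (IF i) IH) => // x _ /=.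
by rewrite big_cons.
Qed.

Lemma igr_bounded_mul R (f w : R -> R) (M : R) :
  measurable_fun setT f -> (forall x, `|f x| <= M) -> igr w ->
  igr (fun x => f x * w x).
Proof.
move=> mf fM Iw; apply: (@igr_le _ _ (fun x => M * `|w x|)).
- by apply: measurable_funM => //; exact: igr_measurable.
- by move=> x; rewrite normrM ler_wpM2r.
- by apply: igrZ; exact: igr_norm.
Qed.

Lemma eq_Int R (f g : R -> R) : f =1 g -> Int f = Int g.
Proof. by move=> fg; apply: eq_Rintegral => x _; exact: fg. Qed.

Lemma eq_igr R (f g : R -> R) : f =1 g -> igr f -> igr g.
Proof. by move=> fg; apply: eq_integrable => // x _ /=; rewrite fg. Qed.

Lemma IntD R (f g : R -> R) :
  igr f -> igr g -> Int (fun x => f x + g x) = Int f + Int g.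
Proof. by move=> If Ig; exact: RintegralD. Qed.

Lemma IntB R (f g : R -> R) :
  igr f -> igr g -> Int (fun x => f x - g x) = Int f - Int g.
Proof. by move=> If Ig; exact: RintegralB. Qed.

Lemma IntZ R (c : R) (f : R -> R) :
  igr f -> Int (fun x => c * f x) = c * Int f.
Proof. by move=> If; exact: RintegralZl. Qed.

Lemma IntZr R (c : R) (f : R -> R) :
  igr f -> Int (fun x => f x * c) = Int f * c.
Proof. by move=> If; exact: RintegralZr. Qed.

Lemma Int0 R : Int (fun _ : R => 0) = 0.
Proof. by rewrite /Int /Rintegral integral0. Qed.

Lemma Int_sum R (I : Type) (s : seq I) (F : I -> R -> R) :
  (forall i, igr (F i)) ->
  Int (fun x => \sum_(i <- s) F i x) = \sum_(i <- s) Int (F i).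
Proof.
move=> IF; elim: s => [|i s IH].
  by rewrite big_nil -[RHS](Int0 R); apply: eq_Int => x; rewrite big_nil.
rewrite big_cons -IH -IntD//; last exact: igr_sum.
by apply: eq_Int => x; rewrite big_cons.
Qed.

Lemma Int_ge0 R (f : R -> R) : (forall x, 0 <= f x) -> 0 <= Int f.
Proof. by move=> f0; apply: Rintegral_ge0 => x _; exact: f0. Qed.

Lemma le_Int R (f g : R -> R) :
  igr f -> igr g -> (forall x, f x <= g x) -> Int f <= Int g.
Proof. by move=> If Ig fg; apply: le_Rintegral => // x _; exact: fg. Qed.

Lemma norm_Int R (f : R -> R) :
  igr f -> `|Int f| <= Int (fun x => `|f x|).
Proof. by move=> If; exact: le_normr_Rintegral. Qed.

Lemma EFin_Int R (f : R -> R) : igr f ->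
  (Int f)%:E = (\int[@lebesgue_measure R]_x (f x)%:E)%E.
Proof. by move=> If; rewrite fineK//; exact: integrable_fin_num. Qed.

Lemma ge0_igr R (f : R -> R) :
  measurable_fun setT f -> (forall x, 0 <= f x) ->
  (\int[@lebesgue_measure R]_x (f x)%:E < +oo)%E -> igr f.
Proof.
move=> mf f0 foo; apply/integrableP; split; first exact/measurable_EFinP.
by under eq_integral do rewrite /= ger0_norm//.
Qed.

Lemma igr_dct R (f_ : nat -> R -> R) (f g : R -> R) :
  (forall n, measurable_fun setT (f_ n)) ->
  (forall x, f_ ^~ x @ \oo --> f x) ->
  (forall n x, `|f_ n x| <= g x) -> igr g -> igr f.
Proof.
move=> mf ff fg Ig.
have mf' : measurable_fun setT f.
  by apply: (measurable_fun_cvg mf) => x _; exact: ff.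
apply: igr_le Ig => // x.
have cf : `|f_ n x| @[n --> \oo] --> `|f x| by apply: cvg_norm; exact: ff.
rewrite -(cvg_lim _ cf)//; apply: limr_le.
  by apply/cvg_ex; eexists; exact: cf.
by apply: nearW => n; exact: fg.
Qed.

Lemma Int_dct R (f_ : nat -> R -> R) (f g : R -> R) :
  (forall n, measurable_fun setT (f_ n)) ->
  (forall x, f_ ^~ x @ \oo --> f x) ->
  (forall n x, `|f_ n x| <= g x) -> igr g ->
  Int (f_ n) @[n --> \oo] --> Int f.
Proof.
move=> mf ff fg Ig.
have If : igr f by exact: igr_dct Ig.
have mfE n : measurable_fun setT (EFin \o f_ n) by exact/measurable_EFinP.
apply: fine_cvg; rewrite fineK; last exact: integrable_fin_num.
apply: (@dominated_cvg _ _ _ (@lebesgue_measure R) setT measurableT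
  (fun n => EFin \o f_ n) (EFin \o f) (EFin \o g)) => //.
- by move=> x _; apply: cvg_EFin; [exact: nearW|exact: ff].
- by move=> n x _ /=; rewrite lee_fin.
Qed.

(** This turns dominated convergence along sequences into continuity of integrals in a real
    parameter. *)
Lemma cvg_seqP R (f : R -> R) (p l : R) :
  (f x @[x --> p] --> l) <->
  (forall u : nat -> R, u n @[n --> \oo] --> p -> f (u n) @[n --> \oo] --> l).
Proof. exact: (@cvg_nbhsP R R^o f p l). Qed.

Lemma continuous_Int R (f : R -> R -> R) (g : R -> R) :
  (forall x, measurable_fun setT (f x)) ->
  (forall y, continuous (fun x => f x y)) ->
  (forall x y, `|f x y| <= g y) -> igr g ->
  continuous (fun x => Int (f x)).
Proof.
move=> mf cf fg Ig x; apply/cvg_seqP => u ux.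
apply: (@Int_dct _ (fun n => f (u n)) _ g) => // y.
exact: (cvg_seqP _ _ _).1 (cf y x) u ux.
Qed.


Lemma derive1_affine R (a b : R) :
  (fun x : R => a * x + b)^`()%classic = cst a.
Proof.
apply/funext => x; rewrite derive1E deriveD// derive_cst addr0.
by rewrite deriveMl// derive_id mulr1.
Qed.

Lemma ge0_integral_affine R (a b : R) (f : R -> R) : 0 < a ->
  continuous f -> (forall x, 0 <= f x) ->
  (\int[@lebesgue_measure R]_x (f x)%:E =
   \int[@lebesgue_measure R]_x (f (a * x + b) * a)%:E)%E.
Proof.
move=> a0 cf f0.
have abE : (fun x => a * x + b) = (fun x => a * (x + b / a)).
  by apply/funext => x; rewrite mulrDr mulrC [a * (b / a)]mulrC divfK// gt_eqF.
rewrite (@increasing_ge0_integration_by_substitutionT _ (fun x => a * x + b))//.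
- by apply: eq_integral => x _ /=; rewrite derive1_affine.
- by move=> x y xy; rewrite ltrD2r ltr_pM2l.
- by rewrite derive1_affine => ?; exact: cvg_cst.
- by rewrite derive1_affine; exact: is_cvg_cst.
- by rewrite derive1_affine; exact: is_cvg_cst.
- rewrite abE; apply: gt0_cvgMrNy => //; exact: cvg_addrr_Ny.
- rewrite abE; apply: gt0_cvgMry => //; exact: cvg_addrr.
Qed.

Lemma continuous_affine R (a b : R) :
  continuous (fun x : R => a * x + b).
Proof.
by move=> x; apply: cvgD; [apply: cvgM; [exact: cvg_cst|exact: cvg_id]|exact: cvg_cst].
Qed.

Lemma cont_measurable R (f : R -> R) :
  continuous f -> measurable_fun setT f.
Proof. exact: continuous_measurable_fun. Qed.

Lemma continuous_compR R (f h : R -> R) :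
  continuous f -> continuous h -> continuous (fun x => f (h x)).
Proof. by move=> cf ch x; apply: continuous_comp; [exact: ch|exact: cf]. Qed.

Lemma igr_affine R (a b : R) (f : R -> R) : 0 < a ->
  continuous f -> igr f -> igr (fun x => f (a * x + b)).
Proof.
move=> a0 cf If.
have cfa : continuous (fun x => f (a * x + b)).
  by apply: continuous_compR => //; exact: continuous_affine.
apply: (@igr_le _ _ (fun x => a^-1 * (`|f (a * x + b)| * a))).
- exact: cont_measurable.
- by move=> x; rewrite mulrCA mulVf ?mulr1// gt_eqF.
apply: igrZ; apply: ge0_igr.
- apply: measurable_funM => //; apply: measurableT_comp => //.
  exact: cont_measurable.
- by move=> x; rewrite mulr_ge0// ltW.
rewrite -(@ge0_integral_affine _ a b (fun x => `|f x|))//.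
  have /integrableP[_] := If; exact.
by move=> x; apply: cvg_norm; exact: cf.
Qed.

Lemma ge0_Int_affine R (a b : R) (f : R -> R) : 0 < a ->
  continuous f -> (forall x, 0 <= f x) -> igr f ->
  Int f = a * Int (fun x => f (a * x + b)).
Proof.
move=> a0 cf f0 If; rewrite mulrC -IntZr; last exact: igr_affine.
by congr fine; exact: ge0_integral_affine.
Qed.

Lemma Int_affine R (a b : R) (f : R -> R) : 0 < a ->
  continuous f -> igr f ->
  Int f = a * Int (fun x => f (a * x + b)).
Proof.
move=> a0 cf If.
have cn : continuous (fun x => `|f x|) by move=> x; apply: cvg_norm; exact: cf.
have In := igr_norm If.
(* f is the difference of the nonnegative functions |f| + f and |f|, for which the substitution is
   already known. *)
have E1 : Int f = Int (fun x => `|f x| + f x) - Int (fun x => `|f x|).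
  by rewrite IntD// addrC addKr.
have E2 : Int (fun x => f (a * x + b)) =
    Int (fun x => `|f (a * x + b)| + f (a * x + b)) -
    Int (fun x => `|f (a * x + b)|).
  have Ia : igr (fun x => f (a * x + b)) by exact: igr_affine.
  by have -> := IntD (igr_norm Ia) Ia; rewrite [RHS]addrC addKr.
rewrite E1 E2 mulrBr (@ge0_Int_affine _ a b (fun x => `|f x|))//; congr (_ - _).
apply: (@ge0_Int_affine _ a b (fun x => `|f x| + f x)) => //.
- by move=> x; apply: cvgD; [exact: cn|exact: cf].
- by move=> x; rewrite -lerBlDr sub0r -normrN ler_norm.
- exact: igrD.
Qed.

(** By Tonelli, a majorant of product form makes the iterated integral of |f| finite; [Int_fubini]
    and [igr_Int] ask for domination in this form. *)
Lemma integrable_prod_bound R (f : R -> R -> R) (G H : R -> R) :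
  measurable_fun setT (fun z : R * R => f z.1 z.2) ->
  (forall x y, `|f x y| <= G x * H y) -> igr G -> igr H ->
  ((@lebesgue_measure R) \x (@lebesgue_measure R))%E.-integrable setT
    (EFin \o (fun z : R * R => f z.1 z.2)).
Proof.
move=> mf fGH IG IH.
have mf1 x : measurable_fun setT (f x).
  exact: (measurable_fun_pair2 x mf).
have mf2 y : measurable_fun setT (f^~ y).
  exact: (measurable_fun_pair1 y mf).
have mn x : measurable_fun setT (fun y => `|f x y|%:E).
  by apply/measurable_EFinP; exact: measurableT_comp.
have mH x : measurable_fun setT (fun y => (`|G x| * `|H y|)%:E).
  apply/measurable_EFinP; apply: measurable_funM => //.
  by apply: measurableT_comp => //; exact: igr_measurable.
have I1 x : igr (f x) by apply: igr_le (igrZ (G x) IH).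
have I2 y : igr (f^~ y).
  by apply: igr_le (igrZ (H y) IG) => // x; rewrite mulrC.
apply/integrable12ltyP; first exact/measurable_EFinP.
apply: (@le_lt_trans _ _
  (\int[@lebesgue_measure R]_x (`|G x| * Int (fun y => `|H y|))%:E)%E).
  apply: ge0_le_integral => //.
  - by move=> x _; exact: integral_ge0.
  - have mE : measurable_fun setT (fun z : R * R => `|f z.1 z.2|%:E).
      by apply/measurable_EFinP; exact: measurableT_comp.
    have mF := @measurable_fun_fubini_tonelli_F _ _ (measurableTypeR R)
      (measurableTypeR R) R (@lebesgue_measure R) _ mE.
    by apply: mF => z; rewrite lee_fin.
  - apply/measurable_EFinP; apply: measurable_funM => //.
    by apply: measurableT_comp => //; exact: igr_measurable.
  move=> x _ /=; rewrite -IntZ; last exact: igr_norm.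
  rewrite EFin_Int; last by apply: igrZ; exact: igr_norm.
  apply: ge0_le_integral => //.
  - exact: mn.
  - exact: mH.
  - move=> y _; rewrite lee_fin -normrM; apply: le_trans (fGH x y) _.
    exact: ler_norm.
rewrite -EFin_Int ?ltry//.
apply: (@eq_igr _ (fun x => Int (fun y => `|H y|) * `|G x|)) => [x|].
  by rewrite mulrC.
by apply: igrZ; exact: igr_norm.
Qed.

Lemma Int_fubini R (f : R -> R -> R) (G H : R -> R) :
  measurable_fun setT (fun z : R * R => f z.1 z.2) ->
  (forall x y, `|f x y| <= G x * H y) -> igr G -> igr H ->
  Int (fun x => Int (fun y => f x y)) = Int (fun y => Int (fun x => f x y)).
Proof.
move=> mf fGH IG IH.
have I1 x : igr (f x).
  by apply: igr_le (igrZ (G x) IH); first exact: (measurable_fun_pair2 x mf).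
have I2 y : igr (f^~ y).
  apply: igr_le (igrZ (H y) IG); first exact: (measurable_fun_pair1 y mf).
  by move=> x; rewrite mulrC.
have := Fubini (integrable_prod_bound mf fGH IG IH).
rewrite /Int /Rintegral => E.
transitivity (fine (\int[@lebesgue_measure R]_x \int[@lebesgue_measure R]_y
   (f x y)%:E)%E).
  by congr fine; apply: eq_integral => x _; rewrite -EFin_Int.
rewrite [LHS](congr1 fine E).
by congr fine; apply: eq_integral => y _; rewrite -(EFin_Int (I2 y)).
Qed.

Lemma igr_Int R (f : R -> R -> R) (G H : R -> R) :
  measurable_fun setT (fun z : R * R => f z.1 z.2) ->
  (forall x y, `|f x y| <= G x * H y) -> igr G -> igr H ->
  igr (fun x => Int (fun y => f x y)).
Proof.
move=> mf fGH IG IH.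
have I1 x : igr (f x).
  by apply: igr_le (igrZ (G x) IH); first exact: (measurable_fun_pair2 x mf).
have := integrable_fubini_F (integrable_prod_bound mf fGH IG IH).
by apply: eq_integrable => // x _; rewrite /fubini_F /= EFin_Int.
Qed.

Lemma Int_eq0 R (f : R -> R) : igr f -> (forall x, 0 <= f x) ->
  Int f = 0 -> {ae @lebesgue_measure R, forall x, f x = 0}.
Proof.
move=> If f0 I0.
have mf : measurable_fun setT (EFin \o f) by exact: measurable_int If.
have I0' : (\int[@lebesgue_measure R]_x `|(EFin \o f) x|)%E = 0%E.
  under eq_integral do rewrite /= ger0_norm//.
  by rewrite -EFin_Int// I0.
have := (ae_eq_integral_abs (@lebesgue_measure R) measurableT mf).1 I0'.
by apply: filterS => x /(_ Logic.I) /= [].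
Qed.

Lemma Int_gt0 R (f : R -> R) : igr f -> (forall x, 0 < f x) ->
  0 < Int f.
Proof.
move=> If f0; rewrite lt_neqAle Int_ge0 ?andbT; last by move=> x; exact: ltW.
apply/negP => /eqP/esym I0.
have [A [mA A0 sA]] := Int_eq0 If (fun x => ltW (f0 x)) I0.
have : (@lebesgue_measure R) setT = 0%E.
  rewrite (_ : setT = A)//; apply/seteqP; split => // x _; apply: sA => /= fx.
  by have := f0 x; rewrite fx ltxx.
have : (@lebesgue_measure R `[0%R, 1%R] <= lebesgue_measure [set: R])%E.
  by apply: le_measure; rewrite ?inE.
rewrite lebesgue_measure_itv/= lte_fin ltr01 => h E; move: h.
by rewrite E -EFinB lee_fin subr0 ler10.
Qed.

(** * Gaussian averages of functions of positive type *)

Lemma double_sum_cons R (Phi : R -> R) (x : R) (l : seq R) :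
  (forall u, Phi (- u) = Phi u) ->
  \sum_(a <- x :: l) \sum_(b <- x :: l) Phi (a - b) =
  Phi 0 + 2 * \sum_(y <- l) Phi (x - y) +
  \sum_(a <- l) \sum_(b <- l) Phi (a - b).
Proof.
move=> even; rewrite !big_cons subrr.
under [X in _ + X]eq_bigr do rewrite big_cons.
rewrite big_split/= [X in _ + (X + _)](_ : _ = \sum_(y <- l) Phi (x - y)).
  by ring.
by apply: eq_bigr => y _; rewrite -even opprB.
Qed.

Lemma continuous_subr R (s : R) : continuous (fun x : R => x - s).
Proof. by move=> x; apply: cvgB; [exact: cvg_id|exact: cvg_cst]. Qed.

Lemma continuousM_fun R (f g : R -> R) :
  continuous f -> continuous g -> continuous (fun x => f x * g x).
Proof. by move=> cf cg x; apply: cvgM; [exact: cf|exact: cg]. Qed.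

Lemma continuousD_fun R (f g : R -> R) :
  continuous f -> continuous g -> continuous (fun x => f x + g x).
Proof. by move=> cf cg x; apply: cvgD; [exact: cf|exact: cg]. Qed.

Lemma continuousN_fun R (f : R -> R) :
  continuous f -> continuous (fun x => - f x).
Proof. by move=> cf x; apply: cvgN; exact: cf. Qed.

Lemma continuous_cst R (c : R) : continuous (fun _ : R => c).
Proof. by move=> x; exact: cvg_cst. Qed.

Lemma continuousX_fun R (f : R -> R) n :
  continuous f -> continuous (fun x => f x ^+ n).
Proof.
by move=> cf; apply: (@continuous_compR _ (fun x => x ^+ n)) => //; exact: exprn_continuous.
Qed.

Lemma continuous_idf R : continuous (fun x : R => x).
Proof. by move=> x; exact: cvg_id. Qed.

(* Sampling r further points independently from the density w and taking
   expectations in the hypothesis gives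
   S(l) + 2 r sum_l J + r Phi(0) + r (r - 1) I >= 0 for every r, where I is the
   double integral; hence I >= 0. *)
Lemma positive_type_average R (Phi w : R -> R) (M : R) :
  continuous Phi -> (forall u, `|Phi u| <= M) -> (forall u, Phi (- u) = Phi u) ->
  (forall x, 0 <= w x) -> igr w -> Int w = 1 ->
  (forall l : seq R, 0 <= \sum_(x <- l) \sum_(y <- l) Phi (x - y)) ->
  0 <= Int (fun s => Int (fun x => Phi (x - s) * w x) * w s).
Proof.
move=> cP PM even w0 Iw w1 pos.
have cPs s : continuous (fun x => Phi (x - s)).
  by apply: continuous_compR => //; exact: continuous_subr.
have IPs s : igr (fun x => Phi (x - s) * w x).
  by apply: (@igr_bounded_mul _ _ _ M) => //; exact: cont_measurable.
pose J s := Int (fun x => Phi (x - s) * w x).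
have cJ : continuous J.
  apply: (@continuous_Int _ _ (fun x => M * w x)).
  - by move=> s; exact: igr_measurable.
  - move=> y; apply: continuousM_fun; last exact: continuous_cst.
    apply: continuous_compR => // s; apply: cvgB; [exact: cvg_cst|exact: cvg_id].
  - by move=> s x; rewrite normrM (ger0_norm (w0 x)) ler_wpM2r.
  - exact: igrZ.
have JM s : `|J s| <= M.
  apply: le_trans (norm_Int (IPs s)) _.
  rewrite -[leRHS]mulr1 -w1 -IntZ//; apply: le_Int.
  - exact: igr_norm.
  - exact: igrZ.
  - by move=> x; rewrite normrM (ger0_norm (w0 x)) ler_wpM2r.
have IJ : igr (fun s => J s * w s).
  by apply: (@igr_bounded_mul _ _ _ M) => //; exact: cont_measurable.
set I := Int _; rewrite -/J in I *.
have step (r : nat) : forall l : seq R,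
    0 <= \sum_(x <- l) \sum_(y <- l) Phi (x - y) +
    2 * r%:R * \sum_(x <- l) J x + r%:R * M + r%:R * (r%:R - 1) * I.
  (* One more point x is drawn from w: the inequality for [x :: l] is multiplied by [w x] and
     integrated over x, with [Phi 0] replaced by its bound M. *)
  elim: r => [|r IH] l; first by rewrite mulr0 !mul0r !addr0.
  set S := \sum_(x <- l) \sum_(y <- l) _; set T := \sum_(x <- l) J x.
  pose c := M + S + 2 * r%:R * T + r%:R * M + r%:R * (r%:R - 1) * I.
  have pw x : 0 <= c * w x + 2 * (\sum_(y <- l) Phi (x - y) * w x) +
      2 * r%:R * (J x * w x).
    rewrite -mulr_suml.
    have := IH (x :: l); rewrite double_sum_cons// big_cons -/S -/T.
    move=> h; rewrite -(pmulr_rge0 _ (@ltr01 R)) mul1r.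
    have -> : c * w x + 2 * ((\sum_(i <- l) Phi (x - i)) * w x) +
      2 * r%:R * (J x * w x) = (c + 2 * \sum_(i <- l) Phi (x - i) +
      2 * r%:R * J x) * w x by ring.
    apply: mulr_ge0 => //; apply: le_trans h _.
    rewrite -subr_ge0 /c.
    apply: (@eq_ge0 _ (M - Phi 0)); first by ring.
    by rewrite subr_ge0; apply: le_trans (PM 0); exact: ler_norm.
  have := Int_ge0 pw.
  rewrite IntD; last 2 first.
  - by apply: igrD; apply: igrZ => //; exact: igr_sum.
  - exact: igrZ.
  rewrite IntD; last 2 first.
  - exact: igrZ.
  - by apply: igrZ; exact: igr_sum.
  rewrite !IntZ//; last exact: igr_sum.
  rewrite Int_sum// w1 -/T -/I.
  by apply: eq_ge0; rewrite /c -natr1; ring.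
have M0 : 0 <= M by apply: le_trans (PM 0).
rewrite leNgt; apply/negP => I0.
(* On the empty list the inequality for n + 1 points is (n + 1) (M + n I) >= 0, which fails as soon
   as M < - n I. *)
have [n nM] : exists n : nat, M < n%:R * - I.
  have nI : 0 < - I by rewrite oppr_gt0.
  exists (Num.truncn (M / - I)).+1.
  by rewrite -ltr_pdivrMr// truncnS_gt.
have := step n.+1 [::]; rewrite !big_nil mulr0 addr0 add0r -mulrA -mulrDr.
rewrite pmulr_rge0// -natr1 addrK leNgt => /negP; apply.
by rewrite -ltrBrDr sub0r -mulrN.
Qed.

Lemma igr_gauss R (c : R) : 0 < c ->
  igr (fun x => expR (- (c * x ^+ 2))).
Proof.
move=> c0; have sc : 0 < Num.sqrt c by rewrite sqrtr_gt0.
have := igr_affine 0 sc (@continuous_gauss_fun R) (@integrableT_gauss R).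
apply: eq_igr => x; rewrite /gauss_fun addr0 exprMn sqr_sqrtr//.
exact: ltW.
Qed.

Lemma continuous_gauss R (c : R) :
  continuous (fun x : R => expR (- (c * x ^+ 2))).
Proof.
apply: (@continuous_compR _ expR); first exact: continuous_expR.
apply: continuousN_fun; apply: continuousM_fun; first exact: continuous_cst.
by apply: continuousX_fun; exact: continuous_idf.
Qed.

(** In the double average with Gaussian weight of parameter 2 eta, integrating out the position of
    the pair leaves a Gaussian of parameter eta in the difference. *)
Lemma gauss_average R (Phi : R -> R) (M eta : R) :
  continuous Phi -> (forall u, `|Phi u| <= M) -> (forall u, Phi (- u) = Phi u) ->
  (forall l : seq R, 0 <= \sum_(x <- l) \sum_(y <- l) Phi (x - y)) ->
  0 < eta -> 0 <= Int (fun u => Phi u * expR (- (eta * u ^+ 2))).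
Proof.
move=> cP PM even pos eta0.
pose e c (x : R) := expR (- (c * x ^+ 2)).
have e2 : 0 < 2 * eta by rewrite mulr_gt0.
have K0 : 0 < Int (e (2 * eta)).
  by apply: Int_gt0; [exact: igr_gauss|move=> x; exact: expR_gt0].
pose c := (Int (e (2 * eta)))^-1.
have c0 : 0 < c by rewrite invr_gt0.
pose w x := c * e (2 * eta) x.
have Iw : igr w by apply: igrZ; exact: igr_gauss.
have cw : continuous w.
  by apply: continuousM_fun; [exact: continuous_cst|exact: continuous_gauss].
have w0 x : 0 <= w x by rewrite mulr_ge0 ?expR_ge0// ltW.
have w1 : Int w = 1.
  by rewrite /w IntZ; [rewrite mulVf// gt_eqF|exact: igr_gauss].
have := positive_type_average cP PM even w0 Iw w1 pos.
have IPs s : igr (fun x => Phi (x - s) * w x).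
  apply: (@igr_bounded_mul _ _ _ M) => //; apply: cont_measurable.
  by apply: continuous_compR => //; exact: continuous_subr.
pose K := Int (e (4 * eta)).
have K40 : 0 < K.
  apply: Int_gt0; last by move=> x; exact: expR_gt0.
  by apply: igr_gauss; rewrite mulr_gt0.
rewrite (_ : Int _ = c ^+ 2 * K * Int (fun u => Phi u * e eta u)); last first.
  transitivity (Int (fun s => Int (fun u => Phi u * w (u + s) * w s))).
    apply: eq_Int => s.
    rewrite (@Int_affine _ 1 s (fun x => Phi (x - s) * w x))//; last first.
      apply: continuousM_fun => //.
      by apply: continuous_compR => //; exact: continuous_subr.
    rewrite mul1r -IntZr.
      by apply: eq_Int => u; rewrite mul1r addrK.
    have := igr_affine s ltr01 _ (IPs s); apply.
    apply: continuousM_fun => //.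
    by apply: continuous_compR => //; exact: continuous_subr.
  (* Completing the square in 2 eta ((u + s)^2 + s^2) separates the difference u from the centre s +
     u / 2. *)
  have ww u s : w (u + s) * w s = c ^+ 2 * e eta u * e (4 * eta) (1 * s + u / 2).
    rewrite /w /e mulrACA -expr2 -[RHS]mulrA -!expRD mul1r; congr (_ * expR _).
    by field.
  rewrite (@Int_fubini _ _ (fun s => c ^+ 2 * M * e eta s)
      (fun u => e (eta / 2) u)); last 4 first.
  - have m1 : measurable_fun setT (fun z : R * R => z.1) by exact: measurable_fst.
    have m2 : measurable_fun setT (fun z : R * R => z.2) by exact: measurable_snd.
    apply: measurable_funM.
      apply: measurable_funM.
        by apply: measurableT_comp => //; exact: cont_measurable.
      apply: measurableT_comp; first exact: cont_measurable.
      exact: measurable_funD.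
    by apply: measurableT_comp => //; exact: cont_measurable.
  - move=> s u; have ww0 : 0 <= w (u + s) * w s by rewrite mulr_ge0.
    rewrite -[X in `|X|]mulrA normrM (ger0_norm ww0).
    rewrite [leRHS](_ : _ = M * (c ^+ 2 * (e eta s * e (eta / 2) u))); last by ring.
    apply: ler_pM => //; rewrite /w /e mulrACA -expr2 -!expRD; rewrite ler_pM2l ?exprn_gt0//.
    (* The exponent 2 eta ((u + s)^2 + s^2) is at least eta s^2 + (eta / 2) u^2, which gives an
       integrable majorant of product form. *)
    rewrite ler_expR -subr_ge0.
    apply: (@eq_ge0 _ (2 * eta * (3 / 4 * (u + 4 / 3 * s) ^+ 2 + 1 / 6 * s ^+ 2))).
      by field.
    rewrite mulr_ge0 ?(ltW e2)// addr_ge0// mulr_ge0 ?sqr_ge0//; lra.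
  - by apply: igrZ; exact: igr_gauss.
  - by apply: igr_gauss; rewrite divr_gt0.
  rewrite -IntZ; last first.
    apply: (@igr_bounded_mul _ _ _ M) => //; first exact: cont_measurable.
    exact: igr_gauss.
  apply: eq_Int => u.
  have I4 : igr (e (4 * eta)) by apply: igr_gauss; rewrite mulr_gt0.
  have c4 : continuous (e (4 * eta)) by exact: continuous_gauss.
  rewrite /K (@Int_affine _ 1 (u / 2) (e (4 * eta)))// mul1r.
  rewrite [RHS](_ : _ = c ^+ 2 * (Phi u * e eta u) *
    Int (fun x => e (4 * eta) (1 * x + u / 2))); last by ring.
  rewrite -IntZ; last exact: igr_affine.
  by apply: eq_Int => s; rewrite -mulrA ww; ring.
by rewrite pmulr_rge0// mulr_gt0// exprn_gt0.
Qed.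

(** * Polar coordinates *)

(** Half-line integrals are written as integrals over R with this factor, so that all rules for
    [Int] apply to them. *)
Definition heaviside R (x : R) : R := (0 <= x)%R%:R.

Lemma measurable_heaviside R :
  measurable_fun setT (@heaviside R).
Proof.
have -> : @heaviside R = \1_(`[0, +oo[%classic : set R).
  apply/funext => x; rewrite indicE /heaviside; congr (_%:R).
  congr nat_of_bool; apply/idP/idP; rewrite inE/= in_itv/= andbT//.
exact: measurable_indic.
Qed.

Lemma heaviside_patch R (f : R -> R) :
  (fun x => heaviside x * f x) = f \_ `[0, +oo[%classic.
Proof.
apply/funext => x; rewrite /heaviside patchE.
case: (lerP 0 x) => x0; first by rewrite mem_set ?mul1r//= in_itv/= x0.
rewrite mul0r ifF//; apply/negP; rewrite inE/= in_itv/= andbT leNgt x0//.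
Qed.

Lemma integral_heaviside R (f : R -> R) :
  (\int[@lebesgue_measure R]_x (heaviside x * f x)%:E =
   \int[@lebesgue_measure R]_(x in `[0%R, +oo[) (f x)%:E)%E.
Proof.
rewrite [RHS]integral_mkcond; apply: eq_integral => x _.
by rewrite (congr1 (fun h => h x) (heaviside_patch f)) restrict_EFin.
Qed.

Lemma nd_itv0 R (u : nat -> R) : nondecreasing_seq u ->
  nondecreasing_seq (fun n => `[0, u n]%classic).
Proof.
move=> nd m n mn; rewrite subsetEset => x/=; rewrite !in_itv/= => /andP[-> xu]/=.
by rewrite (le_trans xu)// nd.
Qed.

Lemma ge0_integral_itv0_cvg R (f : R -> R) (u : nat -> R) :
  continuous f -> (forall x, 0 <= f x) -> nondecreasing_seq u ->
  (forall x, exists n, x <= u n) ->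
  (\int[@lebesgue_measure R]_(x in `[0%R, u n]) (f x)%:E)%E @[n --> \oo] -->
  (\int[@lebesgue_measure R]_(x in `[0%R, +oo[) (f x)%:E)%E.
Proof.
move=> cf f0 nd uoo.
rewrite (_ : `[0%R, +oo[%classic = \bigcup_n `[0, u n]%classic); last first.
  apply/seteqP; split => x /=; rewrite in_itv/= ?andbT.
    by move=> x0; have [n xn] := uoo x; exists n => //=; rewrite in_itv/= x0.
  by move=> [n _] /=; rewrite in_itv/= => /andP[].
apply: ge0_nondecreasing_set_cvg_integral => //.
- exact: nd_itv0.
- move=> n; apply/measurable_EFinP; apply: measurable_funTS.
  exact: cont_measurable.
- by move=> n x _; rewrite lee_fin.
Qed.

Lemma derive1_sqr R (b : R) :
  (fun x : R => b * x ^+ 2)^`()%classic = (fun x => b * (2 * x)).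
Proof.
apply/funext => x; rewrite derive1E deriveMl//; congr (_ * _).
by rewrite exp_derive expr1 /GRing.scale/= mulr1.
Qed.

(** The derivative of b x^2 is unbounded, so the substitution is made on [0, n], followed by
    monotone convergence; the absolute value keeps the integrand nonnegative on R. *)
Lemma ge0_integral_sqr R (F : R -> R) (b : R) : 0 < b ->
  continuous F -> (forall x, 0 <= F x) ->
  (\int[@lebesgue_measure R]_(x in `[0%R, +oo[) (F x)%:E =
   \int[@lebesgue_measure R]_(x in `[0%R, +oo[) (b * (F (b * x ^+ 2) * (2 * `|x|)))%:E)%E.
Proof.
move=> b0 cF F0.
have b2 : continuous (fun x : R => b * x ^+ 2).
  apply: continuousM_fun; first exact: continuous_cst.
  by apply: continuousX_fun; exact: continuous_idf.
have cG : continuous (fun x : R => b * (F (b * x ^+ 2) * (2 * `|x|))).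
  apply: continuousM_fun; first exact: continuous_cst.
  apply: continuousM_fun; first exact: continuous_compR.
  by apply: continuousM_fun; [exact: continuous_cst|exact: norm_continuous].
have nduoo : nondecreasing_seq (fun n => b * (n%:R : R) ^+ 2).
  by move=> m n mn; rewrite ler_pM2l// ler_pXn2r ?nnegrE// ler_nat.
have c1 := @ge0_integral_itv0_cvg _ F (fun n => b * n%:R ^+ 2) cF F0 nduoo.
have c2 := @ge0_integral_itv0_cvg _ (fun x : R => b * (F (b * x ^+ 2) * (2 * `|x|)))
  (fun n => n%:R) cG.
have E n : (\int[@lebesgue_measure R]_(x in `[0%R, (b * n%:R ^+ 2)%R]) (F x)%:E =
   \int[@lebesgue_measure R]_(x in `[0%R, n%:R]) (b * (F (b * x ^+ 2) * (2 * `|x|)))%:E)%E.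
  have := @integration_by_substitution_increasing R (fun x => b * x ^+ 2) F 0 n%:R.
  rewrite expr0n/= mulr0 => ->//.
  - apply: eq_integral => x; rewrite inE/= in_itv/= => /andP[x0 _].
    rewrite derive1_sqr ger0_norm//.
    transitivity ((F (b * x ^+ 2) * (b * (2 * x)))%:E); first by [].
    by congr EFin; ring.
  - move=> x y; rewrite !in_itv/= => /andP[x0 _] /andP[y0 _] xy.
    by rewrite ltr_pM2l// ltr_pXn2r.
  - move=> x _; rewrite derive1_sqr.
    apply: continuousM_fun; first exact: continuous_cst.
    by apply: continuousM_fun; [exact: continuous_cst|exact: continuous_idf].
  - rewrite derive1_sqr; apply/cvg_ex; eexists; apply: cvg_at_right_filter.
    apply: cvgM; first exact: cvg_cst.
    by apply: cvgM; [exact: cvg_cst|exact: cvg_id].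
  - rewrite derive1_sqr; apply/cvg_ex; eexists; apply: cvg_at_left_filter.
    apply: cvgM; first exact: cvg_cst.
    by apply: cvgM; [exact: cvg_cst|exact: cvg_id].
  - split => //.
    + by apply: cvg_at_right_filter; exact: b2.
    + by apply: cvg_at_left_filter; exact: b2.
  - exact: continuous_subspaceT.
have nat_unb (x : R) : exists n, x <= n%:R.
  exists (Num.truncn x).+1; exact/ltW/truncnS_gt.
have hb (x : R) : exists n, x <= b * n%:R ^+ 2.
  have [n xn] := nat_unb (Num.max 1 (x / b)).
  exists n; rewrite mulrC -ler_pdivrMr//.
  move: xn; rewrite ge_max => /andP[n1 xn]; apply: le_trans xn _.
  by rewrite expr2 ler_peMr// (le_trans ler01).
have {}c1 := c1 hb.
have {}c2 := c2 (fun x => mulr_ge0 (ltW b0) (mulr_ge0 (F0 _)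
  (mulr_ge0 (ler0n _ 2) (normr_ge0 x)))) _ nat_unb.
rewrite -(cvg_lim _ c1)// -(cvg_lim _ (c2 _))//; last first.
  by move=> m n mn; rewrite ler_nat.
by congr (lim (_ @ \oo)); apply/funext => n; exact: E.
Qed.

Lemma ge0_integral_norm_sqr R (F : R -> R) (b : R) : 0 < b ->
  continuous F -> (forall x, 0 <= F x) ->
  (\int[@lebesgue_measure R]_x (`|x| * F (b * x ^+ 2))%:E =
   b^-1%:E * \int[@lebesgue_measure R]_(x in `[0%R, +oo[) (F x)%:E)%E.
Proof.
move=> b0 cF F0; rewrite (ge0_integral_sqr b0 cF F0).
have cG : continuous (fun x : R => `|x| * F (b * x ^+ 2)).
  apply: continuousM_fun; first exact: norm_continuous.
  apply: continuous_compR => //.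
  apply: continuousM_fun; first exact: continuous_cst.
  by apply: continuousX_fun; exact: continuous_idf.
rewrite ge0_symfun_integralT//; first last.
- by move=> x /=; rewrite normrN sqrrN.
- by move=> x; rewrite mulr_ge0.
rewrite (_ : [set x | _] = `[0, +oo[%classic); last first.
  by apply/seteqP; split => x/=; rewrite in_itv/= andbT.
rewrite -!ge0_integralZl//.
- by apply: eq_integral => x _; rewrite -EFinM; congr EFin; field; rewrite gt_eqF.
- apply/measurable_EFinP; apply: measurable_funTS; apply: cont_measurable.
  apply: continuousM_fun; first exact: continuous_cst.
  have -> : (fun x => F (b * x ^+ 2) * (2 * `|x|)) =
     (fun x => 2 * (`|x| * F (b * x ^+ 2))) by apply/funext => x; ring.
  by apply: continuousM_fun; first exact: continuous_cst.
- by move=> x _; rewrite lee_fin !mulr_ge0// ltW.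
- by rewrite lee_fin invr_ge0 ltW.
- by apply/measurable_EFinP; apply: measurable_funTS; exact: cont_measurable.
- by move=> x _; rewrite lee_fin mulr_ge0.
Qed.

Lemma integral_oneDsqrV R :
  (\int[@lebesgue_measure R]_x ((1 + x ^+ 2)^-1)%:E = pi%:E)%E.
Proof.
rewrite (@ge0_symfun_integralT _ (fun x => (1 + x ^+ 2)^-1)).
- rewrite (_ : [set x | _] = `[0, +oo[%classic); last first.
    by apply/seteqP; split => x/=; rewrite in_itv/= andbT.
  have := @integral0y_oneDsqr R; rewrite /oneDsqr => ->.
  by rewrite -EFinM mulrC divfK.
- by move=> x; rewrite invr_ge0 addr_ge0// sqr_ge0.
- exact: (@continuous_oneDsqrV R).
- by move=> x /=; rewrite sqrrN.
Qed.

Lemma igr_oneDsqrV R : igr (fun x : R => (1 + x ^+ 2)^-1).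
Proof.
apply: ge0_igr; last by rewrite integral_oneDsqrV ltry.
  by apply: cont_measurable; exact: (@continuous_oneDsqrV R).
by move=> x; rewrite invr_ge0 addr_ge0// sqr_ge0.
Qed.

(* The substitution v = |u| w turns the planar integral into an integral over
   u of |u| F(u^2 (1 + w^2)), for each slope w. *)
Lemma ge0_integral_radial R (F : R -> R) :
  continuous F -> (forall x, 0 <= F x) ->
  (\int[@lebesgue_measure R]_(x in `[0%R, +oo[) (F x)%:E < +oo)%E ->
  (\int[@lebesgue_measure R]_u \int[@lebesgue_measure R]_v (F (u ^+ 2 + v ^+ 2))%:E =
   pi%:E * \int[@lebesgue_measure R]_(x in `[0%R, +oo[) (F x)%:E)%E.
Proof.
move=> cF F0 Foo.
have Fge0 : (0 <= \int[@lebesgue_measure R]_(x in `[0%R, +oo[) (F x)%:E)%E.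
  by apply: integral_ge0 => x _; rewrite lee_fin.
have mz : measurable_fun setT (fun z : R * R => F (z.1 ^+ 2 + z.2 ^+ 2)).
  apply: measurableT_comp; first exact: cont_measurable.
  apply: measurable_funD; apply: measurable_funX; [exact: measurable_fst|exact: measurable_snd].
have mz2 : measurable_fun setT (fun z : R * R => `|z.1| * F ((1 + z.2 ^+ 2) * z.1 ^+ 2)).
  apply: measurable_funM.
    by apply: measurableT_comp => //; exact: measurable_fst.
  apply: measurableT_comp; first exact: cont_measurable.
  apply: measurable_funM.
    apply: measurable_funD => //; apply: measurable_funX; exact: measurable_snd.
  by apply: measurable_funX; exact: measurable_fst.
have mE1 : measurable_fun setT (fun z : R * R => (F (z.1 ^+ 2 + z.2 ^+ 2))%:E).
  exact/measurable_EFinP.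
have mE2 : measurable_fun setT
   (fun z : R * R => (`|z.1| * F ((1 + z.2 ^+ 2) * z.1 ^+ 2))%:E).
  exact/measurable_EFinP.
have mV : measurable_fun setT (fun x : R => ((1 + x ^+ 2)^-1)%:E).
  by apply/measurable_EFinP; apply: igr_measurable; exact: igr_oneDsqrV.
have mI1 := @measurable_fun_fubini_tonelli_F _ _ (measurableTypeR R)
        (measurableTypeR R) R (@lebesgue_measure R) _ mE1.
have mI2 := @measurable_fun_fubini_tonelli_F _ _ (measurableTypeR R)
        (measurableTypeR R) R (@lebesgue_measure R) _ mE2.
transitivity (\int[@lebesgue_measure R]_u \int[@lebesgue_measure R]_w
   (`|u| * F ((1 + w ^+ 2) * u ^+ 2))%:E)%E.
  apply: ae_eq_integral => //.
  - by apply: mI1 => z; rewrite lee_fin.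
  - by apply: mI2 => z; rewrite lee_fin mulr_ge0.
  (* At u = 0 the substitution v = |u| w degenerates; this single point is a null set. *)
  exists [set 0]; split => //; first exact: lebesgue_measure_set1.
  move=> u /= /not_implyP[_ h]; apply/eqP/negPn/negP => u0; apply: h.
  rewrite (@ge0_integral_affine _ `|u| 0 (fun v => F (u ^+ 2 + v ^+ 2)))//.
  - apply: eq_integral => w _; rewrite mulrC addr0; congr (_ * F _)%:E.
    by rewrite exprMn real_normK ?num_real//; ring.
  - by rewrite normr_gt0.
  - apply: continuous_compR => //; apply: continuousD_fun; first exact: continuous_cst.
    by apply: continuousX_fun; exact: continuous_idf.
rewrite (@fubini_tonelli _ _ (measurableTypeR R) (measurableTypeR R) R
  (@lebesgue_measure R) (@lebesgue_measure R)
  (fun z : R * R => (`|z.1| * F ((1 + z.2 ^+ 2) * z.1 ^+ 2))%:E))//; last first.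
  by move=> z; rewrite lee_fin mulr_ge0.
(* For slope w the integral over u is (1 + w^2)^-1 times that of F, and (1 + w^2)^-1 integrates to
   pi over the slopes. *)
under eq_integral.
  move=> w _; rewrite /= ge0_integral_norm_sqr//; last by rewrite ltr_pwDl// sqr_ge0.
  over.
move: (\int[@lebesgue_measure R]_(x in `[0%R, +oo[) (F x)%:E)%E Foo Fge0
  => C Coo C0.
rewrite -integral_oneDsqrV -ge0_integralZr//.
by move=> x _; rewrite lee_fin invr_ge0 addr_ge0// sqr_ge0.
Qed.

Lemma ge0_Int_radial R (F G H : R -> R) :
  continuous F -> (forall x, 0 <= F x) ->
  (forall u v, F (u ^+ 2 + v ^+ 2) <= G u * H v) -> igr G -> igr H ->
  igr (fun x => heaviside x * F x) ->
  Int (fun u => Int (fun v => F (u ^+ 2 + v ^+ 2))) =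
  pi * Int (fun x => heaviside x * F x).
Proof.
move=> cF F0 FGH IG IH IF.
have mz : measurable_fun setT (fun z : R * R => F (z.1 ^+ 2 + z.2 ^+ 2)).
  apply: measurableT_comp; first exact: cont_measurable.
  apply: measurable_funD; apply: measurable_funX; [exact: measurable_fst|exact: measurable_snd].
have Iv u : igr (fun v => F (u ^+ 2 + v ^+ 2)).
  apply: igr_le (igrZ (G u) IH); first exact: (measurable_fun_pair2 u mz).
  by move=> v; rewrite ger0_norm.
have := @ge0_integral_radial _ F cF F0.
rewrite -integral_heaviside -EFin_Int// ltry => /(_ isT).
under eq_integral do rewrite -(EFin_Int (Iv _)).
by move=> h; rewrite [LHS]/Int /Rintegral h -EFinM.
Qed.

Lemma Int_radial R (F G H : R -> R) :
  continuous F ->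
  (forall u v, `|F (u ^+ 2 + v ^+ 2)| <= G u * H v) -> igr G -> igr H ->
  igr (fun x => heaviside x * F x) ->
  Int (fun u => Int (fun v => F (u ^+ 2 + v ^+ 2))) =
  pi * Int (fun x => heaviside x * F x).
Proof.
move=> cF FGH IG IH IF.
have cn : continuous (fun x => `|F x|).
  by apply: continuous_compR => //; exact: norm_continuous.
have h0 (x : R) : 0 <= heaviside x by rewrite /heaviside ler0n.
have In : igr (fun x => heaviside x * `|F x|).
  by apply: eq_igr (igr_norm IF) => x; rewrite normrM ger0_norm.
have mz (f : R -> R) : continuous f ->
    measurable_fun setT (fun z : R * R => f (z.1 ^+ 2 + z.2 ^+ 2)).
  move=> cf; apply: measurableT_comp; first exact: cont_measurable.
  apply: measurable_funD; apply: measurable_funX.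
    exact: measurable_fst.
  exact: measurable_snd.
have nGH u v : `| `|F (u ^+ 2 + v ^+ 2)| | <= G u * H v by rewrite normr_id.
have Iv (f : R -> R) u : continuous f ->
    (forall u v, `|f (u ^+ 2 + v ^+ 2)| <= G u * H v) ->
    igr (fun v => f (u ^+ 2 + v ^+ 2)).
  move=> cf fGH.
  by apply: igr_le (igrZ (G u) IH); first exact: (measurable_fun_pair2 u (mz f cf)).
have E1 := @ge0_Int_radial _ (fun x => `|F x|) G H cn (fun x => normr_ge0 _) FGH
  IG IH In.
(* The nonnegative case applies to |F| and to |F| + F, whose difference is F; the majorant 2 G H
   covers the second. *)
have E2 : Int (fun u => Int (fun v => `|F (u ^+ 2 + v ^+ 2)| + F (u ^+ 2 + v ^+ 2)))
    = pi * Int (fun x => heaviside x * (`|F x| + F x)).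
  apply: (@ge0_Int_radial _ (fun x => `|F x| + F x) (fun u => 2 * G u) H) => //.
  - exact: continuousD_fun.
  - by move=> x; rewrite -lerBlDr sub0r -normrN ler_norm.
  - move=> u v; rewrite -mulrA mulr_natl mulr2n; apply: lerD => //.
    by apply: le_trans (FGH u v); exact: ler_norm.
  - exact: igrZ.
  - by apply: eq_igr (igrD In IF) => x; rewrite mulrDr.
have E3 : Int (fun u => Int (fun v => `|F (u ^+ 2 + v ^+ 2)| + F (u ^+ 2 + v ^+ 2)))
    = Int (fun u => Int (fun v => `|F (u ^+ 2 + v ^+ 2)|)) +
      Int (fun u => Int (fun v => F (u ^+ 2 + v ^+ 2))).
  rewrite -IntD.
  - apply: eq_Int => u.
    by rewrite (IntD (Iv (fun x => `|F x|) u cn nGH) (Iv F u cF FGH)).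
  - exact: (@igr_Int _ (fun u v => `|F (u ^+ 2 + v ^+ 2)|) G H (mz _ cn)).
  - exact: (@igr_Int _ (fun u v => F (u ^+ 2 + v ^+ 2)) G H (mz _ cF)).
have E4 : Int (fun x => heaviside x * (`|F x| + F x)) =
    Int (fun x => heaviside x * `|F x|) + Int (fun x => heaviside x * F x).
  by rewrite -IntD//; apply: eq_Int => x; rewrite mulrDr.
have : Int (fun u => Int (fun v => F (u ^+ 2 + v ^+ 2))) =
   pi * (Int (fun x => heaviside x * `|F x|) + Int (fun x => heaviside x * F x))
   - pi * Int (fun x => heaviside x * `|F x|).
  by rewrite -E4 -E1 -E2 E3 addrC addKr.
by move=> ->; rewrite mulrDr addrC addKr.
Qed.

(** * Averages over horospheres *)

Lemma heaviside_ge0 R (x : R) : 0 <= heaviside x.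
Proof. by rewrite /heaviside ler0n. Qed.

Lemma heaviside_le1 R (x : R) : heaviside x <= 1.
Proof. by rewrite /heaviside; case: (0 <= x)%R. Qed.

Lemma ge0_integral_halfline R (f : R -> R) (a b : R) : 0 < a ->
  continuous f -> (forall x, 0 <= f x) ->
  (\int[@lebesgue_measure R]_x (heaviside (x - b) * f x)%:E =
   \int[@lebesgue_measure R]_x (heaviside x * (f (a * x + b) * a))%:E)%E.
Proof.
move=> a0 cf f0; rewrite integral_heaviside.
have cfb : continuous (fun x => f (x + b)).
  apply: continuous_compR => //; apply: continuousD_fun.
    exact: continuous_idf.
  exact: continuous_cst.
have -> : (\int[@lebesgue_measure R]_x (heaviside (x - b) * f x)%:E)%E =
    (\int[@lebesgue_measure R]_(x in `[b, +oo[) (f x)%:E)%E.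
  rewrite [RHS]integral_mkcond; apply: eq_integral => x _.
  rewrite restrict_EFin /restrict /heaviside subr_ge0; congr EFin.
  rewrite patchE.
  case: (lerP b x) => bx; first by rewrite mem_set ?mul1r//= in_itv/= bx.
  by rewrite mul0r ifF//; apply/negP; rewrite inE/= in_itv/= andbT leNgt bx.
have := @increasing_ge0_integration_by_substitutiony R (fun x => a * x + b) f 0.
rewrite mulr0 add0r => ->//.
- by apply: eq_integral => x _; rewrite derive1_affine.
- by move=> x y _ _ xy; rewrite ltrD2r ltr_pM2l.
- by rewrite derive1_affine => x _; exact: cvg_cst.
- by rewrite derive1_affine; exact: is_cvg_cst.
- by rewrite derive1_affine; exact: is_cvg_cst.
- split => //; apply: cvg_at_right_filter; exact: continuous_affine.
- have -> : (fun x => a * x + b) = (fun x => a * (x + b / a)).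
    by apply/funext => x; rewrite mulrDr mulrC [a * (b / a)]mulrC divfK// gt_eqF.
  by apply: gt0_cvgMry => //; exact: cvg_addrr.
- exact: continuous_subspaceT.
Qed.

Lemma ge0_Int_halfline R (f : R -> R) (a b : R) : 0 < a ->
  continuous f -> (forall x, 0 <= f x) ->
  Int (fun x => heaviside (x - b) * f x) =
  Int (fun x => heaviside x * (f (a * x + b) * a)).
Proof. by move=> a0 cf f0; congr fine; exact: ge0_integral_halfline. Qed.

Lemma igr_halfline R (f : R -> R) (a b : R) : 0 < a ->
  continuous f -> igr (fun x => heaviside (x - b) * f x) ->
  igr (fun x => heaviside x * f (a * x + b)).
Proof.
move=> a0 cf If.
have cfa : continuous (fun x => f (a * x + b)).
  by apply: continuous_compR => //; exact: continuous_affine.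
have cn : continuous (fun x => `|f x|).
  by apply: continuous_compR => //; exact: norm_continuous.
have mh : measurable_fun setT (fun x => heaviside x * f (a * x + b)).
  by apply: measurable_funM; [exact: measurable_heaviside|exact: cont_measurable].
apply: (@igr_le _ _ (fun x => a^-1 * (heaviside x * (`|f (a * x + b)| * a)))) => //.
  move=> x; rewrite normrM ger0_norm ?heaviside_ge0//.
  by rewrite (_ : _ * (_ * _) = heaviside x * `|f (a * x + b)|)//; field; rewrite gt_eqF.
apply: igrZ; apply: ge0_igr.
- apply: measurable_funM; first exact: measurable_heaviside.
  by apply: measurable_funM => //; apply: measurableT_comp => //; exact: cont_measurable.
- by move=> x; rewrite !mulr_ge0 ?heaviside_ge0// ltW.
rewrite -(@ge0_integral_halfline _ (fun x => `|f x|) a b)//.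
have /integrableP[_] := If; apply: le_lt_trans.
rewrite le_eqVlt; apply/orP; left; apply/eqP; apply: eq_integral => x _ /=.
by rewrite normrM (ger0_norm (heaviside_ge0 _)).
Qed.

Lemma Int_halfline R (f : R -> R) (a b : R) : 0 < a ->
  continuous f -> igr (fun x => heaviside (x - b) * f x) ->
  Int (fun x => heaviside (x - b) * f x) =
  a * Int (fun x => heaviside x * f (a * x + b)).
Proof.
move=> a0 cf If.
have cn : continuous (fun x => `|f x|).
  by apply: continuous_compR => //; exact: norm_continuous.
have In : igr (fun x => heaviside (x - b) * `|f x|).
  by apply: eq_igr (igr_norm If) => x; rewrite normrM ger0_norm// heaviside_ge0.
have cD : continuous (fun x => `|f x| + f x) by exact: continuousD_fun.
have D0 x : 0 <= `|f x| + f x by rewrite -lerBlDr sub0r -normrN ler_norm.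
have E1 := @ge0_Int_halfline _ (fun x => `|f x|) a b a0 cn (fun x => normr_ge0 _).
have E2 := @ge0_Int_halfline _ (fun x => `|f x| + f x) a b a0 cD D0.
have I1 := igr_halfline a0 cn In; have I2 := igr_halfline a0 cf If.
have E3 : Int (fun x => heaviside (x - b) * (`|f x| + f x)) =
   Int (fun x => heaviside (x - b) * `|f x|) + Int (fun x => heaviside (x - b) * f x).
  by rewrite -IntD//; apply: eq_Int => x; rewrite mulrDr.
have E4 : Int (fun x => heaviside x * ((`|f (a * x + b)| + f (a * x + b)) * a)) =
   Int (fun x => heaviside x * (`|f (a * x + b)| * a)) +
   a * Int (fun x => heaviside x * f (a * x + b)).
  rewrite -IntZ// -IntD//; last 2 first.
  - apply: (@eq_igr _ (fun x => a * (heaviside x * `|f (a * x + b)|))) => [x|].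
      by ring.
    exact: igrZ.
  - exact: igrZ.
  by apply: eq_Int => x; ring.
apply: (addrI (Int (fun x => heaviside (x - b) * `|f x|))).
by rewrite -E3 E2 E4 E1.
Qed.

Lemma igr_exp R (c : R) : 0 < c ->
  igr (fun x => heaviside x * expR (- (c * x))).
Proof.
move=> c0; apply: (@eq_igr _ (fun x => c^-1 * exponential_pdf c x)) => [x|].
  rewrite /exponential_pdf -heaviside_patch mulrCA mulKf ?gt_eqF//.
  by rewrite mulNr.
by apply: igrZ; exact: integrable_exponential_pdf.
Qed.

Lemma Int_exp R (c : R) : 0 < c ->
  Int (fun x => heaviside x * expR (- (c * x))) = c^-1.
Proof.
move=> c0; rewrite (@eq_Int _ _ (fun x => c^-1 * exponential_pdf c x)) => [|x].
  rewrite IntZ; last exact: integrable_exponential_pdf.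
  by rewrite /Int /Rintegral integral_exponential_pdf ?mulr1.
rewrite /exponential_pdf -heaviside_patch mulrCA mulKf ?gt_eqF//.
by rewrite mulNr.
Qed.

Lemma igr_exp_bounded R (f : R -> R) (M c : R) : 0 < c ->
  continuous f -> (forall x, `|f x| <= M) ->
  igr (fun x => heaviside x * (f x * expR (- (c * x)))).
Proof.
move=> c0 cf fM; have := igr_bounded_mul (cont_measurable cf) fM (igr_exp c0).
by apply: eq_igr => x; ring.
Qed.

(** For fixed coefficients the double sum is an even function of positive type in the translation
    variable, so [gauss_average] integrates that variable out. *)
Lemma pd_gauss_average R (X : Type) (F : X -> X -> R -> R)
    (m : X -> X -> R) (eta : R) :
  (forall x y, continuous (F x y)) -> (forall x y u, `|F x y u| <= m x y) ->
  (forall x y u, F x y (- u) = F x y u) -> 0 < eta ->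
  pd (fun z z' : R * X => F z.2 z'.2 (z.1 - z'.1)) ->
  pd (fun x y => Int (fun u => F x y u * expR (- (eta * u ^+ 2)))).
Proof.
move=> cF Fm even eta0 pK l.
pose Phi u := \sum_(x <- l) \sum_(y <- l) x.1 * y.1 * F x.2 y.2 u.
pose M := \sum_(x <- l) \sum_(y <- l) `|x.1 * y.1| * m x.2 y.2.
have cPhi : continuous Phi.
  move=> u; apply: cvg_big => [|x _]; first exact: add_continuous.
  apply: cvg_big => [|y _]; first exact: add_continuous.
  by apply: cvgM; [exact: cvg_cst|exact: cF].
have PhiM u : `|Phi u| <= M.
  apply: le_trans (ler_norm_sum _ _ _) _; apply: ler_sum => x _.
  apply: le_trans (ler_norm_sum _ _ _) _; apply: ler_sum => y _.
  by rewrite normrM ler_wpM2l.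
have Phi_even u : Phi (- u) = Phi u.
  by apply: eq_bigr => x _; apply: eq_bigr => y _; rewrite even.
have := gauss_average cPhi PhiM Phi_even _ eta0.
have -> : Int (fun u => Phi u * expR (- (eta * u ^+ 2))) =
  \sum_(x <- l) \sum_(y <- l) x.1 * y.1 *
    Int (fun u => F x.2 y.2 u * expR (- (eta * u ^+ 2))).
  have I1 x y : igr (fun u => F x y u * expR (- (eta * u ^+ 2))).
    apply: igr_bounded_mul (Fm x y) (igr_gauss eta0).
    exact: cont_measurable.
  transitivity (Int (fun u => \sum_(x <- l) \sum_(y <- l)
     x.1 * y.1 * (F x.2 y.2 u * expR (- (eta * u ^+ 2))))).
    apply: eq_Int => u; rewrite mulr_suml; apply: eq_bigr => x _.
    by rewrite mulr_suml; apply: eq_bigr => y _; rewrite mulrA.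
  rewrite Int_sum => [|x]; last by apply: igr_sum => y; exact: igrZ.
  apply: eq_bigr => x _; rewrite Int_sum => [|y]; last exact: igrZ.
  by apply: eq_bigr => y _; rewrite IntZ.
apply => us.
(* Positivity on the points us is that of the kernel on the grid of us and l, with coefficients
   independent of u. *)
have := pK [seq (x.1, (u, x.2)) | u <- us, x <- l].
rewrite big_allpairs_dep/=; apply: eq_ge0; apply: eq_bigr => u _.
under eq_bigr do rewrite big_allpairs_dep/=.
by rewrite exchange_big.
Qed.

(* The Laplace transform of f on the half-line [b, +oo[, normalized at b. *)
Definition laplace R (f : R -> R) (eta b : R) : R :=
  Int (fun r => heaviside r * (f (b + r) * expR (- (eta * r)))).

(** Two Gaussian averages remove x1 and x2; polar coordinates leave a half-line integral in q = x1^2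
    + x2^2, and q = 2 e^(s + s') r turns it into a Laplace transform whose parameter has absorbed
    the scale e^(s + s'). *)
Lemma pd_horo_average R (f : R -> R) (eta : R) :
  continuous f -> (forall x, `|f x| <= 1) -> 0 < eta ->
  pd (fun z z' : R * R * R => (expR (- z.2) + expR (- z'.2)) *
    f (((z.1.1 - z'.1.1) ^+ 2 + (z.1.2 - z'.1.2) ^+ 2) * expR (- (z.2 + z'.2)) / 2
     + (cosh (z.2 - z'.2) - 1))) ->
  pd (fun s s' : R => (expR (- s) + expR (- s')) *
    laplace f (eta * expR (s + s')) (cosh (s - s') - 1)).
Proof.
move=> cf f1 eta0 pK.
pose k (s s' q : R) := (expR (- s) + expR (- s')) *
   f (cosh (s - s') - 1 + expR (- (s + s')) / 2 * q).
have ck s s' : continuous (k s s').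
  apply: continuousM_fun; first exact: continuous_cst.
  apply: continuous_compR => //; apply: continuousD_fun; first exact: continuous_cst.
  by apply: continuousM_fun; [exact: continuous_cst|exact: continuous_idf].
pose m (s s' : R) : R := `|expR (- s) + expR (- s')|.
have km s s' q : `|k s s' q| <= m s s' by rewrite normrM ler_piMr.
have eta2 : 0 < eta / 2 by rewrite divr_gt0.
pose e (x : R) := expR (- (eta / 2 * x ^+ 2)).
have Ie : igr e by exact: igr_gauss.
have enorm u : `|e u| = e u by rewrite ger0_norm ?expR_ge0.
have c1 (v : R) s s' : continuous (fun u : R => k s s' (u ^+ 2 + v ^+ 2)).
  apply: continuous_compR => //; apply: continuousD_fun.
    by apply: continuousX_fun; exact: continuous_idf.
  exact: continuous_cst.
have c2 (u : R) s s' : continuous (fun v : R => k s s' (u ^+ 2 + v ^+ 2)).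
  apply: continuous_compR => //; apply: continuousD_fun.
    exact: continuous_cst.
  by apply: continuousX_fun; exact: continuous_idf.
have I1 v s s' : igr (fun u => k s s' (u ^+ 2 + v ^+ 2) * e u).
  by apply: (@igr_bounded_mul _ _ _ (m s s')) => //; exact: cont_measurable.
have p1 : pd (fun z z' : R * R => Int (fun u =>
    k z.2 z'.2 (u ^+ 2 + (z.1 - z'.1) ^+ 2) * e u)).
  apply: (@pd_gauss_average _ _
    (fun z z' u => k z.2 z'.2 (u ^+ 2 + (z.1 - z'.1) ^+ 2))
    (fun z z' => m z.2 z'.2)) => //.
  - by move=> z z' u; rewrite sqrrN.
  - have := pd_comp (fun z : R * (R * R) => ((z.1, z.2.1), z.2.2)) pK.
    by apply: eq_pd => x y /=; rewrite /k; congr (_ * f _); ring.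
pose Xi s s' v := Int (fun u => k s s' (u ^+ 2 + v ^+ 2) * e u).
have cXi s s' : continuous (Xi s s').
  apply: (@continuous_Int _ _ (fun u => m s s' * e u)).
  - by move=> v; exact: igr_measurable.
  - by move=> u; apply: continuousM_fun; [exact: c2|exact: continuous_cst].
  - by move=> v u; rewrite normrM enorm ler_wpM2r ?expR_ge0.
  - exact: igrZ.
have XiM s s' v : `|Xi s s' v| <= m s s' * Int e.
  apply: le_trans (norm_Int (I1 _ _ _)) _; rewrite -IntZ//; apply: le_Int.
  - exact: igr_norm.
  - exact: igrZ.
  - by move=> u; rewrite normrM enorm ler_wpM2r ?expR_ge0.
have p2 : pd (fun s s' => Int (fun v => Xi s s' v * e v)).
  apply: (@pd_gauss_average _ _ Xi (fun s s' => m s s' * Int e)) => //.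
  by move=> s s' v; rewrite /Xi; apply: eq_Int => u; rewrite sqrrN.
have E s s' : Int (fun v => Xi s s' v * e v) =
    pi * ((expR (- s) + expR (- s')) * (2 * expR (s + s') *
      laplace f (eta * expR (s + s')) (cosh (s - s') - 1))).
  pose F q := k s s' q * expR (- (eta / 2 * q)).
  have FE u v : F (u ^+ 2 + v ^+ 2) = k s s' (v ^+ 2 + u ^+ 2) * e v * e u.
    by rewrite /F addrC mulrDr opprD expRD mulrA.
  have cF : continuous F.
    apply: continuousM_fun => //; apply: (@continuous_compR _ expR).
      exact: continuous_expR.
    apply: continuousN_fun; apply: continuousM_fun; first exact: continuous_cst.
    exact: continuous_idf.
  transitivity (Int (fun u => Int (fun v => F (u ^+ 2 + v ^+ 2)))).
    by apply: eq_Int => u; rewrite -IntZr//; apply: eq_Int => v; rewrite FE.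
  rewrite (@Int_radial _ F (fun u => m s s' * e u) e)//; last 3 first.
  - move=> u v; rewrite FE normrM normrM !enorm mulrAC.
    by rewrite ler_wpM2r ?expR_ge0// ler_wpM2r ?expR_ge0//; exact: km.
  - exact: igrZ.
  - exact: igr_exp_bounded (km s s').
  congr (_ * _).
  (* The scale for which q = w r makes the argument of f equal to cosh (s - s') - 1 + r. *)
  pose w : R := 2 * expR (s + s').
  have w0 : 0 < w by rewrite mulr_gt0 ?expR_gt0.
  pose G q := F q.
  have IF : igr (fun x => heaviside (x - 0) * F x).
    have := igr_exp_bounded eta2 (ck s s') (km s s').
    by apply: eq_igr => x; rewrite subr0.
  have := Int_halfline w0 cF IF; under eq_Int do rewrite subr0.
  move=> ->; rewrite [RHS]mulrCA -/w; congr (_ * _).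
  rewrite /laplace -IntZ; last first.
    apply: (@igr_exp_bounded _ (fun r => f (cosh (s - s') - 1 + r)) 1) => //.
      by rewrite mulr_gt0 ?expR_gt0.
    apply: continuous_compR => //; apply: continuousD_fun.
      exact: continuous_cst.
    exact: continuous_idf.
  apply: eq_Int => r; rewrite addr0 /F /k.
  have -> : expR (- (s + s')) / 2 * (w * r) = (expR (s + s') * expR (- (s + s'))) * r.
    by rewrite /w; field.
  rewrite expRxMexpNx_1 mul1r.
  have -> : eta / 2 * (w * r) = eta * expR (s + s') * r by rewrite /w; field.
  by ring.
(* The Jacobian 2 e^(s + s') is, up to the constant, a product of functions of s and of s', so
   congruence with e^-s removes it. *)
have c0 : 0 <= (2 * pi)^-1 :> R by rewrite invr_ge0 mulr_ge0 ?pi_ge0.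
have := pd_scale c0 (pd_map (fun s => expR (- s)) id p2).
apply: eq_pd => s s' /=; rewrite E expRD.
have e1 := expRxMexpNx_1 s; have e2 := expRxMexpNx_1 s'.
move: (laplace _ _ _) => L.
have p0 : pi != 0 :> R by rewrite gt_eqF// pi_gt0.
transitivity ((expR s * expR (- s)) * (expR s' * expR (- s')) *
   ((expR (- s) + expR (- s')) * L)); last by rewrite e1 e2 !mul1r.
move: p0; move: (@pi R) (expR s) (expR s') (expR (- s)) (expR (- s')) => p a b c d p0.
by field; exact: p0.
Qed.

(** * The improper integral of g *)

(** For x <= y this is the indicator of [x, y[; written as a difference it telescopes. *)
Definition indco R (x y r : R) : R :=
  heaviside (r - x) - heaviside (r - y).

Lemma indcoE R (x y r : R) : x <= y ->
  indco x y r = (x <= r < y)%R%:R.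
Proof.
move=> xy; rewrite /indco /heaviside !subr_ge0.
case: (lerP x r) => xr /=; last by rewrite [y <= r]leNgt (lt_le_trans xr)// subrr.
by case: (lerP y r) => yr; rewrite ?subrr ?subr0.
Qed.

Lemma indco_ge0 R (x y r : R) : x <= y -> 0 <= indco x y r.
Proof. by move=> xy; rewrite indcoE// ler0n. Qed.

Lemma indco_set R (x y : R) : x <= y ->
  indco x y = \1_(`[x, y[%classic : set R).
Proof.
move=> xy; apply/funext => r; rewrite indcoE// indicE; congr (nat_of_bool _)%:R.
by apply/idP/idP; rewrite inE/= in_itv/=.
Qed.

Lemma measurable_indco R (x y : R) : x <= y ->
  measurable_fun setT (indco x y).
Proof. by move=> xy; rewrite indco_set//; exact: measurable_indic. Qed.

Lemma igr_indco R (x y : R) : x <= y -> igr (indco x y).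
Proof.
by move=> xy; rewrite /igr indco_set//; exact: integrable_indic_itv.
Qed.

Lemma Int_indco R (x y : R) : x <= y -> Int (indco x y) = y - x.
Proof.
move=> xy; rewrite indco_set// /Int /Rintegral integral_indic//= setIT.
rewrite lebesgue_measure_itv/= lte_fin; case: ifPn => //.
by rewrite -leNgt => yx; rewrite (@le_anti _ _ x y) ?subrr// xy.
Qed.

Lemma igr_indco_mul R (f : R -> R) (x y : R) : x <= y ->
  measurable_fun setT f -> (forall r, `|f r| <= 1) ->
  igr (fun r => indco x y r * f r).
Proof.
move=> xy mf f1; apply: (@eq_igr _ (fun r => f r * indco x y r)) => [r|].
  by rewrite mulrC.
by apply: igr_bounded_mul f1 _ => //; exact: igr_indco.
Qed.

Definition primitive R (f : R -> R) (b : R) : R :=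
  Int (fun r => indco 0 b r * f r).

Lemma primitiveB R (f : R -> R) (x y : R) : 0 <= x -> x <= y ->
  measurable_fun setT f -> (forall r, `|f r| <= 1) ->
  primitive f y - primitive f x = Int (fun r => indco x y r * f r).
Proof.
move=> x0 xy mf f1; rewrite /primitive -IntB.
- by apply: eq_Int => r; rewrite /indco; ring.
- by apply: igr_indco_mul => //; exact: le_trans x0 xy.
- exact: igr_indco_mul.
Qed.

Lemma norm_Int_indco R (f : R -> R) (x y M : R) : x <= y ->
  measurable_fun setT f -> (forall r, `|f r| <= 1) ->
  (forall r, x <= r < y -> `|f r| <= M) ->
  `|Int (fun r => indco x y r * f r)| <= M * (y - x).
Proof.
move=> xy mf f1 fM; have If := igr_indco_mul xy mf f1.
apply: le_trans (norm_Int If) _.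
rewrite -Int_indco// -IntZ; last exact: igr_indco.
apply: le_Int; [exact: igr_norm|by apply: igrZ; exact: igr_indco|].
move=> r; rewrite normrM ger0_norm ?indco_ge0// mulrC indcoE//.
by case: (boolP (x <= r < y)) => xr; rewrite ?mulr1 ?mulr0//; exact: fM.
Qed.

Lemma primitive_lip R (f : R -> R) (x y : R) : 0 <= x -> x <= y ->
  measurable_fun setT f -> (forall r, `|f r| <= 1) ->
  `|primitive f y - primitive f x| <= y - x.
Proof.
move=> x0 xy mf f1; rewrite primitiveB// -[leRHS]mul1r.
exact: norm_Int_indco.
Qed.

(** One-sided because x may be the endpoint 0 of the half-line; the cosine inversion is later
    differentiated only from the right. *)
Lemma primitive_derivative R (f : R -> R) (x : R) (u : nat -> R) :
  0 <= x -> continuous f -> (forall r, `|f r| <= 1) ->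
  (forall n, x < u n) -> u @ \oo --> x ->
  (primitive f (u n) - primitive f x) / (u n - x) @[n --> \oo] --> f x.
Proof.
move=> x0 cf f1 xu ux; apply/cvgrPdist_le => e e0.
have := cf x => /cvgrPdist_le /(_ e e0).
rewrite nearE /= => /nbhs_ballP[d /= d0 fd].
move/cvgrPdist_lt : ux => /(_ d d0); apply: filterS => n xun.
have mf := cont_measurable cf.
have un0 : 0 < u n - x by rewrite subr_gt0.
rewrite -(ler_pM2r un0) -[X in _ * X <= _](gtr0_norm un0) -normrM mulrBl divfK ?gt_eqF//.
rewrite distrC primitiveB ?(ltW (xu n))//.
have -> : f x * (u n - x) = Int (fun r => f x * indco x (u n) r).
  by rewrite IntZ ?Int_indco// ?(ltW (xu n))//; apply: igr_indco; exact: ltW.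
rewrite -IntB; last 2 first.
- by apply: igr_indco_mul => //; exact: ltW.
- by apply: igrZ; apply: igr_indco; exact: ltW.
have I1 : igr (fun r => indco x (u n) r * f r - f x * indco x (u n) r).
  apply: igrB; first by apply: igr_indco_mul => //; exact: ltW.
  by apply: igrZ; apply: igr_indco; exact: ltW.
apply: le_trans (norm_Int I1) _.
rewrite -(Int_indco (ltW (xu n))) -IntZ; last by apply: igr_indco; exact: ltW.
apply: le_Int.
- exact: igr_norm.
- by apply: igrZ; apply: igr_indco; exact: ltW.
move=> r; rewrite (mulrC (f x)) -mulrBr normrM indcoE ?(ltW (xu n))//.
rewrite ger0_norm// mulrC.
case: (boolP (x <= r < u n)) => [/andP[xr run]|]; last by rewrite !mulr0.
rewrite !mulr1 distrC; apply: fd; rewrite /ball/= distrC ger0_norm ?subr_ge0//.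
by apply: le_lt_trans xun; rewrite distrC ger0_norm ?subr_ge0 ?(ltW (xu n))// lerD2r ltW.
Qed.

Lemma cosh_even R (x : R) : cosh (- x) = cosh x.
Proof. by rewrite /cosh opprK addrC. Qed.

Lemma cosh0 R : cosh 0 = 1 :> R.
Proof. by rewrite /cosh oppr0 expR0; field. Qed.

Lemma cosh_double R (x : R) : cosh (2 * x) = 2 * cosh x ^+ 2 - 1.
Proof.
rewrite /cosh mulr_natl mulr2n opprD !expRD.
have e1 := expRxMexpNx_1 x; move: (expR x) (expR (- x)) e1 => u v e1.
apply/eqP; rewrite -subr_eq0; apply/eqP.
by transitivity (1 - u * v); [field|rewrite e1 subrr].
Qed.

Lemma cosh_ge R (x : R) : 1 + x ^+ 2 / 8 <= cosh x.
Proof.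
wlog x0 : x / 0 <= x => [hw|].
  have [x0|x0] := lerP 0 x; first exact: hw.
  by rewrite -cosh_even -sqrrN; apply: hw; rewrite oppr_ge0 ltW.
(* cosh x - 1 = 2 sinh^2 (x / 2), and the crude bound e^y - e^-y >= y at y = x / 2 accounts for the
   8. *)
have -> : cosh x = 1 + (expR (x / 2) - expR (- (x / 2))) ^+ 2 / 2.
  have {1}-> : x = x / 2 + x / 2 by field.
  rewrite /cosh opprD !expRD.
  have e1 := expRxMexpNx_1 (x / 2).
  move: (expR _) (expR _) e1 => u v e1.
  apply/eqP; rewrite -subr_eq0; apply/eqP.
  by transitivity (v * u - 1); [field|rewrite e1 subrr].
rewrite lerD2l.
have -> : x ^+ 2 / 8 = (x / 2) ^+ 2 / 2 by field.
rewrite ler_pM2r ?invr_gt0//.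
have x2 : 0 <= x / 2 by rewrite divr_ge0.
have h : x / 2 <= expR (x / 2) - expR (- (x / 2)).
  have h1 : 1 + x / 2 <= expR (x / 2) by exact: expR_ge1Dx.
  have h2 : expR (- (x / 2)) <= 1 by rewrite -[leRHS]expR0 ler_expR oppr_le0.
  lra.
by rewrite ler_pXn2r// nnegrE// (le_trans x2).
Qed.

Lemma cosh_ge1 R (x : R) : 1 <= cosh x.
Proof. by apply: le_trans (cosh_ge x); rewrite lerDl divr_ge0// sqr_ge0. Qed.

Lemma cosh_gt0 R (x : R) : 0 < cosh x.
Proof. exact: lt_le_trans ltr01 (cosh_ge1 x). Qed.

(** * Uniform bounds for the Laplace transforms *)

Lemma laplace_splitE R (f : R -> R) (eta b : R) :
  continuous f -> (forall x, `|f x| <= 1) -> 0 < eta -> 0 <= b ->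
  laplace f eta 0 = primitive (fun r => f r * expR (- (eta * r))) b +
    expR (- (eta * b)) * laplace f eta b.
Proof.
move=> cf f1 eta0 b0.
have ce : continuous (fun r => f r * expR (- (eta * r))).
  apply: continuousM_fun => //; apply: (@continuous_compR _ expR).
    exact: continuous_expR.
  apply: continuousN_fun; apply: continuousM_fun; first exact: continuous_cst.
  exact: continuous_idf.
have I0 : igr (fun x => heaviside x * (f x * expR (- (eta * x)))).
  exact: igr_exp_bounded f1.
have mh b' : measurable_fun setT (fun x : R => heaviside (x - b')).
  apply: measurableT_comp; first exact: measurable_heaviside.
  by apply: cont_measurable; exact: continuous_subr.
have hb x : heaviside (x - b) <= heaviside x.
  rewrite /heaviside subr_ge0 ler_nat.
  by case: (lerP b x) => // bx; rewrite (le_trans b0).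
have Ib : igr (fun x => heaviside (x - b) * (f x * expR (- (eta * x)))).
  apply: igr_le (igr_norm I0).
    by apply: measurable_funM => //; exact: cont_measurable.
  by move=> x; rewrite !normrM ler_wpM2r// !ger0_norm ?heaviside_ge0.
have -> : laplace f eta 0 = Int (fun x => heaviside x * (f x * expR (- (eta * x)))).
  by apply: eq_Int => x; rewrite add0r.
have -> : expR (- (eta * b)) * laplace f eta b =
    Int (fun x => heaviside (x - b) * (f x * expR (- (eta * x)))).
  rewrite (Int_halfline ltr01 ce Ib) mul1r.
  rewrite /laplace -IntZ; last first.
    apply: (@igr_exp_bounded _ (fun x => f (b + x)) 1) => //.
    apply: continuous_compR => //; apply: continuousD_fun.
      exact: continuous_cst.
    exact: continuous_idf.
  apply: eq_Int => x; rewrite mul1r (addrC x) mulrDr opprD expRD; ring.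
rewrite /primitive -IntD//; last first.
  apply: (@eq_igr _ (fun x => heaviside x * (f x * expR (- (eta * x))) -
    heaviside (x - b) * (f x * expR (- (eta * x))))) => [x|].
    by rewrite /indco subr0 mulrBl.
  exact: igrB.
by apply: eq_Int => x; rewrite /indco subr0 mulrBl subrK.
Qed.

Lemma norm_laplace R (f : R -> R) (eta b : R) :
  continuous f -> (forall x, `|f x| <= 1) -> 0 < eta ->
  `|laplace f eta b| <= eta^-1.
Proof.
move=> cf f1 eta0.
have If : igr (fun r => heaviside r * (f (b + r) * expR (- (eta * r)))).
  apply: (@igr_exp_bounded _ (fun x => f (b + x)) 1) => //.
  apply: continuous_compR => //; apply: continuousD_fun.
    exact: continuous_cst.
  exact: continuous_idf.
apply: le_trans (norm_Int If) _.
rewrite -Int_exp//; apply: le_Int; [exact: igr_norm|exact: igr_exp|].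
move=> r; rewrite !normrM ger0_norm ?heaviside_ge0// ler_wpM2l ?heaviside_ge0//.
by rewrite (ger0_norm (expR_ge0 _)) ler_piMl ?expR_ge0.
Qed.

Definition laplace_kernel R (f : R -> R) (eta s s' : R) : R :=
  (expR (- s) + expR (- s')) *
    laplace f (eta * expR (s + s')) (cosh (s - s') - 1).

(** This is the minor at (a, -a): there s + s' = 0, so the off-diagonal entry keeps the parameter
    eta while the diagonal ones carry e^(2a) and e^(-2a). The weights e^-s + e^-s' contribute the
    gain [cosh a ^+ 2]. *)
Lemma laplace_kernel_CS R (f : R -> R) (eta a : R) :
  pd (laplace_kernel f eta) ->
  cosh a ^+ 2 * laplace f eta (cosh (2 * a) - 1) ^+ 2 <=
  laplace f (eta * expR (2 * a)) 0 * laplace f (eta / expR (2 * a)) 0.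
Proof.
move=> pK.
have sK s s' : laplace_kernel f eta s s' = laplace_kernel f eta s' s.
  by rewrite /laplace_kernel addrC (addrC s) -cosh_even opprB.
have := pd_CauchySchwarz a (- a) sK pK.
rewrite /laplace_kernel !subrr cosh0 subrr expR0 mulr1 opprK.
have -> : a + a = 2 * a by ring.
have -> : - a - a = - (2 * a) by ring.
rewrite [expR (- (2 * a))]expRN.
have e1 : expR (- a) * expR a = 1 by rewrite mulrC expRxMexpNx_1.
set L1 := laplace f _ _; set L2 := laplace f _ 0; set L3 := laplace f _ 0.
rewrite [in leRHS](_ : _ * _ = 4 * (expR (- a) * expR a) * (L2 * L3)); last by ring.
rewrite e1 mulr1 => h; rewrite -(ler_pM2l (_ : 0 < 4 :> R))//.
by apply: le_trans h; rewrite /cosh le_eqVlt; apply/orP; left; apply/eqP; field.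
Qed.

Lemma laplace_ge0 R (f : R -> R) (eta : R) :
  pd (laplace_kernel f eta) -> 0 <= laplace f eta 0.
Proof.
move=> /(pd_ge0 0); rewrite /laplace_kernel subrr cosh0 subrr addr0 expR0 mulr1.
by rewrite oppr0 expR0 pmulr_rge0.
Qed.

Lemma primitive_damped_cvg R (f : R -> R) (b : R) (u : nat -> R) :
  measurable_fun setT f -> (forall x, `|f x| <= 1) -> 0 <= b ->
  (forall n, 0 <= u n) -> u @ \oo --> 0 ->
  primitive (fun r => f r * expR (- (u n * r))) b @[n --> \oo] --> primitive f b.
Proof.
move=> mf f1 b0 u0 cu.
apply: (@Int_dct _ (fun n r => indco 0 b r * (f r * expR (- (u n * r)))) _
  (fun r => indco 0 b r)).
- move=> n; apply: measurable_funM; first exact: measurable_indco.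
  apply: measurable_funM => //; apply: measurableT_comp => //.
  by apply: measurableT_comp => //; apply: measurable_funM.
- move=> r; apply: cvgM; first exact: cvg_cst.
  rewrite -[X in _ --> X]mulr1; apply: cvgM; first exact: cvg_cst.
  rewrite -[X in _ --> X]expR0 -oppr0 -(mul0r r).
  apply: (@continuous_cvg _ _ _ _ _ _ expR); first exact: continuous_expR.
  by apply: cvgN; apply: cvgM => //; exact: cvg_cst.
- move=> n r; rewrite indcoE// normrM normr_nat.
  case: (boolP (0 <= r < b)) => [/andP[r0 _]|]; last by rewrite mul0r.
  rewrite mul1r normrM -[leRHS]mulr1; apply: ler_pM => //.
  by rewrite ger0_norm ?expR_ge0// -expR0 ler_expR oppr_le0 mulr_ge0.
- exact: igr_indco.
Qed.

Lemma exists_exprn_gt R (E c : R) : 1 < E -> exists n, c < E ^+ n.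
Proof.
move=> E1; have bern n : 1 + n%:R * (E - 1) <= E ^+ n.
  elim: n => [|n IH]; first by rewrite mul0r addr0 expr0.
  rewrite exprS; apply: le_trans (_ : E * (1 + n%:R * (E - 1)) <= _).
    rewrite -natr1 -subr_ge0 (_ : _ - _ = n%:R * (E - 1) ^+ 2); last by ring.
    by rewrite mulr_ge0 ?sqr_ge0.
  by rewrite ler_wpM2l// (le_trans ler01)// ltW.
have E10 : 0 < E - 1 by rewrite subr_gt0.
exists (Num.truncn (c / (E - 1))).+1; apply: lt_le_trans (bern _).
rewrite ltr_pwDl// -ler_pdivrMr//; exact/ltW/truncnS_gt.
Qed.

(* If L(eta) > 24 for some eta, the last hypothesis makes the ratios
   L(eta E^-(n+1)) / L(eta E^-n) grow geometrically, against L(eta) <= 1 / eta. *)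
Lemma bounded_of_ratio R (L : R -> R) (E : R) : 1 < E ->
  (forall eta, 0 < eta -> 0 <= L eta <= eta^-1) ->
  (forall eta, 0 < eta -> 24 <= L eta ->
    9 / 4 * L eta ^+ 2 <= L (eta * E) * L (eta / E)) ->
  forall eta, 0 < eta -> L eta <= 24.
Proof.
move=> E1 Lb LE eta eta0; rewrite leNgt; apply/negP => L24.
have E0 : 0 < E by exact: lt_trans E1.
have [n0 En0] : exists n, (eta * E ^+ n)^-1 <= 24.
  have [n nE] := exists_exprn_gt (eta * 24)^-1 E1; exists n.
  rewrite -[leRHS]invrK lef_pV2 ?posrE ?mulr_gt0 ?exprn_gt0// ?invr_gt0//.
  rewrite mulrC -ler_pdivrMr// -invfM mulrC; exact: ltW.
pose P n := L (eta * E ^+ n) <= 24.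
have exP : exists n, P n.
  exists n0; rewrite /P; have /andP[_ h] := Lb (eta * E ^+ n0) (mulr_gt0 eta0 (exprn_gt0 _ E0)).
  exact: le_trans h En0.
have [m Pm minm] := ex_minnP exP.
case: m Pm minm => [|m] Pm minm; first by move: Pm; rewrite /P expr0 mulr1 leNgt L24.
(* The last parameter before the first drop to 24 or below, a drop that the bound 1 / eta forces:
   L(e1) > 24 >= L(e1 E). *)
pose e1 := eta * E ^+ m.
have e10 : 0 < e1 by rewrite mulr_gt0// exprn_gt0.
have L1 : 24 < L e1.
  by rewrite ltNge; apply/negP => /minm; rewrite ltnn.
pose x n := L (e1 / E ^+ n).
have en n : 0 < e1 / E ^+ n by rewrite divr_gt0// exprn_gt0.
(* As L(e1 E) <= L(e1), the first ratio x 1 / x 0 is at least 9/4, and each use of the hypothesis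
   multiplies the next ratio by 9/4. *)
have step n : 24 < x n /\ (9 / 4) ^+ n.+1 * x n <= x n.+1.
  elim: n => [|n [IH1 IH2]].
    rewrite /x expr0 divr1 expr1; split => //.
    have := LE e1 e10 (ltW L1); rewrite expr1.
    have PE : L (e1 * E) <= L e1.
      by apply: ltW; apply: le_lt_trans L1; move: Pm; rewrite /P exprSr mulrA.
    move=> h; have Lp : 0 < L e1 by exact: lt_trans L1.
    rewrite -(ler_pM2l Lp); apply: le_trans (_ : L (e1 * E) * L (e1 / E) <= _).
      by apply: le_trans h; rewrite expr2 mulrCA.
    by rewrite ler_wpM2r//; have /andP[] := Lb (e1 / E) (divr_gt0 e10 E0).
  have q1 : 1 <= (9 / 4 : R) ^+ n.+1.
    by rewrite exprn_ege1//; lra.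
  have xn1 : 24 < x n.+1.
    rewrite (lt_le_trans IH1)// (le_trans _ IH2)// ler_peMl//.
    by rewrite (le_trans _ (ltW IH1)).
  split => //.
  have := LE (e1 / E ^+ n.+1) (en n.+1) (ltW xn1).
  have -> : e1 / E ^+ n.+1 * E = e1 / E ^+ n.
    by rewrite exprSr invfM mulrA divfK// gt_eqF.
  have -> : e1 / E ^+ n.+1 / E = e1 / E ^+ n.+2.
    by rewrite [in RHS]exprSr invfM mulrA.
  rewrite -/(x n) -/(x n.+1) -/(x n.+2) => h.
  have xp : 0 < x n by exact: lt_trans IH1.
  rewrite -(ler_pM2l xp).
  apply: le_trans h; rewrite [in leLHS]exprS.
  rewrite (_ : x n * (9 / 4 * (9 / 4) ^+ n.+1 * x n.+1) =
    9 / 4 * x n.+1 * ((9 / 4) ^+ n.+1 * x n)); last by ring.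
  rewrite (_ : 9 / 4 * x n.+1 ^+ 2 = 9 / 4 * x n.+1 * x n.+1); last by ring.
  by rewrite ler_wpM2l// mulr_ge0//; lra.
(* L(eta) <= 1 / eta bounds y by 1 / e1, whereas y at least doubles at each step once (9/4)^n
   exceeds 2 E. *)
pose y n := x n / E ^+ n.
have yb n : y n <= e1^-1.
  rewrite /y ler_pdivrMr ?exprn_gt0// mulrC.
  have /andP[_] := Lb _ (en n); rewrite invf_div.
  by [].
have y0 n : 0 < y n.
  by rewrite divr_gt0 ?exprn_gt0//; apply: lt_trans (step n).1.
have [N NE] : exists N, 2 * E <= (9 / 4 : R) ^+ N.
  have q : 1 < (9 / 4 : R) by lra.
  by have [n nE] := exists_exprn_gt (2 * E) q; exists n; exact: ltW.
have ystep n : (N <= n)%N -> 2 * y n <= y n.+1.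
  move=> Nn; rewrite /y.
  have := (step n).2 => h.
  rewrite ler_pdivlMr ?exprn_gt0//; apply: le_trans h.
  rewrite exprS (_ : 2 * _ * _ = 2 * E * x n); last first.
    by field; rewrite gt_eqF// exprn_gt0.
  rewrite ler_wpM2r//; first by apply: le_trans (ltW (step n).1).
  apply: le_trans NE _; rewrite ler_eXn2l//; last by lra.
  exact: leqW.
have yk k : 2 ^+ k * y N <= y (N + k)%N.
  elim: k => [|k IH]; first by rewrite expr0 mul1r addn0.
  rewrite addnS; apply: le_trans (ystep _ (leq_addr _ _)).
  by rewrite exprS -mulrA ler_wpM2l.
have [k kb] : exists k, e1^-1 < 2 ^+ k * y N.
  have q : 1 < (2 : R) by lra.
  have [k nk] := exists_exprn_gt (e1^-1 / y N) q; exists k.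
  by rewrite -ltr_pdivrMr.
by have := lt_le_trans kb (le_trans (yk k) (yb _)); rewrite ltxx.
Qed.

Lemma laplace_shift_bound R (f : R -> R) :
  continuous f -> (forall x, `|f x| <= 1) ->
  (forall eta, 0 < eta -> pd (laplace_kernel f eta)) ->
  forall eta s, 0 < eta -> `|laplace f eta (cosh s - 1)| <= 24 / cosh (s / 2).
Proof.
move=> cf f1 pK.
(* With cosh a = 2 the shift is cosh (2a) - 1 = 6. As |f| <= 1, cutting at 6 costs at most 6, a
   quarter of any L >= 24, so the shifted transform is at least 3/4 L and the minor yields 4 (3/4)^2
   = 9/4. *)
pose a : R := arcosh 2.
have ca : cosh a = 2 by rewrite arcoshK// ler1n.
have c2a : cosh (2 * a) = 7 by rewrite cosh_double ca; ring.
have a0 : 0 < a.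
  rewrite lt_neqAle arcosh_ge0 ?ler1n// andbT; apply/eqP => a0.
  by have := ca; rewrite -a0 cosh0; lra.
have LE eta : 0 < eta -> 24 <= laplace f eta 0 ->
  9 / 4 * laplace f eta 0 ^+ 2 <=
  laplace f (eta * expR (2 * a)) 0 * laplace f (eta / expR (2 * a)) 0.
  move=> eta0 L24; apply: le_trans (laplace_kernel_CS a (pK eta eta0)).
  rewrite ca c2a.
  have b0 : 0 <= 7 - 1 :> R by lra.
  have mf := cont_measurable cf.
  have := laplace_splitE cf f1 eta0 b0.
  have ceta : measurable_fun setT (fun r => expR (- (eta * r))).
    by apply: measurableT_comp => //; apply: measurableT_comp => //; exact: measurable_funM.
  have : `|primitive (fun r => f r * expR (- (eta * r))) (7 - 1)| <= 6.
    have := @norm_Int_indco R (fun r => heaviside r * (f r * expR (- (eta * r)))) 0 (7 - 1) 1.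
    have -> : Int (fun r => indco 0 (7 - 1) r * (heaviside r * (f r * expR (- (eta * r))))) =
       primitive (fun r => f r * expR (- (eta * r))) (7 - 1).
      apply: eq_Int => r; rewrite indcoE//.
      case: (boolP (0 <= r < 7 - 1)) => [/andP[r0 _]|]; last by rewrite !mul0r.
      by rewrite /heaviside r0 !mul1r.
    have hb r : `|heaviside r * (f r * expR (- (eta * r)))| <= 1.
      rewrite /heaviside; case: (lerP 0 r) => r0; last by rewrite mul0r normr0.
      rewrite mul1r normrM -[leRHS]mulr1; apply: ler_pM => //.
      by rewrite ger0_norm ?expR_ge0// -[leRHS]expR0 ler_expR oppr_le0 mulr_ge0// ltW.
    move=> h; apply: le_trans (h _ _ _ _) _ => //.
    - apply: measurable_funM; first exact: measurable_heaviside.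
      exact: measurable_funM.
    - by rewrite mul1r subr0; lra.
  have e1 : expR (- (eta * (7 - 1))) <= 1.
    by rewrite -[leRHS]expR0 ler_expR oppr_le0 mulr_ge0// ltW.
  have e0 := expR_ge0 (- (eta * (7 - 1))).
  move: (primitive _ _) (expR _) (laplace f eta (7 - 1)) (laplace f eta 0) L24 e1 e0.
  move=> I e D L L24 e1 e0 I6 LID.
  have h : L - 6 <= `|D|.
    apply: (@le_trans _ _ (e * `|D|)); last by rewrite ler_piMl.
    have : e * D <= e * `|D| by rewrite ler_wpM2l// ler_norm.
    by move: I6; rewrite ler_norml => /andP[_ I6]; lra.
  have h' : (3 / 4 * L) ^+ 2 <= D ^+ 2.
    rewrite -[leRHS]real_normK ?num_real// ler_pXn2r// ?nnegrE//; lra.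
  move: h'; rewrite exprMn; nra.
have L24 : forall eta, 0 < eta -> laplace f eta 0 <= 24.
  apply: (@bounded_of_ratio _ (fun eta => laplace f eta 0) (expR (2 * a))) => //.
    by rewrite -expR0 ltr_expR mulr_gt0.
  move=> eta eta0; rewrite laplace_ge0/=; last exact: pK.
  by apply: le_trans (norm_laplace _ cf f1 eta0); exact: ler_norm.
(* Both diagonal entries are now at most 24, so the minor at s / 2 bounds the off-diagonal entry,
   whose shift is cosh s - 1. *)
move=> eta s eta0.
have := laplace_kernel_CS (s / 2) (pK eta eta0).
rewrite (_ : 2 * (s / 2) = s); last by field.
have c0 := cosh_gt0 (s / 2); have es0 := expR_gt0 s.
have u1 := L24 (eta * expR s) (mulr_gt0 eta0 es0).
have u2 := L24 (eta / expR s) (divr_gt0 eta0 es0).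
have v1 := laplace_ge0 (pK (eta * expR s) (mulr_gt0 eta0 es0)).
have v2 := laplace_ge0 (pK (eta / expR s) (divr_gt0 eta0 es0)).
move=> h; rewrite ler_pdivlMr// -(ler_pXn2r (ltn0Sn 1)) ?nnegrE//; last first.
  by rewrite mulr_ge0// ltW.
rewrite exprMn real_normK ?num_real// mulrC.
by apply: le_trans h _; rewrite expr2 (ler_pM v1 v2 u1 u2).
Qed.

Lemma close_le R (L I I' c c' : R) :
  `|L - I| <= c -> `|L - I'| <= c' -> I - c <= I' + c'.
Proof. by rewrite !ler_norml => /andP[h1 h2] /andP[h3 h4]; lra. Qed.

Lemma close_trans3 R (l P L I c e : R) :
  `|l - P| <= c -> `|L - I| <= c -> c <= e / 3 -> `|P - I| <= e / 3 ->
  `|l - L| <= e.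
Proof.
rewrite !ler_norml => /andP[h1 h2] /andP[h3 h4] h /andP[h5 h6].
by apply/andP; split; lra.
Qed.

(* l is the improper integral of f over [0, +oo[. *)
Lemma primitive_limit R (f : R -> R) :
  continuous f -> (forall x, `|f x| <= 1) ->
  (forall eta, 0 < eta -> pd (laplace_kernel f eta)) ->
  exists l : R, (forall s, `|l - primitive f (cosh s - 1)| <= 24 / cosh (s / 2)) /\
   pd (fun s s' : R => l - primitive f (cosh (s - s') - 1)).
Proof.
move=> cf f1 pK.
have mf := cont_measurable cf.
have lb := laplace_shift_bound cf f1 pK.
pose P s := primitive f (cosh s - 1).
have b0 s : 0 <= cosh s - 1 :> R by rewrite subr_ge0 cosh_ge1.
pose u (n : nat) : R := n.+1%:R^-1.
have u0 n : 0 < u n by rewrite invr_gt0.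
have cu : u @ \oo --> 0 by exact: cvg_harmonic.
pose I n s := primitive (fun r => f r * expR (- (u n * r))) (cosh s - 1).
have cI s : I n s @[n --> \oo] --> P s.
  by apply: primitive_damped_cvg => // n; exact: ltW.
have LI eta s : 0 < eta ->
   `|laplace f eta 0 - primitive (fun r => f r * expR (- (eta * r))) (cosh s - 1)|
   <= 24 / cosh (s / 2).
  move=> eta0; rewrite (laplace_splitE cf f1 eta0 (b0 s)) addrC addKr normrM.
  apply: le_trans (lb eta s eta0).
  rewrite ler_piMl// ger0_norm ?expR_ge0// -[leRHS]expR0 ler_expR oppr_le0.
  by rewrite mulr_ge0// ltW.
(* Both truncated integrals are close to the same number [laplace f (u n) 0], which is eliminated
   before n tends to infinity, its convergence being still unknown. *)
have PP s s' : P s - 24 / cosh (s / 2) <= P s' + 24 / cosh (s' / 2).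
  have c1 : I n s - 24 / cosh (s / 2) @[n --> \oo] --> P s - 24 / cosh (s / 2).
    by apply: cvgB; [exact: cI|exact: cvg_cst].
  have c2 : I n s' + 24 / cosh (s' / 2) @[n --> \oo] --> P s' + 24 / cosh (s' / 2).
    by apply: cvgD; [exact: cI|exact: cvg_cst].
  by apply: le_lim_seq c1 c2 _ => n; apply: close_le (LI _ _ (u0 n)) (LI _ _ (u0 n)).
(* Every P s' + 24 / cosh (s' / 2) bounds this set from above, so its supremum lies within 24 / cosh
   (s / 2) of each P s. *)
pose S := [set P s - 24 / cosh (s / 2) | s in [set: R]].
have S0 : S !=set0 by exists (P 0 - 24 / cosh (0 / 2)); exists 0.
have ubS s : ubound S (P s + 24 / cosh (s / 2)).
  by move=> _ [s' _ <-]; exact: PP.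
have Sb : has_sup S by split => //; exists (P 0 + 24 / cosh (0 / 2)); exact: ubS.
exists (sup S).
have lP s : `|sup S - P s| <= 24 / cosh (s / 2).
  rewrite ler_norml; apply/andP; split.
    have : P s - 24 / cosh (s / 2) <= sup S by apply: sup_upper_bound => //; exists s.
    lra.
  have : sup S <= P s + 24 / cosh (s / 2) by apply: ge_sup => //; exact: ubS.
  lra.
split => //.
(* The estimate [LI] is uniform in the Laplace parameter, so the transforms have the same limit when
   the parameter tends to 0. *)
have cL (v : nat -> R) : (forall n, 0 < v n) -> v @ \oo --> 0 ->
    laplace f (v n) 0 @[n --> \oo] --> sup S.
  move=> v0 cv; apply/cvgrPdist_le => e e0.
  have [s se] : exists s, 24 / cosh (s / 2) <= e / 3.
    exists (2 * arcosh (1 + 72 / e)).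
    have e7 : 0 <= 72 / e by rewrite divr_ge0// ltW.
    rewrite (_ : 2 * arcosh (1 + 72 / e) / 2 = arcosh (1 + 72 / e)); last by field.
    rewrite arcoshK; last by rewrite lerDl.
    rewrite ler_pdivrMr; last by rewrite ltr_pwDl.
    rewrite (_ : e / 3 * (1 + 72 / e) = e / 3 + 24); last by field; rewrite gt_eqF.
    by rewrite lerDr divr_ge0// ltW.
  have cIv := primitive_damped_cvg mf f1 (b0 s) (fun n => ltW (v0 n)) cv.
  have e3 : 0 < e / 3 by rewrite divr_gt0.
  move/cvgrPdist_le : cIv => /(_ _ e3); apply: filterS => n.
  exact: close_trans3 (lP s) (LI (v n) s (v0 n)) se.
have clap (v : nat -> R) s : (forall n, 0 < v n) -> v @ \oo --> 0 ->
    laplace f (v n) (cosh s - 1) @[n --> \oo] --> sup S - P s.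
  move=> v0 cv.
  have E n : laplace f (v n) (cosh s - 1) = expR (v n * (cosh s - 1)) *
     (laplace f (v n) 0 - primitive (fun r => f r * expR (- (v n * r))) (cosh s - 1)).
    rewrite (laplace_splitE cf f1 (v0 n) (b0 s)) [primitive _ _ + _]addrC addrK mulrA.
    by rewrite expRxMexpNx_1 mul1r.
  apply: (eq_cvgr (fun n => esym (E n)) (l := 1 * (sup S - P s))).
    by rewrite mul1r.
  apply: cvgM.
    rewrite -[X in _ --> X]expR0 -(mul0r (cosh s - 1)).
    apply: (@continuous_cvg _ _ _ _ _ _ expR); first exact: continuous_expR.
    by apply: cvgM => //; exact: cvg_cst.
  apply: cvgB; first exact: cL.
  by apply: primitive_damped_cvg => // n; exact: ltW.
(* The parameter u n e^(s + s') tends to 0 for all s and s', so apart from the weights, which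
   [pd_div] then removes, the limit kernel depends on s - s' alone. *)
have p1 : pd (fun s s' => (expR (- s) + expR (- s')) * (sup S - P (s - s'))).
  apply: (@pd_lim _ _ (fun n => laplace_kernel f (u n))) => [n|s s'].
    exact: pK.
  apply: cvgM; first exact: cvg_cst.
  apply: clap => [n|]; first by rewrite mulr_gt0 ?expR_gt0.
  by rewrite -[X in _ --> X](mul0r (expR (s + s'))); apply: cvgM => //; exact: cvg_cst.
have := pd_div (fun s => expR_gt0 (- s)) p1.
apply: eq_pd => s s'; rewrite mulrAC divff ?mul1r// gt_eqF//.
by rewrite addr_gt0 ?expR_gt0.
Qed.

(** * Hyperbolic calculus *)

Lemma isdD R (f g : R -> R) (x df dg : R) :
  is_derive x 1 f df -> is_derive x 1 g dg ->
  is_derive x 1 (fun y => f y + g y) (df + dg).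
Proof. by move=> hf hg; exact: is_deriveD. Qed.

Lemma isdN R (f : R -> R) (x df : R) :
  is_derive x 1 f df -> is_derive x 1 (fun y => - f y) (- df).
Proof. by move=> hf; exact: is_deriveN. Qed.

Lemma isdM R (f g : R -> R) (x df dg : R) :
  is_derive x 1 f df -> is_derive x 1 g dg ->
  is_derive x 1 (fun y => f y * g y) (df * g x + f x * dg).
Proof.
move=> hf hg; have h := is_deriveM hf hg; apply: is_derive_eq h _.
by rewrite /GRing.scale/= addrC mulrC.
Qed.

Lemma isd_cst R (x c : R) : is_derive x 1 (fun _ : R => c) 0.
Proof. exact: is_derive_cst. Qed.

Lemma isd_id R (x : R) : is_derive x 1 (fun y : R => y) 1.
Proof. exact: is_derive_id. Qed.

Lemma isd_comp R (f g : R -> R) (x df dg : R) :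
  is_derive (g x) 1 f df -> is_derive x 1 g dg ->
  is_derive x 1 (fun y => f (g y)) (df * dg).
Proof. by move=> hf hg; exact: is_derive1_comp. Qed.

Lemma isd_eq R (f g : R -> R) (x df df' : R) :
  is_derive x 1 f df -> f =1 g -> df = df' -> is_derive x 1 g df'.
Proof. by move=> h /funext <- <-. Qed.

Lemma isd_mulc R (x c : R) : is_derive x 1 (fun y : R => c * y) c.
Proof.
apply: (isd_eq (isdM (isd_cst x c) (isd_id x))) => //.
by rewrite mul0r mulr1 add0r.
Qed.

Lemma isd_X R (x : R) (n : nat) :
  is_derive x 1 (fun y : R => y ^+ n.+1) (n.+1%:R * x ^+ n).
Proof.
elim: n => [|n IH].
  by apply: (isd_eq (isd_id x)) => [y|]; rewrite ?expr1// expr0 mulr1.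
apply: (isd_eq (isdM (isd_id x) IH)) => [y|]; first by rewrite -exprS.
by rewrite mul1r mulrCA -exprS -[n.+2%:R]natr1 mulrDl mul1r addrC.
Qed.

Lemma isd_cosh R (x : R) : is_derive x 1 (@cosh R) (sinh x).
Proof.
have e1 := @is_derive_expR R x.
have e2 := isd_comp (@is_derive_expR R (- x)) (isdN (isd_id x)).
apply: (isd_eq (isdM (isdD e1 e2) (isd_cst x 2^-1))) => //.
by rewrite mulr0 addr0 mulrN1.
Qed.

Lemma isd_sinh R (x : R) : is_derive x 1 (@sinh R) (cosh x).
Proof.
have e1 := @is_derive_expR R x.
have e2 := isdN (isd_comp (@is_derive_expR R (- x)) (isdN (isd_id x))).
apply: (isd_eq (isdM (isdD e1 e2) (isd_cst x 2^-1))) => //.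
by rewrite mulr0 addr0 mulrN1 opprK.
Qed.

Lemma isd_continuous R (f df : R -> R) :
  (forall x : R, is_derive x 1 f (df x)) -> continuous f.
Proof.
move=> h x; apply: differentiable_continuous; apply/derivable1_diffP.
by have [] := h x.
Qed.

Lemma ge_of_derive R (f df : R -> R) (x : R) :
  (forall y : R, is_derive y 1 f (df y)) -> (forall y, 0 <= y -> 0 <= df y) ->
  0 <= x -> f 0 <= f x.
Proof.
move=> h d0 x0.
have [c] := @MVT_segment _ f df 0 x x0 (fun y _ => h y)
  (continuous_subspaceT (isd_continuous h)).
rewrite in_itv/= => /andP[c0 _] E.
by rewrite -subr_ge0 E mulr_ge0 ?d0// subr_ge0.
Qed.

Lemma cosh_cont R : continuous (@cosh R).
Proof. exact: isd_continuous (@isd_cosh R). Qed.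

Lemma sinh_cont R : continuous (@sinh R).
Proof. exact: isd_continuous (@isd_sinh R). Qed.

Lemma sinh0 R : sinh 0 = 0 :> R.
Proof. by rewrite /sinh oppr0 subrr mul0r. Qed.

Lemma sinh_ge R (x : R) : 0 <= x -> x <= sinh x.
Proof.
move=> x0; rewrite -subr_ge0 -(subrr 0) -{1}(sinh0 R).
apply: (@ge_of_derive _ (fun y => sinh y - y) (fun y => cosh y - 1) x
  (fun y => isdD (isd_sinh y) (isdN (isd_id y))) _ x0).
by move=> y _; rewrite subr_ge0 cosh_ge1.
Qed.

Lemma sin_le_id R (x : R) : 0 <= x -> sin x <= x.
Proof.
move=> x0; rewrite -subr_ge0 -(subrr 0) -{2}(sin0 R).
apply: (@ge_of_derive _ (fun y => y - sin y) (fun y => 1 - cos y) x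
  (fun y => isdD (isd_id y) (isdN (is_derive_sin y))) _ x0).
by move=> y _; rewrite subr_ge0 cos_le1.
Qed.

Lemma norm_sin R (x : R) : `|sin x| <= `|x|.
Proof.
wlog x0 : x / 0 <= x => [hw|].
  have [x0|x0] := lerP 0 x; first exact: hw.
  by rewrite -normrN -sinN -(normrN x); apply: hw; rewrite oppr_ge0 ltW.
rewrite (ger0_norm x0) ler_norml sin_le_id// andbT.
rewrite -subr_ge0 opprK -(addr0 0) -{1}(sin0 R).
apply: (@ge_of_derive _ (fun y => sin y + y) (fun y => cos y + 1) x
  (fun y => isdD (is_derive_sin y) (isd_id y)) _ x0).
by move=> y _; rewrite -lerBlDr sub0r cos_geN1.
Qed.

(** In this chain of Taylor bounds the difference of the two sides vanishes at 0, and its derivative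
    is nonnegative by the previous bound. *)
Lemma cos_ge_taylor R (x : R) : 1 - x ^+ 2 / 2 <= cos x.
Proof.
wlog x0 : x / 0 <= x => [hw|].
  have [x0|x0] := lerP 0 x; first exact: hw.
  by rewrite -cosN -sqrrN; apply: hw; rewrite oppr_ge0 ltW.
rewrite -subr_ge0 (_ : 0 = cos 0 - (1 - 0 ^+ 2 / 2)); last first.
  by rewrite cos0 expr0n/= mul0r subr0 subrr.
apply: (@ge_of_derive _ (fun y => cos y - (1 - y ^+ 2 / 2)) (fun y => y - sin y)) => //.
- move=> y; have h := isdN (isdD (isd_cst y 1) (isdN (isdM (isd_X y 1) (isd_cst y 2^-1)))).
  apply: (isd_eq (isdD (@is_derive_cos R y) h)) => //.
  by rewrite expr1; field.
- by move=> y y0; rewrite subr_ge0 sin_le_id.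
Qed.

Lemma sin_ge_taylor R (x : R) : 0 <= x -> x - x ^+ 3 / 6 <= sin x.
Proof.
move=> x0; rewrite -subr_ge0 (_ : 0 = sin 0 - (0 - 0 ^+ 3 / 6)); last first.
  by rewrite sin0 expr0n/= mul0r !subr0.
apply: (@ge_of_derive _ (fun y => sin y - (y - y ^+ 3 / 6))
  (fun y => cos y - (1 - y ^+ 2 / 2))) => //.
- move=> y; have h := isdN (isdD (isd_id y) (isdN (isdM (isd_X y 2) (isd_cst y 6^-1)))).
  apply: (isd_eq (isdD (@is_derive_sin R y) h)) => //.
  by rewrite mulr0 addr0; field.
- by move=> y y0; rewrite subr_ge0 cos_ge_taylor.
Qed.

Lemma cos_le_taylor R (x : R) : 0 <= x ->
  cos x <= 1 - x ^+ 2 / 2 + x ^+ 4 / 24.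
Proof.
move=> x0; rewrite -subr_ge0 (_ : 0 = 1 - 0 ^+ 2 / 2 + 0 ^+ 4 / 24 - cos 0); last first.
  by rewrite cos0 !expr0n/= !mul0r subr0 addr0 subrr.
apply: (@ge_of_derive _ (fun y => 1 - y ^+ 2 / 2 + y ^+ 4 / 24 - cos y)
  (fun y => sin y - (y - y ^+ 3 / 6))) => //.
- move=> y; have h := isdD (isdD (isd_cst y 1) (isdN (isdM (isd_X y 1) (isd_cst y 2^-1))))
    (isdM (isd_X y 3) (isd_cst y 24^-1)).
  apply: (isd_eq (isdD h (isdN (@is_derive_cos R y)))) => //.
  by rewrite expr1; field.
- by move=> y y0; rewrite subr_ge0 sin_ge_taylor.
Qed.

Lemma sin_le_taylor R (x : R) : 0 <= x ->
  sin x <= x - x ^+ 3 / 6 + x ^+ 5 / 120.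
Proof.
move=> x0; rewrite -subr_ge0 (_ : 0 = 0 - 0 ^+ 3 / 6 + 0 ^+ 5 / 120 - sin 0); last first.
  by rewrite sin0 !expr0n/= !mul0r !subr0 addr0.
apply: (@ge_of_derive _ (fun y => y - y ^+ 3 / 6 + y ^+ 5 / 120 - sin y)
  (fun y => 1 - y ^+ 2 / 2 + y ^+ 4 / 24 - cos y)) => //.
- move=> y; have h := isdD (isdD (isd_id y) (isdN (isdM (isd_X y 2) (isd_cst y 6^-1))))
    (isdM (isd_X y 4) (isd_cst y 120^-1)).
  apply: (isd_eq (isdD h (isdN (@is_derive_sin R y)))) => //.
  by field.
- by move=> y y0; rewrite subr_ge0 cos_le_taylor.
Qed.

Lemma isd_derive1 R (f : R -> R) (x df : R) :
  is_derive x 1 f df -> f^`()%classic x = df.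
Proof. by move=> h; rewrite derive1E derive_val. Qed.

Lemma Int_FTC R (F f : R -> R) (l1 l2 : R) :
  (forall x : R, is_derive x 1 F (f x)) -> continuous f -> igr f ->
  F n%:R @[n --> \oo] --> l1 -> F (- n%:R) @[n --> \oo] --> l2 ->
  Int f = l1 - l2.
Proof.
move=> dF cf If F1 F2.
have nle n : - (n%:R : R) <= n%:R by rewrite (le_trans (_ : _ <= 0))// oppr_le0.
have c1 : Int (fun x => indco (- n%:R) n%:R x * f x) @[n --> \oo] --> Int f.
  apply: (@Int_dct _ _ _ (fun x => `|f x|)).
  - move=> n; apply: measurable_funM; first exact: measurable_indco.
    exact: igr_measurable.
  - move=> x; apply: cvg_near_cst.
    exists (Num.truncn `|x|).+1 => // n /= xn.
    have nx : `|x| < n%:R.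
      by apply: lt_le_trans (truncnS_gt _) _; rewrite ler_nat.
    rewrite indcoE// ; move: nx; rewrite ltr_norml => /andP[h1 h2].
    by rewrite (ltW h1) h2 mul1r.
  - move=> n x; rewrite normrM indcoE// normr_nat.
    by case: (_ && _); rewrite ?mul1r// mul0r.
  - exact: igr_norm.
have E (n : nat) : (0 < n)%N ->
    Int (fun x => indco (- n%:R) n%:R x * f x) = F n%:R - F (- n%:R).
  move=> n0; have nn : - (n%:R : R) < n%:R by rewrite (lt_trans (_ : _ < 0)) ?oppr_lt0 ?ltr0n.
  have cF := isd_continuous dF.
  have := @continuous_FTC2 _ f F (- n%:R) n%:R nn (continuous_subspaceT cf).
  have -> : (\int[@lebesgue_measure R]_(x in `[(- n%:R)%R, n%:R]) (f x)%:E)%E =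
     (\int[@lebesgue_measure R]_(x in `[(- n%:R)%R, n%:R[) (f x)%:E)%E.
    apply/esym/integral_itv_bndo_bndc; apply/measurable_EFinP.
    by apply: measurable_funTS; exact: cont_measurable.
  rewrite integral_mkcond => h.
  rewrite /Int /Rintegral (_ : (\int[_]_x _)%E = (F n%:R - F (- n%:R))%:E)//.
  rewrite EFinB -h.
  - apply: eq_integral => x _; rewrite restrict_EFin; congr EFin; rewrite patchE indcoE//.
    case: ifPn => [|/negP]; rewrite inE/= in_itv/=; first by move=> ->; rewrite mul1r.
    by move=> /negP/negbTE ->; rewrite mul0r.
  - split.
    + by move=> x _; have [] := dF x.
    + by apply: cvg_at_right_filter; exact: cF.
    + by apply: cvg_at_left_filter; exact: cF.
  - by move=> x _; exact: isd_derive1.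
have c2 : Int (fun x => indco (- n%:R) n%:R x * f x) @[n --> \oo] --> l1 - l2.
  have : F n%:R - F (- n%:R) @[n --> \oo] --> l1 - l2 by exact: cvgB.
  apply: cvg_trans; apply: near_eq_cvg; exists 1%N => // n /= n1.
  by rewrite E.
by rewrite -(cvg_lim _ c1)// (cvg_lim _ c2).
Qed.

(** * The function 1 / (1 + cosh x) and its cosine transform *)

Definition psi R (x : R) : R := (1 + cosh x)^-1.

Lemma psi_gt0 R (x : R) : 0 < psi x.
Proof. by rewrite invr_gt0 addr_gt0// cosh_gt0. Qed.

Lemma psi_le1 R (x : R) : psi x <= 1.
Proof. by rewrite invf_le1 ?lerDl ?ltW ?cosh_gt0// addr_gt0// cosh_gt0. Qed.

Lemma psi_even R (x : R) : psi (- x) = psi x.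
Proof. by rewrite /psi cosh_even. Qed.

Lemma psi_le R (x : R) : psi x <= 8 * (1 + x ^+ 2)^-1.
Proof.
have c := cosh_ge x; have x2 := sqr_ge0 x.
rewrite -[8]invrK -invfM lef_pV2 ?posrE; last 2 first.
- by rewrite addr_gt0// cosh_gt0.
- by rewrite mulr_gt0 ?invr_gt0// ltr_pwDl.
by rewrite mulrC; lra.
Qed.

Lemma psi_cont R : continuous (@psi R).
Proof.
move=> x; apply: cvgV; first by rewrite gt_eqF// addr_gt0// cosh_gt0.
by apply: cvgD; [exact: cvg_cst|exact: cosh_cont].
Qed.

Lemma igr_psi R : igr (@psi R).
Proof.
apply: igr_le (igrZ 8 (@igr_oneDsqrV R)).
  by apply: cont_measurable; exact: psi_cont.
by move=> x; rewrite ger0_norm ?psi_le// ltW// psi_gt0.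
Qed.

Lemma isd_psi R (x : R) :
  is_derive x 1 (@psi R) (- (sinh x * psi x ^+ 2)).
Proof.
have c0 : 1 + cosh x != 0 by rewrite gt_eqF// addr_gt0// cosh_gt0.
have h := isdD (isd_cst x 1) (isd_cosh x).
have h2 := @is_deriveV R (fun y : R => 1 + cosh y) x (0 + sinh x) 1 c0 h.
apply: (isd_eq h2) => [y|]; first by [].
rewrite /GRing.scale/= add0r /psi.
by rewrite exprVn mulNr mulrC.
Qed.

Lemma isd_psiX R (x : R) (k : nat) :
  is_derive x 1 (fun y : R => psi y ^+ k.+1)
    (- (k.+1%:R * sinh x * psi x ^+ k.+2)).
Proof.
apply: (isd_eq (isd_comp (isd_X (psi x) k) (isd_psi x))) => //.
by rewrite !exprS; ring.
Qed.

Definition psi_hat R (k : nat) (l : R) : R :=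
  Int (fun x => psi x ^+ k * cos (l * x)).

Lemma psiX_le R (x : R) (k : nat) : psi x ^+ k.+1 <= psi x.
Proof.
rewrite exprS ler_piMr ?(ltW (psi_gt0 x))//.
by rewrite exprn_ile1// ?psi_le1// ltW// psi_gt0.
Qed.

Lemma cos_mul_cont R (l : R) : continuous (fun x : R => cos (l * x)).
Proof.
apply: (@continuous_compR _ cos); first exact: continuous_cos.
by apply: continuousM_fun; [exact: continuous_cst|exact: continuous_idf].
Qed.

Lemma sin_mul_cont R (l : R) : continuous (fun x : R => sin (l * x)).
Proof.
apply: (@continuous_compR _ sin); first exact: continuous_sin.
by apply: continuousM_fun; [exact: continuous_cst|exact: continuous_idf].
Qed.

Lemma measurable_cosr R (l : R) : measurable_fun setT (fun x : R => cos (x * l)).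
Proof. by apply: cont_measurable; under eq_fun do rewrite mulrC; exact: cos_mul_cont. Qed.

Lemma measurable_sinr R (l : R) : measurable_fun setT (fun x : R => sin (x * l)).
Proof. by apply: cont_measurable; under eq_fun do rewrite mulrC; exact: sin_mul_cont. Qed.

Lemma igr_psiX_mul R (f : R -> R) (k : nat) : continuous f ->
  (forall x, `|f x| <= 1) -> igr (fun x => psi x ^+ k.+1 * f x).
Proof.
move=> cf f1; apply: igr_le (@igr_psi R).
  apply: cont_measurable; apply: continuousM_fun => //.
  by apply: continuousX_fun; exact: psi_cont.
move=> x; rewrite normrM ger0_norm ?exprn_ge0 ?(ltW (psi_gt0 x))//.
by apply: le_trans (psiX_le x k); rewrite ler_piMr// exprn_ge0// ltW// psi_gt0.
Qed.

Lemma igr_psi_hat R (k : nat) (l : R) :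
  igr (fun x : R => psi x ^+ k.+1 * cos (l * x)).
Proof. by apply: igr_psiX_mul => [|x]; [exact: cos_mul_cont|exact: cos_max]. Qed.

Lemma sqr_sinh R (x : R) : sinh x ^+ 2 = cosh x ^+ 2 - 1.
Proof.
rewrite /cosh /sinh; have e1 := expRxMexpNx_1 x.
move: (expR x) (expR (- x)) e1 => u v e1.
apply/eqP; rewrite -subr_eq0; apply/eqP.
by transitivity (1 - u * v); [field|rewrite e1 subrr].
Qed.

Lemma norm_sinh_psi R (x : R) : `|sinh x * psi x| <= 1.
Proof.
rewrite normrM (ger0_norm (ltW (psi_gt0 x))) /psi.
have c0 : 0 < 1 + cosh x by rewrite addr_gt0// cosh_gt0.
rewrite ler_pdivrMr// mul1r -(ler_pXn2r (ltn0Sn 1)) ?nnegrE// ?(ltW c0)//.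
rewrite real_normK ?num_real// sqr_sinh.
by have := cosh_gt0 x; nra.
Qed.

Lemma psi_nat_cvg0 R : psi (n%:R : R) @[n --> \oo] --> 0.
Proof.
apply: (@squeeze_cvgr _ _ _ _ (fun=> 0) (fun n : nat => 8 * (n.+1%:R : R)^-1)).
- apply: nearW => n; rewrite (ltW (psi_gt0 _))/=; apply: le_trans (psi_le _) _.
  have q0 : 0 < 1 + (n%:R : R) ^+ 2 by rewrite ltr_pwDl// sqr_ge0.
  have n0 : 0 < (n.+1%:R : R) by rewrite ltr0n.
  rewrite ler_pM2l// lef_pV2//.
  rewrite -natr1 addrC lerD2l; clear q0 n0; case: n => [|n]; first by rewrite expr0n.
  by rewrite expr2 ler_peMl// ler1n.
- exact: cvg_cst.
- rewrite -[X in _ --> X](mulr0 8); apply: cvgM; first exact: cvg_cst.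
  exact: cvg_harmonic.
Qed.

(* Two integrations by parts, since psi'' = psi - 3 psi^2 and more generally
   (psi^k)'' = k^2 psi^k - k (2 k + 1) psi^(k+1). *)
Lemma psi_hat_rec R (k : nat) (l : R) :
  (l ^+ 2 + k.+1%:R ^+ 2) * psi_hat k.+1 l =
  k.+1%:R * (2 * k.+1%:R + 1) * psi_hat k.+2 l.
Proof.
(* The boundary terms of both integrations by parts; they are bounded by a multiple of psi and so
   vanish at both ends. *)
pose F x : R := - (k.+1%:R * sinh x * psi x ^+ k.+2) * cos (l * x)
  + l * (psi x ^+ k.+1 * sin (l * x)).
pose f x : R := (l ^+ 2 + k.+1%:R ^+ 2) * (psi x ^+ k.+1 * cos (l * x))
  - k.+1%:R * (2 * k.+1%:R + 1) * (psi x ^+ k.+2 * cos (l * x)).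
have dF (x : R) : is_derive x 1 F (f x).
  have dcos : is_derive x 1 (fun y : R => cos (l * y)) (- sin (l * x) * l).
    by exact: isd_comp (is_derive_cos (l * x)) (isd_mulc x l).
  have dsin : is_derive x 1 (fun y : R => sin (l * y)) (cos (l * x) * l).
    by exact: isd_comp (is_derive_sin (l * x)) (isd_mulc x l).
  have d1 := isdN (isdM (isdM (isd_cst x k.+1%:R) (isd_sinh x)) (isd_psiX x k.+1)).
  have d2 := isdM (isd_cst x l) (isdM (isd_psiX x k) dsin).
  apply: (isd_eq (isdD (isdM d1 dcos) d2)) => //.
  rewrite /f.
  have E : sinh x ^+ 2 * psi x ^+ 2 = 1 - 2 * psi x.
    rewrite sqr_sinh /psi; field; by rewrite gt_eqF// addr_gt0// cosh_gt0.
  have E1 : cosh x * psi x = 1 - psi x.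
    rewrite /psi; field; by rewrite gt_eqF// addr_gt0// cosh_gt0.
  rewrite (exprS _ k.+2) (exprS _ k.+1) -[k.+2%:R]natr1.
  move: (psi x ^+ k.+1) (cos (l * x)) (sin (l * x)) (k.+1%:R : R) => P c s n.
  apply/eqP; rewrite -subr_eq0; apply/eqP.
  transitivity (n * (n + 1) * P * c * (sinh x ^+ 2 * psi x ^+ 2 - (1 - 2 * psi x))
    - n * P * c * (cosh x * psi x - (1 - psi x))); first by ring.
  by rewrite E E1 !subrr !mulr0 subrr.
have cf : continuous f.
  have cp j : continuous (fun x : R => psi x ^+ j * cos (l * x)).
    apply: continuousM_fun; last exact: cos_mul_cont.
    by apply: continuousX_fun; exact: psi_cont.
  apply: continuousD_fun; first by apply: continuousM_fun; [exact: continuous_cst|exact: cp].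
  apply: continuousN_fun; apply: continuousM_fun; [exact: continuous_cst|exact: cp].
have If : igr f by apply: igrB; apply: igrZ; exact: igr_psi_hat.
pose C : R := k.+1%:R + `|l|.
have FC x : `|F x| <= C * psi x.
  rewrite /F mulrDl; apply: le_trans (ler_normD _ _) _; apply: lerD.
    rewrite (_ : - _ * _ = - (k.+1%:R * ((sinh x * psi x) * (psi x ^+ k.+1 * cos (l * x))))); last first.
      by rewrite (exprS _ k.+1); move: (sinh x) => sh; ring.
    rewrite normrN normrM normr_nat ler_wpM2l// normrM -[leRHS]mul1r.
    apply: ler_pM => //; first exact: norm_sinh_psi.
    rewrite normrM -[leRHS]mulr1; apply: ler_pM => //; last exact: cos_max.
    by rewrite ger0_norm ?psiX_le// exprn_ge0// ltW// psi_gt0.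
  rewrite normrM ler_wpM2l// normrM -[leRHS]mulr1; apply: ler_pM => //; last exact: sin_max.
  by rewrite ger0_norm ?psiX_le// exprn_ge0// ltW// psi_gt0.
have psin0 := @psi_nat_cvg0 R.
have CF (u : nat -> R) : (forall n, psi (u n) = psi n%:R) -> F (u n) @[n --> \oo] --> 0.
  move=> un; apply/norm_cvg0P.
  apply: (@squeeze_cvgr _ _ _ _ (fun=> 0) (fun n : nat => C * psi (n%:R : R))).
  - by apply: nearW => n; rewrite normr_ge0/= -un FC.
  - exact: cvg_cst.
  - by rewrite -[X in _ --> X](mulr0 C); apply: cvgM => //; exact: cvg_cst.
have := Int_FTC dF cf If (CF _ (fun n => erefl)) (CF (fun n => - n%:R) (fun n => psi_even _)).
rewrite subrr IntB; last 2 first.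
- by apply: igrZ; exact: igr_psi_hat.
- by apply: igrZ; exact: igr_psi_hat.
rewrite !IntZ; try exact: igr_psi_hat.
by move/eqP; rewrite subr_eq0 => /eqP.
Qed.

Lemma psi_hat0_gt0 R (k : nat) : 0 < psi_hat k.+1 (0 : R).
Proof.
apply: Int_gt0; first exact: igr_psi_hat.
by move=> x; rewrite mul0r cos0 mulr1 exprn_gt0// psi_gt0.
Qed.

Lemma norm_psi_hat R (k : nat) (l : R) :
  `|psi_hat k.+1 l| <= psi_hat k.+1 0.
Proof.
apply: le_trans (norm_Int (igr_psi_hat k l)) _.
apply: le_Int; [exact/igr_norm/igr_psi_hat|exact: igr_psi_hat|].
move=> x; rewrite mul0r cos0 normrM ger0_norm ?exprn_ge0 ?(ltW (psi_gt0 x))//.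
by rewrite ler_wpM2l ?cos_max// exprn_ge0// ltW// psi_gt0.
Qed.

(* For large k the mass of psi^k concentrates near 0, where cos is positive. *)
Lemma psi_hat_large R (k : nat) (l : R) :
  4 * l ^+ 2 < k.+1%:R -> 0 < psi_hat k.+2 l.
Proof.
move=> lk; have F0 := psi_hat0_gt0 R k.+1.
have r0 := psi_hat_rec k (0 : R).
rewrite expr0n/= add0r in r0.
have Iw : igr (fun x : R => psi x ^+ k.+2 * cos (0 * x)) by exact: igr_psi_hat.
have Iw1 : igr (fun x : R => psi x ^+ k.+1 * cos (0 * x)) by exact: igr_psi_hat.
(* From cos y >= 1 - y^2 / 2 and x^2 <= 8 (cosh x - 1), where psi^(k+2) (cosh x - 1) = psi^(k+1) - 2
   psi^(k+2). The recursion at l = 0 then turns the bound into [psi_hat k.+2 0] times 1 - 4 l^2 / (k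
   + 1). *)
have h : psi_hat k.+2 0 - (l ^+ 2 / 2) * (8 * (psi_hat k.+1 0 - 2 * psi_hat k.+2 0))
   <= psi_hat k.+2 l.
  rewrite -(IntZ 2)// -IntB//; last exact: igrZ.
  rewrite -!IntZ//; last 2 first.
  - by apply: igrZ; apply: igrB => //; exact: igrZ.
  - by apply: igrB => //; exact: igrZ.
  rewrite -IntB//; last by do 2 apply: igrZ; apply: igrB => //; exact: igrZ.
  apply: le_Int.
  - by apply: igrB => //; do 2 apply: igrZ; apply: igrB => //; exact: igrZ.
  - exact: igr_psi_hat.
  move=> x; rewrite mul0r cos0 !mulr1.
  have p0 : 0 < psi x ^+ k.+2 by rewrite exprn_gt0// psi_gt0.
  have E : psi x ^+ k.+1 = psi x ^+ k.+2 * (1 + cosh x).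
    by rewrite [in RHS]exprSr -mulrA /psi mulVf ?mulr1// gt_eqF// addr_gt0// cosh_gt0.
  rewrite E; have c1 := cos_ge_taylor (l * x); have c2 := cosh_ge x.
  move: (psi x ^+ k.+2) p0 => p p0.
  rewrite (_ : p - _ = p * (1 - l ^+ 2 / 2 * (8 * (cosh x - 1)))); last by ring.
  rewrite ler_pM2l//; apply: le_trans c1; rewrite lerD2l lerN2 exprMn mulrAC.
  rewrite ler_wpM2l ?divr_ge0 ?sqr_ge0//; lra.
apply: lt_le_trans h.
have n0 : 0 < (k.+1%:R : R) by rewrite ltr0n.
have E : psi_hat k.+1 0 - 2 * psi_hat k.+2 0 = psi_hat k.+2 0 / k.+1%:R :> R.
  have n2 : (k.+1%:R ^+ 2 : R) != 0 by rewrite gt_eqF// exprn_gt0.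
  apply: (mulfI n2).
  by rewrite mulrBr r0; field; rewrite gt_eqF.
rewrite E; move: (psi_hat k.+2 0) F0 => P P0.
rewrite (_ : P - _ = P * ((k.+1%:R - 4 * l ^+ 2) / k.+1%:R)); last by field; rewrite gt_eqF.
by rewrite mulr_gt0// divr_gt0// subr_gt0.
Qed.

(** For l != 0 this is 2 pi l / sinh (pi l). *)
Definition tau R (l : R) : R := Int (fun x => psi x * cos (l * x)).

Lemma tauE R (l : R) : tau l = psi_hat 1 l.
Proof. by apply: eq_Int => x; rewrite expr1. Qed.

(** The coefficients in [psi_hat_rec] are positive, so positivity for some large power of psi
    descends to the first. *)
Lemma tau_gt0 R (l : R) : 0 < tau l.
Proof.
rewrite tauE.
pose n := Num.truncn (4 * l ^+ 2).
have hn : 0 < psi_hat n.+2 l by apply: psi_hat_large; exact: truncnS_gt.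
suff down j : 0 < psi_hat j.+1 l -> 0 < psi_hat 1 l by exact: (down n.+1).
elim: j => // j IH h; apply: IH.
have := psi_hat_rec j l => E.
have c0 : 0 < l ^+ 2 + j.+1%:R ^+ 2 by rewrite ltr_wpDl ?sqr_ge0// exprn_gt0.
rewrite -(pmulr_rgt0 _ c0) E mulr_gt0// mulr_gt0// addr_gt0// mulr_gt0//.
Qed.

Lemma tau_cont R : continuous (@tau R).
Proof.
apply: (@continuous_Int _ _ (@psi R)); last exact: igr_psi.
- move=> l; apply: cont_measurable; apply: continuousM_fun; first exact: psi_cont.
  exact: cos_mul_cont.
- move=> x; apply: continuousM_fun; first exact: continuous_cst.
  apply: (@continuous_compR _ cos); first exact: continuous_cos.
  by apply: continuousM_fun; [exact: continuous_idf|exact: continuous_cst].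
- move=> l x; rewrite normrM ger0_norm ?(ltW (psi_gt0 x))// ler_piMr ?cos_max//.
  by rewrite ltW// psi_gt0.
Qed.

(** The recursion at the first power, (1 + l^2) tau(l) = 3 [psi_hat 2 l], gives quadratic decay. *)
Lemma igr_tau R : igr (@tau R).
Proof.
apply: igr_le (igrZ (3 * psi_hat 2 0) (@igr_oneDsqrV R)).
  by apply: cont_measurable; exact: tau_cont.
move=> l; have c0 : 0 < 1 + l ^+ 2 by rewrite ltr_pwDl// sqr_ge0.
rewrite ler_pdivlMr// tauE -[X in _ * X](gtr0_norm c0) -normrM mulrC.
have := psi_hat_rec 0 l; rewrite expr1n (addrC _ 1) => ->.
rewrite (_ : 1 * (2 * 1 + 1) = 3 :> R); last by ring.
by rewrite normrM (ger0_norm (ler0n _ 3)) ler_wpM2l// norm_psi_hat.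
Qed.

(** * Fourier inversion *)

(** Integrability of the limit is a conclusion here, for use where the integrals are controlled but
    no majorant is known. *)
Lemma Int_fatou R (f_ : nat -> R -> R) (f : R -> R) (u : nat -> R) (M : R) :
  (forall n, igr (f_ n)) -> (forall n x, 0 <= f_ n x) ->
  (forall x, f_ ^~ x @ \oo --> f x) ->
  (forall n, Int (f_ n) <= u n) -> u @ \oo --> M ->
  igr f /\ Int f <= M.
Proof.
move=> If f0 ff fu uM.
have ff0 x : 0 <= f x.
  by apply: (le_lim_seq (u := fun=> 0)) (ff x) _ => //; exact: cvg_cst.
have mf : measurable_fun setT f.
  by apply: (measurable_fun_cvg (fun n => igr_measurable (If n))) => x _; exact: ff.
have mE n : measurable_fun setT (EFin \o f_ n).
  by apply/measurable_EFinP; exact: igr_measurable.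
have h : (\int[@lebesgue_measure R]_x (f x)%:E <= M%:E)%E.
  have := @fatou _ _ _ (@lebesgue_measure R) setT measurableT
    (fun n => EFin \o f_ n) mE (fun n x _ => f0 n x).
  have -> : (\int[@lebesgue_measure R]_x limn_einf (fun n => (EFin \o f_ n) x))%E =
      (\int[@lebesgue_measure R]_x (f x)%:E)%E.
    apply: eq_integral => x _.
    have c : (f_ n x)%:E @[n --> \oo] --> (f x)%:E.
      by apply: cvg_EFin; [exact: nearW|exact: ff].
    exact: (cvg_limn_einf_sup c).1.
  move=> /le_trans; apply.
  have cu : (u n)%:E @[n --> \oo] --> M%:E by apply: cvg_EFin; [exact: nearW|].
  rewrite -(cvg_limn_einf_sup cu).1 !limn_einf_lim.
  apply: lee_lim; [exact: is_cvg_einfs|exact: is_cvg_einfs|apply: nearW => m].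
  apply: le_ereal_inf_tmp => _ [k /= mk <-].
  apply: (@le_trans _ _ (\int[@lebesgue_measure R]_x (f_ k x)%:E)%E).
    by apply: ereal_inf_lbound; exists k.
  by rewrite -(EFin_Int (If k)) lee_fin.
have Iff : igr f by apply: ge0_igr => //; exact: le_lt_trans h (ltry _).
by split => //; rewrite -lee_fin EFin_Int.
Qed.

Lemma isd_slope R (f : R -> R) (x df : R) (u : nat -> R) :
  is_derive x 1 f df -> (forall n, 0 < u n) -> u @ \oo --> 0 ->
  (f (x + u n) - f x) / u n @[n --> \oo] --> df.
Proof.
move=> [dfx <-] u0 cu.
have := cvgP _ dfx => _; have h := dfx.
have {}h : h^-1 *: (f (h *: 1 + x) - f x) @[h --> 0^'] --> 'D_1 f x by exact: h.
have := @cvg_comp _ _ _ u _ _ _ _ _ h.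
move=> /(_ \oo) h2; have {}h2 := h2 _.
apply: eq_cvgr (erefl _) (h2 _) => [n|].
  by rewrite /= /GRing.scale/= mulr1 mulrC [x + _]addrC.
move=> A [e /= e0 eA]; move/cvgrPdist_lt : cu => /(_ e e0); apply: filterS => n /= un.
by apply: eA => //=; rewrite gt_eqF.
Qed.

Lemma norm_sin_mul R (l k : R) : `|sin (l * k)| <= `|l| * `|k|.
Proof. by rewrite -normrM norm_sin. Qed.

Lemma cosB_le R (x y : R) : `|cos x - cos y| <= `|x - y|.
Proof.
have hx : x = (x + y) / 2 + (x - y) / 2 by field.
have hy : y = (x + y) / 2 - (x - y) / 2 by field.
have -> : cos x - cos y = - (2 * sin ((x + y) / 2) * sin ((x - y) / 2)).
  rewrite {1}hx [in X in _ - X = _]hy cosD [cos (_ - _)]cosB.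
  by move: (sin _) (sin _) (cos _) (cos _) => a b c d; ring.
rewrite normrN !normrM ger0_norm//.
have h := norm_sin ((x - y) / 2); rewrite normrM [`|2^-1|]gtr0_norm// in h.
have h1 := sin_max ((x + y) / 2).
have h2 := normr_ge0 (sin ((x - y) / 2)).
have h3 := normr_ge0 (sin ((x + y) / 2)).
by move: `|sin ((x - y) / 2)| `|sin ((x + y) / 2)| `|x - y| h h1 h2 h3 => a b c; nra.
Qed.

(** * Cosine transforms of functions of positive type *)

Definition positive_type R (A : R -> R) : Prop :=
  [/\ continuous A, forall s, A (- s) = A s, igr A & pd (fun s s' => A (s - s'))].

Lemma positive_type_norm R (A : R -> R) (s : R) :
  positive_type A -> `|A s| <= A 0.
Proof.
move=> [_ Ae _ Ap].
have sA x y : A (x - y) = A (y - x) by rewrite -Ae opprB.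
have A0 : 0 <= A 0 by have := pd_ge0 0 Ap; rewrite subrr.
have := pd_CauchySchwarz s 0 sA Ap; rewrite !subr0 subrr -expr2.
by rewrite -real_normK ?num_real// ler_pXn2r ?nnegrE.
Qed.

Definition cos_transform R (A : R -> R) (l : R) : R :=
  Int (fun s => A s * cos (l * s)).

Section cos_transform.
Context (R : realType) (A : R -> R).
Context (ptA : positive_type A).
Let cA : continuous A. Proof. by case: ptA. Qed.
Let eA s : A (- s) = A s. Proof. by case: ptA. Qed.
Let iA : igr A. Proof. by case: ptA. Qed.
Let pA : pd (fun s s' => A (s - s')). Proof. by case: ptA. Qed.

Lemma igr_cos_transform_integrand (l : R) : igr (fun s => A s * cos (l * s)).
Proof.
apply: igr_le (igr_norm iA) => [|s].
  by apply: measurable_funM; apply: cont_measurable => //; exact: cos_mul_cont.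
by rewrite normrM ler_piMr// cos_max.
Qed.

Lemma cos_transform_bound (l : R) : `|cos_transform A l| <= Int (fun s => `|A s|).
Proof.
apply: le_trans (norm_Int (igr_cos_transform_integrand l)) _.
apply: le_Int; [exact/igr_norm/igr_cos_transform_integrand|exact: igr_norm|].
by move=> s; rewrite normrM ler_piMr// cos_max.
Qed.

Lemma cos_transform_continuous : continuous (cos_transform A).
Proof.
apply: (@continuous_Int _ _ (fun s => `|A s|)); last exact: igr_norm.
- by move=> l; apply: igr_measurable; exact: igr_cos_transform_integrand.
- move=> x; apply: continuousM_fun; first exact: continuous_cst.
  apply: (@continuous_compR _ cos); first exact: continuous_cos.
  by apply: continuousM_fun; [exact: continuous_idf|exact: continuous_cst].
- by move=> l s; rewrite normrM ler_piMr// cos_max.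
Qed.

(** Multiplication by cos (l s) preserves positive type, so the integral against every Gaussian is
    nonnegative; then the Gaussians tend to 1. *)
Lemma cos_transform_ge0 (l : R) : 0 <= cos_transform A l.
Proof.
have cv : Int (fun s => (A s * cos (l * s)) * expR (- (n.+1%:R^-1 * s ^+ 2)))
    @[n --> \oo] --> cos_transform A l.
  apply: (@Int_dct _ _ _ (fun s => `|A s|)).
  - move=> n; apply: measurable_funM; first by apply: igr_measurable; exact: igr_cos_transform_integrand.
    by apply: cont_measurable; exact: continuous_gauss.
  - move=> s; rewrite -[X in _ --> X]mulr1; apply: cvgM; first exact: cvg_cst.
    rewrite -[X in _ --> X]expR0.
    apply: (@continuous_cvg _ _ _ _ _ _ expR); first exact: continuous_expR.
    rewrite -oppr0 -[X in _ --> - X](mul0r (s ^+ 2)).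
    by apply: cvgN; apply: cvgM; [exact: cvg_harmonic|exact: cvg_cst].
  - move=> n s; rewrite !normrM -mulrA ler_piMr// mulr_ile1 ?cos_max//.
    by rewrite ger0_norm ?expR_ge0// -expR0 ler_expR oppr_le0 mulr_ge0// sqr_ge0.
  - exact: igr_norm.
apply: (le_lim_seq (u := fun=> 0)) cv _; first exact: cvg_cst.
move=> n; apply: (@gauss_average _ _ (A 0)).
- by apply: continuousM_fun => //; exact: cos_mul_cont.
- by move=> u; rewrite normrM; apply: le_trans (positive_type_norm u ptA); rewrite ler_piMr// cos_max.
- by move=> u; rewrite eA mulrN cosN.
- move=> s; have := pd_cos (fun x => l * x) pA [seq (1, x) | x <- s].
  rewrite big_map; apply: eq_ge0; apply: eq_bigr => x _; rewrite big_map.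
  by apply: eq_bigr => y _ /=; rewrite !mul1r mulrBr mulrC.
- by rewrite invr_gt0.
Qed.

Let igr_translate (k e : R) : igr (fun v => A (e * v + k) * tau v).
Proof.
apply: (@igr_bounded_mul _ _ _ (A 0)); last exact: igr_tau.
  by apply: cont_measurable; apply: continuous_compR => //; exact: continuous_affine.
by move=> v; exact: positive_type_norm.
Qed.

(** The transform of psi (e l) is tau rescaled to width e, an approximate identity of mass
    [Int tau]; the substitution s = e v + k moves the scale into A. *)
Let translate (k e : R) : 0 < e ->
  Int (fun s => A s * Int (fun l => psi (e * l) * cos (l * (s - k)))) =
  Int (fun v => A (e * v + k) * tau v).
Proof.
move=> e0.
have T x : Int (fun l => psi (e * l) * cos (l * x)) = e^-1 * tau (e^-1 * x).
  have cf : continuous (fun y => psi y * cos (e^-1 * x * y)).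
    by apply: continuousM_fun; [exact: psi_cont|exact: cos_mul_cont].
  have If : igr (fun y => psi y * cos (e^-1 * x * y)).
    by have := igr_psi_hat 0 (e^-1 * x); apply: eq_igr => y; rewrite expr1.
  rewrite /tau (Int_affine 0 e0 cf If) mulKf ?gt_eqF//; apply: eq_Int => l.
  by rewrite addr0; congr (_ * cos _); field; rewrite gt_eqF.
have cf : continuous (fun s => A s * (e^-1 * tau (e^-1 * (s - k)))).
  apply: continuousM_fun => //; apply: continuousM_fun; first exact: continuous_cst.
  apply: continuous_compR; first exact: tau_cont.
  by apply: continuousM_fun; [exact: continuous_cst|exact: continuous_subr].
have If : igr (fun s => A s * (e^-1 * tau (e^-1 * (s - k)))).
  apply: (@eq_igr _ (fun s => (e^-1 * tau (e^-1 * (s - k))) * A s)).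
    by move=> s; rewrite mulrC.
  apply: (@igr_bounded_mul _ _ _ (e^-1 * psi_hat 1 0)) => //.
    apply: cont_measurable; apply: continuousM_fun; first exact: continuous_cst.
    apply: continuous_compR; first exact: tau_cont.
    by apply: continuousM_fun; [exact: continuous_cst|exact: continuous_subr].
  move=> s; rewrite normrM gtr0_norm ?invr_gt0// ler_wpM2l ?invr_ge0 ?(ltW e0)//.
  by rewrite tauE norm_psi_hat.
transitivity (Int (fun s => A s * (e^-1 * tau (e^-1 * (s - k))))).
  by apply: eq_Int => s; rewrite T.
rewrite (Int_affine k e0 cf If) -IntZ.
  apply: eq_Int => v; rewrite addrK mulKf ?gt_eqF//; field; by rewrite gt_eqF.
apply: (@eq_igr _ (fun v => e^-1 * (A (e * v + k) * tau v))).
  by move=> v; rewrite addrK mulKf ?gt_eqF//; ring.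
by apply: igrZ; exact: igr_translate.
Qed.

Lemma igr_damped (k e : R) : 0 < e ->
  igr (fun l => cos_transform A l * (psi (e * l) * cos (l * k))).
Proof.
move=> e0; apply: (@igr_bounded_mul _ _ _ (Int (fun s => `|A s|))).
- by apply: cont_measurable; exact: cos_transform_continuous.
- exact: cos_transform_bound.
have cpe : continuous (fun l => psi (e * l)).
  apply: continuous_compR; first exact: psi_cont.
  by apply: continuousM_fun; [exact: continuous_cst|exact: continuous_idf].
have ip : igr (fun l => psi (e * l)).
  have := igr_affine 0 e0 (@psi_cont R) (@igr_psi R).
  by apply: eq_igr => l; rewrite addr0.
apply: igr_le ip.
  apply: measurable_funM; first exact: cont_measurable.
  exact: measurable_cosr.
by move=> l; rewrite normrM ger0_norm ?(ltW (psi_gt0 _))// ler_piMr ?cos_max// ltW// psi_gt0.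
Qed.

(** The damping by psi justifies Fubini, and cos (l s) cos (l k) is the half-sum of the cosines of l
    (s - k) and l (s + k), hence the two translates. *)
Lemma damped_inversion (k e : R) : 0 < e ->
  Int (fun l => cos_transform A l * (psi (e * l) * cos (l * k))) =
  (Int (fun v => A (e * v + k) * tau v) + Int (fun v => A (e * v - k) * tau v)) / 2.
Proof.
move=> e0.
have ip : igr (fun l => psi (e * l)).
  have := igr_affine 0 e0 (@psi_cont R) (@igr_psi R).
  by apply: eq_igr => l; rewrite addr0.
have mp : measurable_fun setT (fun l => psi (e * l)) by exact: igr_measurable ip.
have ipc x : igr (fun l => psi (e * l) * cos (l * x)).
  apply: igr_le ip.
    apply: measurable_funM => //.
    exact: measurable_cosr.
  by move=> l; rewrite normrM ger0_norm ?(ltW (psi_gt0 _))// ler_piMr ?cos_max// ltW// psi_gt0.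
pose F l s := (A s * cos (l * s)) * (psi (e * l) * cos (l * k)).
have mF : measurable_fun setT (fun z : R * R => F z.1 z.2).
  have m1 : measurable_fun setT (fun z : R * R => z.1) by exact: measurable_fst.
  have m2 : measurable_fun setT (fun z : R * R => z.2) by exact: measurable_snd.
  have mc := cont_measurable (@continuous_cos R).
  apply: measurable_funM.
    apply: measurable_funM.
      by apply: (measurableT_comp (cont_measurable cA)).
    by apply: (measurableT_comp mc); exact: measurable_funM.
  apply: measurable_funM.
    by apply: (measurableT_comp mp).
  by apply: (measurableT_comp mc); apply: measurable_funM.
have bF l s : `|F l s| <= psi (e * l) * `|A s|.
  rewrite /F !normrM [`|psi _|]ger0_norm ?(ltW (psi_gt0 _))//.
  rewrite [leLHS](_ : _ = psi (e * l) * (`|A s| * (`|cos (l * s)| * `|cos (l * k)|))); last first.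
    by move: (psi _) => p; ring.
  rewrite ler_wpM2l ?(ltW (psi_gt0 _))//.
  have := cos_max (l * s); have := cos_max (l * k).
  move: `|cos (l * s)| `|cos (l * k)| (normr_ge0 (cos (l * s))) (normr_ge0 (cos (l * k))).
  by move=> a b a0 b0 b1 a1; rewrite ler_piMr// mulr_ile1.
have E1 l : cos_transform A l * (psi (e * l) * cos (l * k)) = Int (F l).
  by rewrite /cos_transform -IntZr//; exact: igr_cos_transform_integrand.
rewrite (eq_Int E1) (Int_fubini mF bF ip (igr_norm iA)).
rewrite -(translate k e0); have -> : (fun v => A (e * v - k) * tau v) = (fun v => A (e * v + (- k)) * tau v) by [].
rewrite -(translate (- k) e0).
have It x : igr (fun s => A s * Int (fun l => psi (e * l) * cos (l * (s - x)))).
  have := @igr_Int _ (fun s l => A s * (psi (e * l) * cos (l * (s - x)))) (fun s => `|A s|) (fun l => psi (e * l)).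
  move=> h; apply: eq_igr (h _ _ (igr_norm iA) ip) => [s||].
  - by rewrite IntZ.
  - have m1 : measurable_fun setT (fun z : R * R => z.1) by exact: measurable_fst.
    have m2 : measurable_fun setT (fun z : R * R => z.2) by exact: measurable_snd.
    apply: measurable_funM; first by apply: (measurableT_comp (cont_measurable cA)).
    apply: measurable_funM; first by apply: (measurableT_comp mp).
    apply: (measurableT_comp (cont_measurable (@continuous_cos R))).
    by apply: measurable_funM => //; exact: measurable_funB.
  - move=> s l; rewrite !normrM ler_wpM2l// ger0_norm ?(ltW (psi_gt0 _))//.
    by rewrite ler_piMr ?cos_max// ltW// psi_gt0.
rewrite -IntD// -IntZr; last exact: igrD.
apply: eq_Int => s; rewrite /F -mulrDr -IntD//.
transitivity (Int (fun l => (A s / 2) * (psi (e * l) * cos (l * (s - k)) + psi (e * l) * cos (l * (s + k))))).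
  apply: eq_Int => l; rewrite (mulrBr l s k) (mulrDr l s k) cosB cosD; move: (cos (l * k)) => ck.
  by field.
rewrite IntZ; last by apply: igrD.
by rewrite opprK mulrAC.
Qed.

Lemma damped_cvg (k : R) :
  Int (fun l => cos_transform A l * (psi (n.+1%:R^-1 * l) * cos (l * k)))
    @[n --> \oo] --> A k * Int (@tau R).
Proof.
have lim k' : Int (fun v => A (n.+1%:R^-1 * v + k') * tau v) @[n --> \oo] --> A k' * Int (@tau R).
  rewrite -IntZ; last exact: igr_tau.
  apply: (@Int_dct _ _ _ (fun v => A 0 * tau v)).
  - by move=> n; apply: igr_measurable; exact: igr_translate.
  - move=> v; apply: cvgM; last exact: cvg_cst.
    apply: (@continuous_cvg _ _ _ _ _ _ A); first exact: cA.
    rewrite -[X in _ --> X]add0r -(mul0r v); apply: cvgD; last exact: cvg_cst.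
    by apply: cvgM; [exact: cvg_harmonic|exact: cvg_cst].
  - move=> n v; rewrite normrM [`|tau v|]gtr0_norm ?tau_gt0// ler_wpM2r ?(ltW (tau_gt0 _))//.
    exact: positive_type_norm.
  - by apply: igrZ; exact: igr_tau.
have h : (Int (fun v => A (n.+1%:R^-1 * v + k) * tau v) +
     Int (fun v => A (n.+1%:R^-1 * v - k) * tau v)) / 2 @[n --> \oo] -->
     (A k * Int (@tau R) + A (- k) * Int (@tau R)) / 2.
  by apply: cvgM; [apply: cvgD; exact: lim|exact: cvg_cst].
apply: eq_cvgr h => [n|]; first by rewrite damped_inversion// invr_gt0.
by rewrite eA; field.
Qed.

Let psi_cvg (l : R) : psi (n.+1%:R^-1 * l) @[n --> \oo] --> (2^-1 : R).
Proof.
have -> : 2^-1 = psi 0 :> R by rewrite /psi cosh0.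
apply: (@continuous_cvg _ _ _ _ _ _ (@psi R)); first exact: psi_cont.
rewrite -(mul0r l); apply: cvgM; [exact: cvg_harmonic|exact: cvg_cst].
Qed.

(** At k = 0 the damped integrands are nonnegative and their integrals converge to [A 0] times
    [Int tau], so Fatou applies; the limit is half the transform because psi 0 = 1/2. *)
Lemma igr_cos_transform : igr (cos_transform A).
Proof.
have h : igr (fun l => cos_transform A l / 2) /\
    Int (fun l => cos_transform A l / 2) <= A 0 * Int (@tau R).
  apply: (@Int_fatou _ (fun n l => cos_transform A l * (psi (n.+1%:R^-1 * l) * cos (l * 0))) _
    (fun n => Int (fun l => cos_transform A l * (psi (n.+1%:R^-1 * l) * cos (l * 0))))); last 2 first.
  - by move=> n; exact: lexx.
  - exact: damped_cvg.
  - by move=> n; apply: igr_damped; rewrite invr_gt0.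
  - by move=> n l; rewrite mulr0 cos0 mulr1 mulr_ge0 ?cos_transform_ge0// ltW// psi_gt0.
  - move=> l; apply: cvgM; first exact: cvg_cst.
    rewrite mulr0 cos0 -[X in _ --> X]mulr1; apply: cvgM; last exact: cvg_cst.
    exact: psi_cvg.
have [h1 _] := h.
by apply: eq_igr (igrZ 2 h1) => l; field.
Qed.

Lemma igr_cos_transform_mul (f : R -> R) (M : R) : measurable_fun setT f ->
  (forall l, `|f l| <= M) -> igr (fun l => cos_transform A l * f l).
Proof.
move=> mf fM; apply: eq_igr (igr_bounded_mul mf fM igr_cos_transform) => l.
by rewrite mulrC.
Qed.

(** Once the transform is integrable, dominated convergence removes the damping. The factor 2 is 1 /
    psi 0, and twice [Int tau] is the usual 2 pi. *)
Lemma cos_inversion (k : R) :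
  Int (fun l => cos_transform A l * cos (l * k)) = 2 * Int (@tau R) * A k.
Proof.
have h : Int (fun l => cos_transform A l * (psi (n.+1%:R^-1 * l) * cos (l * k)))
    @[n --> \oo] --> Int (fun l => 2^-1 * (cos_transform A l * cos (l * k))).
  apply: (@Int_dct _ _ _ (cos_transform A)).
  - by move=> n; apply: igr_measurable; apply: igr_damped; rewrite invr_gt0.
  - move=> l; rewrite mulrCA; apply: cvgM; first exact: cvg_cst.
    by apply: cvgM; [exact: psi_cvg|exact: cvg_cst].
  - move=> n l; rewrite normrM (ger0_norm (cos_transform_ge0 l)) ler_piMr ?cos_transform_ge0//.
    by rewrite normrM mulr_ile1 ?cos_max// ger0_norm ?psi_le1// ltW// psi_gt0.
  - exact: igr_cos_transform.
have E : Int (fun l => 2^-1 * (cos_transform A l * cos (l * k))) = A k * Int (@tau R).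
  by rewrite -(cvg_lim _ h)// (cvg_lim _ (@damped_cvg k)).
rewrite IntZ in E; first by rewrite -mulrA [_ * A k]mulrC -E; field.
by apply: (igr_cos_transform_mul (@measurable_cosr R k)) => l; exact: cos_max.
Qed.

(** cosh x - 1 = 2 sinh^2 (x / 2), and sinh y <= y cosh y. *)
Lemma cosh_le_sqr (x : R) : 0 <= x -> cosh x - 1 <= x ^+ 2 / 2 * cosh x.
Proof.
move=> x0.
have S (y : R) : 0 <= y -> sinh y <= y * cosh y.
  move=> y0; rewrite -subr_ge0 (_ : 0 = 0 * cosh 0 - sinh 0 :> R); last by rewrite mul0r sinh0 subrr.
  apply: (@ge_of_derive _ (fun z => z * cosh z - sinh z) (fun z => z * sinh z)) => //.
    move=> z; apply: (isd_eq (isdD (isdM (isd_id z) (isd_cosh z)) (isdN (isd_sinh z)))) => //.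
    by rewrite mul1r addrAC subrr add0r.
  by move=> z z0; rewrite mulr_ge0//; apply: le_trans (sinh_ge z0).
have x2 : 0 <= x / 2 by rewrite divr_ge0.
have h := S _ x2.
have D : cosh x = 2 * cosh (x / 2) ^+ 2 - 1.
  by rewrite -cosh_double; congr cosh; field.
have s2 := sqr_sinh (x / 2).
have s0 : 0 <= sinh (x / 2) by apply: le_trans (sinh_ge x2).
have c1 := cosh_ge1 (x / 2).
rewrite D; move: (cosh (x / 2)) (sinh (x / 2)) h s2 s0 c1 => c s h s2 s0 c1.
have h2 : s ^+ 2 <= (x / 2 * c) ^+ 2 by rewrite ler_pXn2r ?nnegrE ?mulr_ge0//; lra.
have c2 : 1 <= c ^+ 2 by rewrite exprn_ege1.
rewrite exprMn in h2.
have e : (x / 2) ^+ 2 = x ^+ 2 / 4 by field.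
rewrite e in h2; have := sqr_ge0 x; move: (x ^+ 2) h2 => X h2 X0.
have -> : 2 * c ^+ 2 - 1 - 1 = 2 * s ^+ 2 by rewrite s2; ring.
apply: (@le_trans _ _ (X / 2 * c ^+ 2)); first by lra.
rewrite ler_wpM2l//; lra.
Qed.

Context (A_lip : forall d, 0 <= d -> A 0 - A d <= cosh d - 1).

(** (1 - cos (l u)) / u^2 is nonnegative and tends to l^2 / 2 with u; inversion and the quadratic
    bound on A 0 - A u keep its integrals against the transform bounded, so Fatou applies. *)
Lemma igr_sqr_cos_transform : igr (fun l => l ^+ 2 * cos_transform A l).
Proof.
pose u (n : nat) : R := n.+1%:R^-1.
have u0 n : 0 < u n by rewrite invr_gt0.
have cu : u @ \oo --> 0 by exact: cvg_harmonic.
pose F n l := cos_transform A l * (2 * (sin (l * u n / 2) / u n) ^+ 2).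
have FE n l : F n l = (u n ^+ 2)^-1 * (cos_transform A l * cos (l * 0) - cos_transform A l * cos (l * u n)).
  rewrite /F mulr0 cos0.
  have -> : cos (l * u n) = 1 - 2 * sin (l * u n / 2) ^+ 2.
    have {1}-> : l * u n = l * u n / 2 + l * u n / 2 by field.
    by rewrite cosD -!expr2 cos2sin2; ring.
  by field; rewrite gt_eqF.
have Ic k : igr (fun l => cos_transform A l * cos (l * k)).
  by apply: (igr_cos_transform_mul (@measurable_cosr R k)) => l; exact: cos_max.
have IF n : igr (F n).
  by apply: eq_igr (igrZ (u n ^+ 2)^-1 (igrB (Ic 0) (Ic (u n)))) => l; rewrite FE.
have h : igr (fun l => cos_transform A l * (2 * (l / 2) ^+ 2)) /\
    Int (fun l => cos_transform A l * (2 * (l / 2) ^+ 2)) <= Int (@tau R) * 1.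
  apply: (@Int_fatou _ F _ (fun n => Int (@tau R) * cosh (u n))) => //.
  - by move=> n l; rewrite mulr_ge0 ?cos_transform_ge0// mulr_ge0// sqr_ge0.
  - move=> l; apply: cvgM; first exact: cvg_cst.
    apply: cvgM; first exact: cvg_cst.
    have d : is_derive (0 : R) 1 (fun y : R => sin (l / 2 * y)) (l / 2).
      apply: (isd_eq (isd_comp (is_derive_sin (l / 2 * 0)) (isd_mulc 0 (l / 2)))) => //.
      by rewrite mulr0 cos0 mul1r.
    have := isd_slope d u0 cu.
    rewrite mulr0 sin0 => h.
    have {}h : sin (l * u n / 2) / u n @[n --> \oo] --> l / 2.
      by apply: eq_cvgr h => // n; rewrite add0r subr0; congr (sin _ / _); ring.
    by rewrite !expr2; under eq_fun do rewrite expr2; exact: cvgM.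
  - move=> n; rewrite (eq_Int (FE n)) IntZ; last exact: igrB.
    rewrite IntB// !cos_inversion -mulrBr.
    have T0 : 0 < Int (@tau R) by apply: Int_gt0; [exact: igr_tau|exact: tau_gt0].
    have a := A_lip (ltW (u0 n)); have b := cosh_le_sqr (ltW (u0 n)).
    have un := u0 n; rewrite mulrC ler_pdivrMr ?exprn_gt0//; clear FE IF F.
    move: (Int (@tau R)) T0 => T T0.
    have {a b} := le_trans a b; move: (cosh (u n)) (u n) (A 0 - A (u n)) => c v D h.
    rewrite [leRHS](_ : _ = 2 * T * (v ^+ 2 / 2 * cosh v)).
      by rewrite ler_wpM2l// mulr_ge0// ltW.
    by move: (cosh v) => c'; field.
  - apply: cvgM; first exact: cvg_cst; rewrite -(cosh0 R).
    by apply: (@continuous_cvg _ _ _ _ _ _ (@cosh R)) cu; exact: cosh_cont.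
have [h1 _] := h.
by apply: eq_igr (igrZ 2 h1) => l; field.
Qed.

Lemma igr_mul_cos_transform : igr (fun l => l * cos_transform A l).
Proof.
apply: igr_le (igrD igr_cos_transform igr_sqr_cos_transform).
  apply: measurable_funM => //; exact: igr_measurable igr_cos_transform.
move=> l; rewrite normrM (ger0_norm (cos_transform_ge0 l)).
rewrite -[X in X + _]mul1r -mulrDl ler_wpM2r ?cos_transform_ge0//.
rewrite -(real_normK (num_real l)); have := normr_ge0 l; move: `|l| => x x0.
nra.
Qed.

(** The cosine inversion is differentiated in k from the right along the steps 1 / (n + 1), the
    quotients being dominated by |l| times the transform. *)
Lemma sin_inversion (k d : R) : 0 <= k ->
  ((A (k + n.+1%:R^-1) - A k) * n.+1%:R) @[n --> \oo] --> d ->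
  Int (fun l => l * cos_transform A l * sin (l * k)) = - (2 * Int (@tau R) * d).
Proof.
move=> k0 hd.
pose u (n : nat) : R := n.+1%:R^-1.
have u0 n : 0 < u n by rewrite invr_gt0.
have cu : u @ \oo --> 0 by exact: cvg_harmonic.
have Ic k' : igr (fun l => cos_transform A l * cos (l * k')).
  by apply: (igr_cos_transform_mul (@measurable_cosr R k')) => l; exact: cos_max.
pose F n l := cos_transform A l * ((cos (l * (k + u n)) - cos (l * k)) / u n).
have IF n : Int (F n) = 2 * Int (@tau R) * ((A (k + u n) - A k) * n.+1%:R).
  transitivity (Int (fun l => (u n)^-1 * (cos_transform A l * cos (l * (k + u n)) - cos_transform A l * cos (l * k)))).
    by apply: eq_Int => l; rewrite /F; ring.
  by rewrite IntZ ?IntB ?cos_inversion//; [rewrite invrK; ring|exact: igrB].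
have c1 : Int (F n) @[n --> \oo] --> 2 * Int (@tau R) * d.
  by apply: eq_cvgr (cvgM (cvg_cst (2 * Int (@tau R))) hd) => // n; rewrite IF.
have c2 : Int (F n) @[n --> \oo] --> Int (fun l => - (l * cos_transform A l * sin (l * k))).
  apply: (@Int_dct _ _ _ (fun l => `|l * cos_transform A l|)).
  - move=> n; apply: measurable_funM; first exact: igr_measurable igr_cos_transform.
    apply: measurable_funM; first by apply: measurable_funB; exact: measurable_cosr.
    exact: measurable_cst.
  - move=> l; have d1 : is_derive k 1 (fun y : R => cos (l * y)) (- sin (l * k) * l).
      exact: isd_comp (is_derive_cos (l * k)) (isd_mulc k l).
    have h := cvgM (cvg_cst (cos_transform A l)) (isd_slope d1 u0 cu).
    rewrite (_ : - _ = cos_transform A l * (- sin (l * k) * l)); last by ring.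
    exact: h.
  - move=> n l; rewrite /F !normrM mulrC ler_wpM2r// [`|(u n)^-1|]gtr0_norm ?invr_gt0//.
    rewrite ler_pdivrMr//; apply: le_trans (cosB_le _ _) _.
    by rewrite mulrDr addrAC subrr add0r normrM (gtr0_norm (u0 n)).
  - exact/igr_norm/igr_mul_cos_transform.
have E : Int (fun l => - (l * cos_transform A l * sin (l * k))) = 2 * Int (@tau R) * d.
  by rewrite -(cvg_lim _ c1)// (cvg_lim _ c2).
rewrite -E -mulN1r -IntZ; last first.
  apply: (@eq_igr _ (fun l => -1 * (l * cos_transform A l * sin (l * k)))).
    by move=> l; rewrite mulN1r.
  apply: igrZ; apply: igr_le (igr_norm igr_mul_cos_transform) => [|l].
    apply: measurable_funM; [exact: igr_measurable igr_mul_cos_transform|exact: measurable_sinr].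
  by rewrite normrM ler_piMr// sin_max.
by apply: eq_Int => l; rewrite mulN1r opprK.
Qed.

End cos_transform.

Lemma coshD R (x y : R) :
  cosh (x + y) = cosh x * cosh y + sinh x * sinh y.
Proof. by rewrite /cosh /sinh opprD !expRD; field. Qed.

Lemma cosh_ltD R (x y : R) : 0 <= x -> 0 < y -> cosh x < cosh (x + y).
Proof.
move=> x0 y0; rewrite coshD ltr_wpDr//.
  by rewrite mulr_ge0//; [apply: le_trans (sinh_ge x0)|apply: le_trans (sinh_ge (ltW y0)); exact: ltW].
rewrite -[X in X < _]mulr1 ltr_pM2l ?cosh_gt0//.
by apply: lt_le_trans (cosh_ge y); rewrite ltrDl divr_gt0// exprn_gt0.
Qed.

Lemma primitive_positive_type R (f : R -> R) (l : R) :
  continuous f -> (forall x, `|f x| <= 1) ->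
  (forall s, `|l - primitive f (cosh s - 1)| <= 24 / cosh (s / 2)) ->
  pd (fun s s' : R => l - primitive f (cosh (s - s') - 1)) ->
  positive_type (fun s => l - primitive f (cosh s - 1)).
Proof.
move=> cf f1 bA pA; have mf := cont_measurable cf.
have b0 s : 0 <= cosh s - 1 :> R by rewrite subr_ge0 cosh_ge1.
have cA : continuous (fun s => l - primitive f (cosh s - 1)).
  apply: continuousD_fun; first exact: continuous_cst.
  apply: continuousN_fun => s; apply/cvgrPdist_le => e e0.
  have /cvgrPdist_le/(_ e e0) := @cosh_cont R s.
  apply: filterS => s' h.
  wlog ss : s s' h / cosh s' <= cosh s => [hw|].
    have /orP[ss|ss] := le_total (cosh s') (cosh s); first exact: hw.
    by rewrite distrC; apply: hw => //; rewrite distrC.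
  have := @primitive_lip _ f (cosh s' - 1) (cosh s - 1) (b0 _) _ mf f1.
  rewrite lerD2r => /(_ ss) /le_trans; apply.
  by rewrite opprB addrA subrK; apply: le_trans (ler_norm _) h.
split; [exact: cA| |rewrite /=|exact: pA].
- by move=> s; rewrite cosh_even.
(* 768 = 24 * 32: by [cosh_ge], 24 / cosh (s / 2) is at most 24 / (1 + s^2 / 32). *)
- apply: igr_le (igrZ 768 (@igr_oneDsqrV R)); first exact: cont_measurable.
  move=> s; apply: le_trans (bA s) _.
  have c := cosh_ge (s / 2); have s2 := sqr_ge0 s.
  have q0 : 0 < 1 + s ^+ 2 by rewrite ltr_pwDl.
  rewrite ler_pdivrMr ?cosh_gt0// mulrAC ler_pdivlMr//.
  have e : (s / 2) ^+ 2 = s ^+ 2 / 4 by field.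
  rewrite e in c; move: (cosh _) c => c' c; lra.
Qed.

Lemma primitive_slope R (f : R -> R) (l k : R) : 0 <= k ->
  continuous f -> (forall x, `|f x| <= 1) ->
  ((l - primitive f (cosh (k + n.+1%:R^-1) - 1)) - (l - primitive f (cosh k - 1)))
    * n.+1%:R @[n --> \oo] --> - (f (cosh k - 1) * sinh k).
Proof.
move=> k0 cf f1.
pose u (n : nat) : R := n.+1%:R^-1.
have u0 n : 0 < u n by rewrite invr_gt0.
have cu : u @ \oo --> 0 by exact: cvg_harmonic.
pose x := cosh k - 1; pose v n := cosh (k + u n) - 1.
have xv n : x < v n by rewrite ltrD2r cosh_ltD.
have cv : v @ \oo --> x.
  apply: cvgB; last exact: cvg_cst.
  apply: (@continuous_cvg _ _ _ _ _ _ (@cosh R)); first exact: cosh_cont.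
  by rewrite -[X in _ --> X]addr0; apply: cvgD => //; exact: cvg_cst.
have x0 : 0 <= x by rewrite subr_ge0 cosh_ge1.
have h1 := primitive_derivative x0 cf f1 xv cv.
have h2 := isd_slope (isd_cosh k) u0 cu.
apply: (eq_cvgr _ _ (cvgN (cvgM h1 h2))) => [n|]; last by [].
have e : cosh (k + u n) - cosh k = v n - x by rewrite /v /x opprB addrA subrK.
have vx : v n - x != 0 by rewrite gt_eqF// subr_gt0.
transitivity (((l - primitive f (v n)) - (l - primitive f x)) * (u n)^-1); last first.
  by rewrite /u invrK.
rewrite [LHS]/= e.
have un : u n != 0 by rewrite gt_eqF.
rewrite /= ; move: (u n) un (v n - x) vx (primitive f (v n)) (primitive f x) => U U0 V V0 P Q.
by field; rewrite U0 V0.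
Qed.

Lemma spectral_density R (f : R -> R) :
  continuous f -> (forall x, `|f x| <= 1) -> f 0 = 1 ->
  (forall eta, 0 < eta -> pd (laplace_kernel f eta)) ->
  exists rho : R -> R, [/\ continuous rho /\ rho 0 = 0, forall l, 0 <= rho l,
    igr rho /\ igr (fun l => rho l / l), Int rho = 1 &
    forall k, 0 <= k ->
      f (cosh k - 1) * sinh k = Int (fun l => rho l / l * sin (l * k))].
Proof.
move=> cf f1 f01 pK; have [l [bA pA]] := primitive_limit cf f1 pK.
have ptA := primitive_positive_type cf f1 bA pA.
set A := (X in positive_type X) in ptA.
(* A 0 - A d is the integral of f over [0, cosh d - 1[, and |f| <= 1. *)
have A_lip d : 0 <= d -> A 0 - A d <= cosh d - 1.
  move=> d0; have := @primitive_lip _ f (cosh 0 - 1) (cosh d - 1).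
  rewrite cosh0 subrr subr0 => /(_ (lexx _)).
  rewrite subr_ge0 cosh_ge1 => /(_ isT (cont_measurable cf) f1).
  apply: le_trans; rewrite /A cosh0 subrr; apply: le_trans (ler_norm _).
  by rewrite opprB addrA addrAC (addrAC l) subrr sub0r addrC.
pose a := cos_transform A; pose C := (2 * Int (@tau R))^-1.
have T0 : 0 < Int (@tau R) by apply: Int_gt0; [exact: igr_tau|exact: tau_gt0].
have C0 : 0 < C by rewrite invr_gt0 mulr_gt0.
have a0 s : 0 <= a s by exact: cos_transform_ge0.
pose rho s := C * (s ^+ 2 * a s).
have Irho : igr rho by apply: igrZ; exact: igr_sqr_cos_transform.
have crho : continuous rho.
  apply: continuousM_fun; first exact: continuous_cst.
  apply: continuousM_fun; last exact: cos_transform_continuous.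
  by apply: continuousX_fun; exact: continuous_idf.
have rho0 s : 0 <= rho s by rewrite mulr_ge0 ?(ltW C0)// mulr_ge0// sqr_ge0.
have rho00 : rho 0 = 0 by rewrite /rho expr0n/= mul0r mulr0.
(* At s = 0 both sides are 0, since division by 0 yields 0. *)
have rhoE s : rho s / s = C * (s * a s).
  have [->|s0] := eqVneq s 0; first by rewrite rho00 !mul0r mulr0.
  by rewrite /rho; field.
have I1 : igr (fun s => s * a s) by apply: igr_mul_cos_transform.
have main k : 0 <= k -> f (cosh k - 1) * sinh k = Int (fun s => rho s / s * sin (s * k)).
  move=> k0; have := sin_inversion ptA A_lip k0 (primitive_slope l k0 cf f1).
  have -> : Int (fun s => rho s / s * sin (s * k)) = C * Int (fun s => s * a s * sin (s * k)).
    rewrite -IntZ; first by apply: eq_Int => s; rewrite rhoE mulrA.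
    apply: igr_le (igr_norm I1) => [|s].
      apply: measurable_funM; first exact: igr_measurable I1.
      exact: measurable_sinr.
    by rewrite normrM ler_piMr// sin_max.
  move=> ->; rewrite -mulrN opprK [RHS]mulrA.
  by rewrite /C mulVf ?mul1r// gt_eqF// mulr_gt0.
exists rho; split => //.
  by split=> //; apply: eq_igr (igrZ C I1) => s; rewrite rhoE.
(* For the mass of rho, both sides of the formula for f are divided by k = u n. The left one tends
   to f 0 = 1; the right one is dominated by rho because |sin (s k)| <= |s k|. *)
pose u (n : nat) : R := n.+1%:R^-1.
have u0 n : 0 < u n by rewrite invr_gt0.
have cu : u @ \oo --> 0 by exact: cvg_harmonic.
have c1 : f (cosh (u n) - 1) * (sinh (u n) / u n) @[n --> \oo] --> (1 : R).
  rewrite -[X in _ --> X]mulr1; apply: cvgM.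
    rewrite -[X in _ --> X]f01; apply: (@continuous_cvg _ _ _ _ _ _ f); first exact: cf.
    rewrite -(subrr 1) -[X in _ --> X - _](cosh0 R); apply: cvgB; last exact: cvg_cst.
    by apply: (@continuous_cvg _ _ _ _ _ _ (@cosh R)) cu; exact: cosh_cont.
  have := isd_slope (isd_sinh 0) u0 cu; rewrite cosh0 sinh0.
  by apply: eq_cvgr => // n; rewrite add0r subr0.
pose F n s := rho s / s * (sin (s * u n) / u n).
have FE n : Int (F n) = f (cosh (u n) - 1) * (sinh (u n) / u n).
  rewrite [RHS]mulrA main ?(ltW (u0 n))// -IntZr; first by apply: eq_Int => s; rewrite -[RHS]mulrA.
  apply: (@igr_le _ _ (fun s => C * `|s * a s|)); last by apply: igrZ; exact: igr_norm.
    apply: measurable_funM.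
      under eq_fun do rewrite rhoE; apply: measurable_funM => //; exact: igr_measurable I1.
    exact: measurable_sinr.
  by move=> s; rewrite rhoE !normrM (gtr0_norm C0) -!mulrA ler_wpM2l ?(ltW C0)// ler_wpM2l// ler_piMr// sin_max.
have c2 : Int (F n) @[n --> \oo] --> Int rho.
  apply: (@Int_dct _ _ _ rho) => //.
  - move=> n; apply: measurable_funM.
      under eq_fun do rewrite rhoE; apply: measurable_funM => //; exact: igr_measurable I1.
    apply: measurable_funM => //.
    exact: measurable_sinr.
  - move=> s; have [->|s0] := eqVneq s 0.
      rewrite rho00; apply: (eq_cvgr _ _ (cvg_cst (0 : R))) => // n.
      by rewrite /F rho00 !mul0r.
    rewrite -[X in _ --> X](divfK s0); apply: cvgM; first exact: cvg_cst.
    have d : is_derive (0 : R) 1 (fun y : R => sin (s * y)) s.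
      apply: (isd_eq (isd_comp (is_derive_sin (s * 0)) (isd_mulc 0 s))) => //.
      by rewrite mulr0 cos0 mul1r.
    have := isd_slope d u0 cu; rewrite mulr0 sin0.
    by apply: eq_cvgr => // n; rewrite add0r subr0.
  - move=> n s; rewrite normrM normf_div (ger0_norm (rho0 s)).
    have [->|s0] := eqVneq s 0; first by rewrite rho00 !mul0r.
    have s1 : 0 < `|s| by rewrite normr_gt0.
    rewrite mulrAC ler_pdivrMr// ler_wpM2l// normf_div (gtr0_norm (u0 n)) ler_pdivrMr//.
    by have := norm_sin_mul s (u n); rewrite (gtr0_norm (u0 n)).
rewrite -(cvg_lim _ c2)//; under eq_fun do rewrite FE.
by rewrite (cvg_lim _ c1).
Qed.

(** * The principal series kernels *)

Lemma pd_one R (X : Type) : pd (fun _ _ : X => 1 : R).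
Proof.
move=> s; apply: (@eq_ge0 _ ((\sum_(x <- s) x.1) ^+ 2)); last exact: sqr_ge0.
rewrite expr2 mulr_suml; apply: eq_bigr => x _; rewrite mulr_sumr.
by apply: eq_bigr => y _; rewrite mulr1.
Qed.

Lemma pd_Int R (X : Type) (K : R -> X -> X -> R) :
  (forall u, pd (K u)) -> (forall x y, igr (fun u => K u x y)) ->
  pd (fun x y => Int (fun u => K u x y)).
Proof.
move=> pK IK s.
have -> : \sum_(x <- s) \sum_(y <- s) x.1 * y.1 * Int (fun u => K u x.2 y.2) =
    Int (fun u => \sum_(x <- s) \sum_(y <- s) x.1 * y.1 * K u x.2 y.2).
  rewrite Int_sum => [|x]; last by apply: igr_sum => y; exact: igrZ.
  apply: eq_bigr => x _; rewrite Int_sum => [|y]; last exact: igrZ.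
  by apply: eq_bigr => y _; rewrite IntZ.
by apply: Int_ge0 => u; exact: pK.
Qed.

(** * Integrals over the light-like directions *)

Lemma continuous_sqrf R : continuous (fun x : R => x ^+ 2).
Proof. by apply: continuousX_fun; exact: continuous_idf. Qed.

Lemma continuous_quadraticV R (U b : R) : 0 < U -> 0 < b ->
  continuous (fun u : R => (U * u ^+ 2 + b)^-1).
Proof.
move=> U0 b0 u; apply: cvgV.
  by rewrite gt_eqF// ltr_wpDl// mulr_ge0 ?sqr_ge0// ltW.
apply: (@continuousD_fun _ (fun u => U * u ^+ 2)); last exact: continuous_cst.
apply: continuousM_fun; first exact: continuous_cst.
exact: continuous_sqrf.
Qed.

Lemma igr_quadraticV R (U b c : R) : 0 < U -> 0 < b ->
  igr (fun u => (U * (u - c) ^+ 2 + b)^-1).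
Proof.
move=> U0 b0.
have h : igr (fun u => (U * u ^+ 2 + b)^-1).
  pose m := Num.min U b; have m0 : 0 < m by rewrite lt_min U0 b0.
  have d0 u : 0 < U * u ^+ 2 + b by rewrite ltr_wpDl// mulr_ge0 ?sqr_ge0// ltW.
  apply: igr_le (igrZ m^-1 (@igr_oneDsqrV R)) => [|u].
    by apply: cont_measurable; exact: continuous_quadraticV.
  rewrite gtr0_norm ?invr_gt0// -invfM lef_pV2 ?posrE//; last first.
    by rewrite mulr_gt0// ltr_pwDl// sqr_ge0.
  rewrite mulrDr mulr1 addrC lerD//; first by rewrite ler_wpM2r ?sqr_ge0// ge_min lexx.
  by rewrite ge_min lexx orbT.
have := igr_affine (- c) ltr01 (continuous_quadraticV U0 b0) h.
by apply: eq_igr => u; rewrite mul1r.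
Qed.

(** The square leaves one factor for each variable, hence a majorant of product form. *)
Lemma norm_quadraticV2 R (U b u v : R) : 0 < U -> 0 < b ->
  `|(U * (u ^+ 2 + v ^+ 2) + b) ^- 2| <= (U * u ^+ 2 + b)^-1 * (U * v ^+ 2 + b)^-1.
Proof.
move=> U0 b0; have u2 := sqr_ge0 u; have v2 := sqr_ge0 v.
have d1 : 0 < U * u ^+ 2 + b by rewrite ltr_wpDl// mulr_ge0// ltW.
have d2 : 0 < U * v ^+ 2 + b by rewrite ltr_wpDl// mulr_ge0// ltW.
have d3 : 0 < U * (u ^+ 2 + v ^+ 2) + b.
  by rewrite ltr_wpDl// mulr_ge0 ?addr_ge0// ltW.
rewrite gtr0_norm ?invr_gt0 ?exprn_gt0// -invfM lef_pV2 ?posrE ?exprn_gt0 ?mulr_gt0//.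
rewrite expr2; apply: ler_pM; rewrite ?(ltW d1) ?(ltW d2)// lerD2r ler_wpM2l ?(ltW U0)//.
  by rewrite lerDl.
by rewrite lerDr.
Qed.

(* Its value is 1, but only its positivity matters. *)
Definition halfline_const R : R :=
  Int (fun x : R => heaviside x * (`|x| + 1) ^- 2).

(** The absolute value extends a function of q = u^2 + v^2 to a continuous function on R, as the
    polar-coordinate formula requires. *)
Lemma continuous_normV2 R (U b : R) : 0 < U -> 0 < b ->
  continuous (fun x : R => (U * `|x| + b) ^- 2).
Proof.
move=> U0 b0 x; apply: cvgV.
  by rewrite expf_eq0/= gt_eqF// ltr_wpDl// mulr_ge0// ltW.
apply: (@continuousX_fun _ (fun x => U * `|x| + b)).
apply: continuousD_fun; last exact: continuous_cst.
by apply: continuousM_fun; [exact: continuous_cst|exact: norm_continuous].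
Qed.

Lemma igr_normV2 R (U b : R) : 0 < U -> 0 < b ->
  igr (fun x : R => (U * `|x| + b) ^- 2).
Proof.
move=> U0 b0.
apply: igr_le (igr_quadraticV 0 (_ : 0 < U ^+ 2) (_ : 0 < b ^+ 2)); rewrite ?exprn_gt0//.
  by apply: cont_measurable; exact: continuous_normV2.
move=> x; have d0 : 0 < U * `|x| + b by rewrite ltr_wpDl// mulr_ge0// ltW.
rewrite gtr0_norm ?invr_gt0 ?exprn_gt0// lef_pV2 ?posrE ?exprn_gt0//; last first.
  by rewrite ltr_wpDl ?exprn_gt0// mulr_ge0 ?sqr_ge0.
rewrite subr0 -(real_normK (num_real x)) sqrrD exprMn addrAC lerDl mulrn_wge0//.
by rewrite !mulr_ge0// ltW.
Qed.

Lemma halfline_const_gt0 R : 0 < halfline_const R.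
Proof.
have I1 : igr (fun x : R => heaviside x * (`|x| + 1) ^- 2).
  apply: (@eq_igr _ (fun x : R => heaviside x * (1 * `|x| + 1) ^- 2)).
    by move=> x; rewrite mul1r.
  apply: (@igr_bounded_mul _ _ _ 1); first exact: measurable_heaviside.
    by move=> x; rewrite ger0_norm ?heaviside_le1 ?heaviside_ge0.
  exact: igr_normV2.
apply: (@lt_le_trans _ _ (Int (fun x => 4^-1 * indco 0 1 x))).
  by rewrite IntZ; [rewrite Int_indco// subr0 mulr1 invr_gt0|exact: igr_indco].
apply: le_Int => //; first by apply: igrZ; exact: igr_indco.
move=> x; rewrite indcoE//.
have [/andP[x0 x1]|_] := boolP (0 <= x < 1); last first.
  by rewrite mulr0 mulr_ge0 ?heaviside_ge0// invr_ge0 exprn_ge0// addr_ge0.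
rewrite /heaviside x0 mul1r mulr1 ger0_norm// lef_pV2 ?posrE ?exprn_gt0// ?ltr_wpDl//.
by rewrite (_ : 4 = 2 ^+ 2 :> R) ?ler_pXn2r ?nnegrE ?addr_ge0//; [lra|ring].
Qed.

(** Translations remove c and d, polar coordinates leave a half-line integral, and x = (b / U) y
    extracts the dependence on U and b. *)
Lemma Int_paraboloid R (U b c d : R) : 0 < U -> 0 < b ->
  Int (fun u => Int (fun v => (U * ((u - c) ^+ 2 + (v - d) ^+ 2) + b) ^- 2)) =
  pi * halfline_const R / (U * b).
Proof.
move=> U0 b0.
pose F (x : R) := (U * `|x| + b) ^- 2.
have FE (u v : R) : F (u ^+ 2 + v ^+ 2) = (U * (u ^+ 2 + v ^+ 2) + b) ^- 2.
  by rewrite /F ger0_norm// addr_ge0// sqr_ge0.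
have cF : continuous F by exact: continuous_normV2.
have bF u v : `|F (u ^+ 2 + v ^+ 2)| <= (U * (u - 0) ^+ 2 + b)^-1 * (U * (v - 0) ^+ 2 + b)^-1.
  by rewrite !subr0 FE; exact: norm_quadraticV2.
have c2 (w : R) : continuous (fun v : R => F (w + v ^+ 2)).
  apply: continuous_compR => //; apply: continuousD_fun; first exact: continuous_cst.
  exact: continuous_sqrf.
have m2 : measurable_fun setT (fun z : R * R => F (z.1 ^+ 2 + z.2 ^+ 2)).
  apply: measurableT_comp; first exact: cont_measurable.
  by apply: measurable_funD; apply: measurable_funX; [exact: measurable_fst|exact: measurable_snd].
have Iv u : igr (fun v => F (u ^+ 2 + v ^+ 2)).
  apply: igr_le (igrZ ((U * (u - 0) ^+ 2 + b)^-1) (igr_quadraticV 0 U0 b0)) => [|v].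
    exact: cont_measurable.
  exact: bF.
pose g u := Int (fun v => F (u ^+ 2 + v ^+ 2)).
have Ig : igr g.
  by apply: (igr_Int (f := fun u v => F (u ^+ 2 + v ^+ 2)) m2 bF); exact: igr_quadraticV.
have cg : continuous g.
  apply: (@continuous_Int _ (fun u v => F (u ^+ 2 + v ^+ 2)) (fun v => b^-1 * (U * (v - 0) ^+ 2 + b)^-1)).
  - by move=> u; exact: cont_measurable.
  - move=> v; apply: continuous_compR => //; apply: continuousD_fun; last exact: continuous_cst.
    exact: continuous_sqrf.
  - move=> u v; apply: le_trans (bF u v) _; rewrite ler_wpM2r//.
      by rewrite invr_ge0 addr_ge0 ?(ltW b0)// mulr_ge0 ?sqr_ge0// (ltW U0).
    have d1 : 0 < U * (u - 0) ^+ 2 + b by rewrite ltr_wpDl// mulr_ge0 ?sqr_ge0// ltW.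
    by rewrite lef_pV2 ?posrE// lerDr mulr_ge0 ?sqr_ge0// ltW.
  - by apply: igrZ; exact: igr_quadraticV.
transitivity (Int (fun u => g (1 * u + (- c)))).
  apply: eq_Int => u; rewrite mul1r /g (Int_affine (- d) ltr01 (c2 _) (Iv _)) mul1r.
  by apply: eq_Int => v; rewrite mul1r FE.
rewrite -[LHS]mul1r -(Int_affine (- c) ltr01 cg Ig) /g.
have IF : igr (fun x => heaviside x * F x).
  apply: (@igr_bounded_mul _ _ _ 1); first exact: measurable_heaviside.
    by move=> x; rewrite ger0_norm ?heaviside_le1 ?heaviside_ge0.
  exact: igr_normV2.
rewrite (Int_radial cF bF (igr_quadraticV 0 U0 b0) (igr_quadraticV 0 U0 b0) IF).
rewrite -mulrA; congr (_ * _).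
have bU : 0 < b / U by rewrite divr_gt0.
have F0 x : 0 <= F x by rewrite invr_ge0 sqr_ge0.
have := @ge0_Int_halfline _ F _ 0 bU cF F0.
under eq_Int do rewrite subr0.
move=> ->; rewrite /halfline_const [RHS]mulrC -IntZ; last first.
  apply: (@eq_igr _ (fun x : R => heaviside x * (1 * `|x| + 1) ^- 2)).
    by move=> x; rewrite mul1r.
  apply: (@igr_bounded_mul _ _ _ 1); first exact: measurable_heaviside.
    by move=> x; rewrite ger0_norm ?heaviside_le1 ?heaviside_ge0.
  exact: igr_normV2.
apply: eq_Int => x; rewrite addr0 /F normrM (gtr0_norm bU).
have x0 := normr_ge0 x; move: `|x| x0 => y y0.
have y1 : y + 1 != 0 by rewrite gt_eqF// ltr_wpDl.
have e : U * (b / U * y) + b = b * (y + 1) by field; rewrite gt_eqF.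
by rewrite e; field; rewrite y1 !gt_eqF.
Qed.

(* The light-ray coordinates of the point e^s (energy p, p) of the forward cone
   paired with the light-like vectors of the paraboloid. *)
Definition cone_form R (u v : R) (P : 'cV[R]_3 * R) : R :=
  let p := P.1 in
  expR P.2 * ((energy p + p (lift ord0 (lift ord0 ord0)) 0) * (u ^+ 2 + v ^+ 2)
    - 2 * (p ord0 0 * u + p (lift ord0 ord0) 0 * v)
    + (energy p - p (lift ord0 (lift ord0 ord0)) 0)).

Section cone.
Context (R : realType).
Implicit Types P Q : 'cV[R]_3 * R.

Let x1 P := P.1 ord0 0.
Let x2 P := P.1 (lift ord0 ord0) 0.
Let x3 P := P.1 (lift ord0 (lift ord0 ord0)) 0.

Let sqrE P : energy P.1 ^+ 2 = 1 + x1 P ^+ 2 + x2 P ^+ 2 + x3 P ^+ 2.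
Proof. by rewrite sqr_energy dotvE -!expr2 !addrA. Qed.

Let plus_gt0 P : 0 < energy P.1 + x3 P.
Proof.
have e := sqrE P; have e0 := energy_gt0 P.1.
have h1 := sqr_ge0 (x1 P); have h2 := sqr_ge0 (x2 P).
rewrite ltNge; apply/negP => h.
have : (energy P.1) ^+ 2 <= x3 P ^+ 2.
  by rewrite -(sqrrN (x3 P)) ler_pXn2r ?nnegrE ?(ltW e0)//; lra.
lra.
Qed.

Lemma cone_form_gt0 (u v : R) P : 0 < cone_form u v P.
Proof.
rewrite /cone_form mulr_gt0 ?expR_gt0// -(pmulr_rgt0 _ (plus_gt0 P)) -/(x1 P) -/(x2 P) -/(x3 P).
have e := sqrE P; have h := plus_gt0 P.
move: (energy P.1) (x1 P) (x2 P) (x3 P) e h => E a b c e h.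
(* Multiplied by E + c > 0, the form is a sum of two squares plus 1, by the mass-shell relation. *)
rewrite [X in 0 < X](_ : _ = ((E + c) * u - a) ^+ 2 + ((E + c) * v - b) ^+ 2 + 1).
  by rewrite ltr_wpDl ?addr_ge0 ?sqr_ge0.
by apply/eqP; rewrite -subr_eq0; apply/eqP; transitivity (E ^+ 2 - (1 + a ^+ 2 + b ^+ 2 + c ^+ 2)); [ring|rewrite e subrr].
Qed.

(** The sum of two such forms is the form of the summed four-vectors, a paraboloid with minimum M /
    U. Here M = U W - Z1^2 - Z2^2 is the Minkowski square of the sum, e^(2s) + e^(2s') + 2 e^(s +
    s') k.p. *)
Let Int_cone P Q :
  (forall u, igr (fun v => (cone_form u v P + cone_form u v Q) ^- 2)) /\
  igr (fun u => Int (fun v => (cone_form u v P + cone_form u v Q) ^- 2)) /\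
  Int (fun u => Int (fun v => (cone_form u v P + cone_form u v Q) ^- 2)) =
  pi * halfline_const R / (2 * expR (P.2 + Q.2) *
     (lorentz_prod P.1 Q.1 + cosh (P.2 - Q.2))).
Proof.
pose U := expR P.2 * (energy P.1 + x3 P) + expR Q.2 * (energy Q.1 + x3 Q).
pose W := expR P.2 * (energy P.1 - x3 P) + expR Q.2 * (energy Q.1 - x3 Q).
pose Z1 := expR P.2 * x1 P + expR Q.2 * x1 Q.
pose Z2 := expR P.2 * x2 P + expR Q.2 * x2 Q.
pose M := 2 * expR (P.2 + Q.2) * (lorentz_prod P.1 Q.1 + cosh (P.2 - Q.2)).
have M0 : 0 < M.
  rewrite mulr_gt0 ?mulr_gt0 ?expR_gt0// addr_gt0 ?cosh_gt0//.
  exact: lt_le_trans ltr01 (lorentz_prod_ge1 _ _).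
have U0 : 0 < U by rewrite addr_gt0// mulr_gt0 ?expR_gt0.
have ME : U * W - Z1 ^+ 2 - Z2 ^+ 2 = M.
  have eP := sqrE P; have eQ := sqrE Q.
  rewrite /M /cosh opprB expRD !expRD !expRN /lorentz_prod dotvE.
  rewrite -/(x1 P) -/(x2 P) -/(x3 P) -/(x1 Q) -/(x2 Q) -/(x3 Q) /U /W /Z1 /Z2.
  have p0 : expR P.2 != 0 by rewrite gt_eqF ?expR_gt0.
  have q0 : expR Q.2 != 0 by rewrite gt_eqF ?expR_gt0.
  move: (energy P.1) (x1 P) (x2 P) (x3 P) eP (energy Q.1) (x1 Q) (x2 Q) (x3 Q) eQ.
  move=> E a b c e E' a' b' c' e'.
  move: (expR P.2) (expR Q.2) p0 q0 => p q p0 q0.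
  apply/eqP; rewrite -subr_eq0; apply/eqP.
  transitivity (p ^+ 2 * (E ^+ 2 - (1 + a ^+ 2 + b ^+ 2 + c ^+ 2)) +
    q ^+ 2 * (E' ^+ 2 - (1 + a' ^+ 2 + b' ^+ 2 + c' ^+ 2))).
    by field; rewrite p0 q0.
  by rewrite e e' !subrr !mulr0 addr0.
have b0 : 0 < M / U by rewrite divr_gt0.
have FE u v : cone_form u v P + cone_form u v Q =
    U * ((u - Z1 / U) ^+ 2 + (v - Z2 / U) ^+ 2) + M / U.
  have Un : U != 0 by rewrite gt_eqF.
  rewrite -ME (_ : cone_form u v P + cone_form u v Q = U * (u ^+ 2 + v ^+ 2)
    - 2 * (Z1 * u + Z2 * v) + W); last first.
    by rewrite /cone_form -/(x1 P) -/(x2 P) -/(x3 P) -/(x1 Q) -/(x2 Q) -/(x3 Q) /U /W /Z1 /Z2; ring.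
  by field.
have bF u v : `|(U * ((u - Z1 / U) ^+ 2 + (v - Z2 / U) ^+ 2) + M / U) ^- 2| <=
    (U * (u - Z1 / U) ^+ 2 + M / U)^-1 * (U * (v - Z2 / U) ^+ 2 + M / U)^-1.
  exact: norm_quadraticV2.
have mF : measurable_fun setT (fun z : R * R => (cone_form z.1 z.2 P + cone_form z.1 z.2 Q) ^- 2).
  have m1 : measurable_fun setT (fun z : R * R => z.1) by exact: measurable_fst.
  have m2 : measurable_fun setT (fun z : R * R => z.2) by exact: measurable_snd.
  have -> : (fun z : R * R => (cone_form z.1 z.2 P + cone_form z.1 z.2 Q) ^- 2) =
    (fun z : R * R => (U * `|(z.1 - Z1 / U) ^+ 2 + (z.2 - Z2 / U) ^+ 2| + M / U) ^- 2).
    by apply/funext => z; rewrite FE ger0_norm// addr_ge0// sqr_ge0.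
  apply: (measurableT_comp (cont_measurable (continuous_normV2 U0 b0))).
  by apply: measurable_funD; apply: measurable_funX; apply: measurable_funB.
have bK u v : `|(cone_form u v P + cone_form u v Q) ^- 2| <=
    (U * (u - Z1 / U) ^+ 2 + M / U)^-1 * (U * (v - Z2 / U) ^+ 2 + M / U)^-1.
  by rewrite FE.
split; last split.
- move=> u; apply: igr_le (igrZ ((U * (u - Z1 / U) ^+ 2 + M / U)^-1) (igr_quadraticV (Z2 / U) U0 b0)) => //.
  exact: (measurable_fun_pair2 u mF).
- by apply: (igr_Int (f := fun u v => (cone_form u v P + cone_form u v Q) ^- 2) mF bK); exact: igr_quadraticV.
- transitivity (Int (fun u => Int (fun v => (U * ((u - Z1 / U) ^+ 2 + (v - Z2 / U) ^+ 2) + M / U) ^- 2))).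
    by apply: eq_Int => u; apply: eq_Int => v; rewrite FE.
  rewrite Int_paraboloid//; congr (_ / _).
  by rewrite mulrC divfK// gt_eqF.
Qed.

(* The average of the kernels 1 / (a + a')^2 over all light-like directions. *)
Lemma pd_cone :
  pd (fun P Q : 'cV[R]_3 * R => (lorentz_prod P.1 Q.1 + cosh (P.2 - Q.2))^-1).
Proof.
have h u v : pd (fun P Q => (cone_form u v P + cone_form u v Q) ^- 2).
  have a0 := cone_form_gt0 u v.
  apply: eq_pd (pd_div a0 (pd_div a0 (@pd_one R _))) => P Q.
  by rewrite mul1r expr2 invfM.
have h1 u : pd (fun P Q => Int (fun v => (cone_form u v P + cone_form u v Q) ^- 2)).
  by apply: pd_Int => // P Q; have [] := Int_cone P Q.
have h2 : pd (fun P Q => Int (fun u => Int (fun v => (cone_form u v P + cone_form u v Q) ^- 2))).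
  by apply: (pd_Int h1) => P Q; have [_ []] := Int_cone P Q.
have C0 : 0 < pi * halfline_const R by rewrite mulr_gt0 ?pi_gt0 ?halfline_const_gt0.
have := pd_map (fun P => expR P.2) id (pd_scale (ltW (_ : 0 < 2 / (pi * halfline_const R))) h2).
move=> /(_ (divr_gt0 (ltr0Sn _ 1) C0)); apply: eq_pd => P Q.
have [_ [_ ->]] := Int_cone P Q.
have p0 : expR P.2 != 0 by rewrite gt_eqF ?expR_gt0.
have q0 : expR Q.2 != 0 by rewrite gt_eqF ?expR_gt0.
have t0 : lorentz_prod P.1 Q.1 + cosh (P.2 - Q.2) != 0.
  rewrite gt_eqF// addr_gt0 ?cosh_gt0//; exact: lt_le_trans ltr01 (lorentz_prod_ge1 _ _).
rewrite expRD; move: (_ + _) (expR _) (expR _) (pi * _) C0 t0 p0 q0 => T p q C C0 t0 p0 q0.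
by field; rewrite t0 p0 q0 gt_eqF.
Qed.

End cone.

(** This is tanh (x / 2), a primitive of psi. *)
Definition half_tanh R (x : R) : R := sinh x * psi x.

Lemma isd_half_tanh R (x : R) : is_derive x 1 (@half_tanh R) (psi x).
Proof.
apply: (isd_eq (isdM (isd_sinh x) (isd_psi x))) => //.
have c0 : 1 + cosh x != 0 by rewrite gt_eqF// addr_gt0// cosh_gt0.
have -> : cosh x * psi x + sinh x * - (sinh x * psi x ^+ 2) =
   cosh x * psi x - sinh x ^+ 2 * psi x ^+ 2 by move: (sinh x) => s; ring.
by rewrite sqr_sinh /psi; move: (cosh x) c0 => c c0; field.
Qed.

Lemma half_tanhB R (x k : R) :
  (half_tanh (x + k) - half_tanh (x - k)) / 2 = sinh k / (cosh k + cosh x).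
Proof.
rewrite /half_tanh /psi /sinh /cosh !opprD !expRD !opprK !expRN.
have x0 := expR_gt0 x; have k0 := expR_gt0 k.
move: (expR x) (expR k) x0 k0 => X K X0 K0.
have K2 := sqr_ge0 K; have X2 := sqr_ge0 X.
by field; rewrite !gt_eqF ?mulr_gt0//; nra.
Qed.

(* Integration by parts turns the left-hand side into a difference of two
   translates of the sine transform of psi. *)
Lemma Int_cos_quotient R (l k : R) : l != 0 ->
  sinh k * Int (fun x => cos (l * x) / (cosh k + cosh x)) =
  tau l * (sin (l * k) / l).
Proof.
move=> l0.
have d0 x : 0 < cosh k + cosh x by rewrite addr_gt0// cosh_gt0.
pose D x := (cosh k + cosh x)^-1.
have D0 x : 0 < D x by rewrite invr_gt0.
have Dpsi x : D x <= psi x.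
  by rewrite lef_pV2 ?posrE ?d0// ?addr_gt0 ?cosh_gt0// lerD2r cosh_ge1.
have cD : continuous D.
  move=> x; apply: cvgV; first by rewrite gt_eqF.
  by apply: cvgD; [exact: cvg_cst|exact: cosh_cont].
have csin : continuous (fun x : R => sin (l * x)) by exact: sin_mul_cont.
have ccos : continuous (fun x : R => cos (l * x)) by exact: cos_mul_cont.
have ID : igr (fun x => cos (l * x) * D x).
  apply: igr_le (@igr_psi R) => [|x].
    by apply: cont_measurable; exact: continuousM_fun.
  rewrite normrM (gtr0_norm (D0 x)); apply: le_trans (Dpsi x).
  by rewrite ler_piMl ?cos_max// ltW.
have cp c : continuous (fun x : R => psi (x + c)).
  apply: continuous_compR; first exact: psi_cont.
  by apply: continuousD_fun; [exact: continuous_idf|exact: continuous_cst].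
have ip c : igr (fun x : R => psi (x + c)).
  have := igr_affine c ltr01 (@psi_cont R) (@igr_psi R).
  by apply: eq_igr => x; rewrite mul1r.
have isp c : igr (fun x : R => sin (l * x) * psi (x + c)).
  apply: (@igr_bounded_mul _ _ _ 1) => //; first exact: cont_measurable.
  by move=> x; exact: sin_max.
(* The difference of the two translates is bounded by a multiple of psi, so F vanishes at both ends
   and its derivative integrates to 0; this is the integration by parts. *)
pose F x := sin (l * x) * (half_tanh (x + k) - half_tanh (x - k)).
pose f x := 2 * l * sinh k * (cos (l * x) * D x) +
  (sin (l * x) * psi (x + k) - sin (l * x) * psi (x - k)).
have dF (x : R) : is_derive x 1 F (f x).
  have dsin : is_derive x 1 (fun y : R => sin (l * y)) (cos (l * x) * l).
    by exact: isd_comp (is_derive_sin (l * x)) (isd_mulc x l).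
  have dth c : is_derive x 1 (fun y : R => half_tanh (y + c)) (psi (x + c)).
    have h := @isd_comp _ _ (fun y => y + c) x _ _ (isd_half_tanh (x + c)) (isdD (isd_id x) (isd_cst x c)).
    by apply: (isd_eq h) => //; rewrite addr0 mulr1.
  apply: (isd_eq (isdM dsin (isdD (dth k) (isdN (dth (- k)))))) => //.
  rewrite /f /D.
  have -> : half_tanh (x + k) - half_tanh (x + - k) = 2 * (sinh k / (cosh k + cosh x)).
    by rewrite -half_tanhB; move: (_ - _) => w; field.
  by move: (_^-1) (sinh k) => w s; ring.
have If : igr f.
  by apply: igrD; [exact: igrZ|apply: igrB; exact: isp].
have cf : continuous f.
  apply: continuousD_fun.
    by apply: continuousM_fun; [exact: continuous_cst|exact: continuousM_fun].
  apply: continuousD_fun; first by apply: continuousM_fun => //; exact: cp.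
  by apply: continuousN_fun; apply: continuousM_fun => //; exact: cp.
have FB x : `|F x| <= 2 * `|sinh k| * psi x.
  rewrite /F normrM; apply: (@le_trans _ _ (1 * `|half_tanh (x + k) - half_tanh (x - k)|)).
    by rewrite ler_wpM2r// sin_max.
  have -> : half_tanh (x + k) - half_tanh (x - k) = 2 * (sinh k * D x).
    by rewrite -[X in 2 * X]half_tanhB; move: (_ - _) => w; field.
  by rewrite mul1r !normrM (gtr0_norm (D0 x)) ger0_norm// mulrA ler_wpM2l// mulr_ge0.
have CF (u : nat -> R) : (forall n, psi (u n) = psi n%:R) -> F (u n) @[n --> \oo] --> 0.
  move=> un; apply/norm_cvg0P.
  apply: (@squeeze_cvgr _ _ _ _ (fun=> 0) (fun n : nat => 2 * `|sinh k| * psi (n%:R : R))).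
  - by apply: nearW => n; rewrite normr_ge0/= -un FB.
  - exact: cvg_cst.
  - rewrite -[X in _ --> X](mulr0 (2 * `|sinh k|)); apply: cvgM; first exact: cvg_cst.
    exact: psi_nat_cvg0.
have := Int_FTC dF cf If (CF _ (fun n => erefl)) (CF (fun n => - n%:R) (fun n => psi_even _)).
rewrite subrr IntD; [|exact: igrZ|by apply: igrB; exact: isp].
rewrite IntZ// IntB; [|exact: isp|exact: isp] => E.
have tr c : Int (fun x => sin (l * x) * psi (x + c)) = Int (fun x => sin (l * (x - c)) * psi x).
  have cg : continuous (fun x : R => sin (l * (x - c)) * psi x).
    apply: continuousM_fun; last exact: psi_cont.
    apply: (@continuous_compR _ (fun x => sin (l * x))) => //.
    exact: continuous_subr.
  have Ig : igr (fun x : R => sin (l * (x - c)) * psi x).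
    apply: (@igr_bounded_mul _ _ _ 1); last exact: igr_psi.
      apply: cont_measurable; apply: (@continuous_compR _ (fun x => sin (l * x))) => //.
      exact: continuous_subr.
    by move=> x; exact: sin_max.
  rewrite (Int_affine c ltr01 cg Ig) mul1r; apply: eq_Int => x.
  by rewrite mul1r addrK.
(* After translation by k and -k the integrand is (sin (l (x - k)) - sin (l (x + k))) psi x, that
   is, -2 cos (l x) sin (l k) psi x. *)
have E2 : Int (fun x => sin (l * x) * psi (x + k)) - Int (fun x => sin (l * x) * psi (x - k)) =
    - 2 * (sin (l * k) * tau l).
  rewrite tr (tr (- k)) -IntB; last 2 first.
  - apply: (@igr_bounded_mul _ _ _ 1); last exact: igr_psi.
      apply: cont_measurable; apply: (@continuous_compR _ (fun x => sin (l * x))) => //.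
      exact: continuous_subr.
    by move=> x; exact: sin_max.
  - apply: (@igr_bounded_mul _ _ _ 1); last exact: igr_psi.
      apply: cont_measurable; apply: (@continuous_compR _ (fun x => sin (l * x))) => //.
      exact: continuous_subr.
    by move=> x; exact: sin_max.
  have Ip : igr (fun x => psi x * cos (l * x)).
    by have := igr_psi_hat 0 l; apply: eq_igr => x; rewrite expr1.
  rewrite mulrA -IntZ//; apply: eq_Int => x.
  rewrite opprK (mulrBr l) (mulrDr l) sinB sinD; move: (psi x) (sin _) (cos _) (sin _) (cos _).
  by move=> a b c d e; ring.
rewrite E2 in E.
have {}E : l * (sinh k * Int (fun x => cos (l * x) * D x)) = sin (l * k) * tau l.
  move: (sinh k) (Int _) (_ * tau l) E => s I T E.
  have -> : l * (s * I) = (2 * l * s * I + - 2 * T) / 2 + T by field.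
  by rewrite E mul0r add0r.
apply: (mulfI l0); rewrite E; field; exact: l0.
Qed.

Lemma norm_principal R (l k : R) : 0 <= k ->
  `|principal_integrand l k| <= 1.
Proof.
move=> k0; rewrite /principal_integrand.
case: eqVneq => [_|kn]; first by rewrite normr1.
have kp : 0 < k by rewrite lt_neqAle eq_sym kn.
have s := sinh_ge k0; have s0 : 0 < sinh k by exact: lt_le_trans s.
case: eqVneq => [_|ln]; first by rewrite ger0_norm; [rewrite ler_pdivrMr// mul1r|rewrite divr_ge0// ltW].
have d0 : 0 < `|l| * sinh k by rewrite mulr_gt0 ?normr_gt0.
rewrite normf_div [`|l * _|]normrM (gtr0_norm s0) (ler_pdivrMr _ _ d0) mul1r.
apply: le_trans (norm_sin_mul l k) _.
by rewrite (gtr0_norm kp) ler_wpM2l.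
Qed.

Lemma arcosh_eq0 R (t : R) : 1 <= t -> arcosh t = 0 -> t = 1.
Proof. by move=> t1 e; rewrite -(arcoshK t1) e cosh0. Qed.

Lemma Int_cos_arcosh R (l t : R) : l != 0 -> 1 <= t ->
  Int (fun x => cos (l * x) / (t + cosh x)) =
  tau l * principal_integrand l (arcosh t).
Proof.
move=> l0 t1; have tK := arcoshK t1; rewrite /principal_integrand (negbTE l0).
case: eqVneq => [e|k0].
  rewrite (arcosh_eq0 t1 e) mulr1; apply: eq_Int => x; by rewrite mulrC.
have kp : 0 < arcosh t by rewrite lt_neqAle eq_sym k0 arcosh_ge0.
have s0 : sinh (arcosh t) != 0.
  by rewrite gt_eqF//; apply: lt_le_trans (sinh_ge (ltW kp)).
apply: (mulfI s0); rewrite -{2}tK Int_cos_quotient//.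
by move: (sinh _) s0 => s s0; field; rewrite l0 s0.
Qed.

(** By [pd_cone] the kernel cos (l (b - b')) / (k.p + cosh (b - b')) is positive definite, and b
    enters by translation. Gaussian averages, with the Gaussians tending to 1, leave the integral
    over the difference, which is tau l > 0 times the principal integrand. *)
Lemma pd_principal R (l : R) : l != 0 ->
  pd (fun k p : 'cV[R]_3 => principal_integrand l (arcosh (lorentz_prod k p))).
Proof.
move=> l0; have t0 := tau_gt0 l.
pose F (k p : 'cV[R]_3) u := cos (l * u) / (lorentz_prod k p + cosh u).
have d0 (k p : 'cV[R]_3) u : 0 < lorentz_prod k p + cosh u.
  by rewrite addr_gt0 ?cosh_gt0//; exact: lt_le_trans ltr01 (lorentz_prod_ge1 _ _).
have cF k p : continuous (F k p).
  move=> u; apply: cvgM; first exact: cos_mul_cont.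
  apply: cvgV; first by rewrite gt_eqF.
  by apply: cvgD; [exact: cvg_cst|exact: cosh_cont].
have Fpsi k p u : `|F k p u| <= psi u.
  rewrite /F normrM [`|_^-1|]gtr0_norm ?invr_gt0//.
  apply: (@le_trans _ _ (lorentz_prod k p + cosh u)^-1).
    by rewrite ler_piMl ?cos_max// invr_ge0 ltW.
  by rewrite lef_pV2 ?posrE// ?addr_gt0 ?cosh_gt0// lerD2r lorentz_prod_ge1.
have pF : pd (fun z z' : R * 'cV[R]_3 => F z.2 z'.2 (z.1 - z'.1)).
  have := pd_cos (fun P : 'cV[R]_3 * R => l * P.2) (@pd_cone R).
  move=> /(pd_comp (fun z : R * 'cV[R]_3 => (z.2, z.1))).
  by apply: eq_pd => z z' /=; rewrite /F mulrBr.
have p1 n : pd (fun k p : 'cV[R]_3 => Int (fun u => F k p u * expR (- (n.+1%:R^-1 * u ^+ 2)))).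
  apply: (pd_gauss_average (m := fun _ _ => 1)) => //.
  - by move=> k p u; apply: le_trans (Fpsi k p u) (psi_le1 u).
  - by move=> k p u; rewrite /F mulrN cosN cosh_even.
have p2 : pd (fun k p : 'cV[R]_3 => Int (F k p)).
  apply: (pd_lim p1) => k p.
  apply: (@Int_dct _ _ _ (@psi R)).
  - move=> n; apply: measurable_funM; first exact: cont_measurable.
    by apply: cont_measurable; exact: continuous_gauss.
  - move=> s; rewrite -[X in _ --> X]mulr1; apply: cvgM; first exact: cvg_cst.
    rewrite -[X in _ --> X]expR0.
    apply: (@continuous_cvg _ _ _ _ _ _ expR); first exact: continuous_expR.
    rewrite -oppr0 -[X in _ --> - X](mul0r (s ^+ 2)).
    by apply: cvgN; apply: cvgM; [exact: cvg_harmonic|exact: cvg_cst].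
  - move=> n s; rewrite normrM; apply: le_trans (Fpsi k p s); rewrite ler_piMr//.
    by rewrite ger0_norm ?expR_ge0// -expR0 ler_expR oppr_le0 mulr_ge0// sqr_ge0.
  - exact: igr_psi.
have := pd_scale (ltW (_ : 0 < (tau l)^-1)) p2; rewrite invr_gt0 => /(_ t0).
apply: eq_pd => k p; rewrite Int_cos_arcosh ?lorentz_prod_ge1// mulKf// gt_eqF//.
Qed.

(** * Mixtures of principal series kernels *)

(** The approximants x / (x^2 + 1 / (n + 1)) are continuous and vanish at 0, in agreement with the
    convention 0^-1 = 0. *)
Lemma measurable_inv R : measurable_fun setT (fun x : R => x^-1).
Proof.
pose f (n : nat) (x : R) := x / (x ^+ 2 + n.+1%:R^-1).
have d0 n (x : R) : 0 < x ^+ 2 + n.+1%:R^-1 by rewrite ltr_wpDl ?sqr_ge0// invr_gt0.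
apply: (@measurable_fun_cvg _ _ _ _ f) => [n|x _].
  apply: cont_measurable => x; apply: cvgM; first exact: continuous_idf.
  apply: cvgV; first by rewrite gt_eqF.
  by apply: cvgD; [exact: continuous_sqrf|exact: cvg_cst].
have [->|x0] := eqVneq x 0.
  rewrite invr0; apply: (eq_cvgr _ _ (cvg_cst (0 : R))) => // n.
  by rewrite /f mul0r.
have -> : x^-1 = x / (x ^+ 2 + 0) by rewrite addr0; field.
apply: cvgM; first exact: cvg_cst.
apply: cvgV; first by rewrite addr0 expf_eq0.
by apply: cvgD; [exact: cvg_cst|exact: cvg_harmonic].
Qed.

(** * Lorentz invariance of the Minkowski product *)

Lemma minkowski_col R (x y : 'M[R]_1) (k p : 'cV[R]_3) :
  ((col_mx x k)^T *m minkowski R *m col_mx y p) 0 0 = x 0 0 * y 0 0 - dotv k p.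
Proof.
rewrite tr_col_mx /minkowski mul_row_block !mulmx1 !mulmx0 addr0 add0r.
rewrite mulmxN mulmx1 mul_row_col mulNmx !mxE big_ord1 !mxE; congr (_ - _).
by apply: eq_bigr => i _; rewrite !mxE.
Qed.

Lemma minkowski_sqr R : minkowski R *m minkowski R = 1%:M.
Proof.
rewrite /minkowski mulmx_block !mulmx0 !mul0mx !mulmx1 !addr0 !add0r mulmxN mulmx1 opprK.
by rewrite -scalar_mx_block.
Qed.

(** With J the Minkowski form, J L^T J is a left inverse of L, hence a right inverse. *)
Lemma lorentz_tr R (L : 'M[R]_(1 + 3)) : lorentz L ->
  L *m minkowski R *m L^T = minkowski R.
Proof.
move=> [h _ _]; have e : (minkowski R *m L^T *m minkowski R) *m L = 1%:M.
  by rewrite -!mulmxA (mulmxA L^T) h minkowski_sqr.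
have := mulmx1C e; rewrite !mulmxA => h2.
rewrite -[LHS]mulmx1 -minkowski_sqr mulmxA h2 mul1mx//.
Qed.

Definition four_vector R (k : 'cV[R]_3) : 'cV[R]_(1 + 3) :=
  col_mx (energy k)%:M k.

Lemma minkowski_act R (L : 'M[R]_(1 + 3)) (X Y : 'cV[R]_(1 + 3)) :
  lorentz L -> (L *m X)^T *m minkowski R *m (L *m Y) = X^T *m minkowski R *m Y.
Proof.
move=> [h _ _]; rewrite trmx_mul -!mulmxA; congr (_ *m _).
by rewrite !mulmxA h.
Qed.

Lemma lorentz_prodE R (k p : 'cV[R]_3) :
  lorentz_prod k p = ((four_vector k)^T *m minkowski R *m four_vector p) 0 0.
Proof. by rewrite minkowski_col !mxE eqxx !mulr1n. Qed.

(* The time component of L (energy k, k) is the Minkowski product of (energy k, k)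
   with the four-vector of minus the first row of L, hence at least 1. *)
Lemma lorentz_four_vector R (L : 'M[R]_(1 + 3)) (k : 'cV[R]_3) :
  lorentz L -> L *m four_vector k = four_vector (lorentz_act L k).
Proof.
move=> hL; pose X := L *m four_vector k; pose t := (usubmx X) 0 0.
have XE : X = col_mx t%:M (lorentz_act L k).
  by rewrite -[X]vsubmxK; congr col_mx; rewrite [LHS]mx11_scalar.
have sq : t ^+ 2 = 1 + dotv (lorentz_act L k) (lorentz_act L k).
  have : (X^T *m minkowski R *m X) 0 0 = 1.
    by rewrite /X minkowski_act// -lorentz_prodE lorentz_prod_id.
  rewrite XE minkowski_col mxE eqxx mulr1n -expr2 => <-.
  by rewrite subrK.
suff t0 : 0 <= t by rewrite -/X XE /four_vector (energyP t0 sq).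
pose a := ulsubmx L; pose b := ursubmx L.
pose q : 'cV[R]_3 := - b^T; pose l := a 0 0.
have l0 : 0 < l.
  have [_ _] := hL; rewrite /l /a !mxE.
  by congr (0 < L _ _); apply/val_inj.
have LE : L = block_mx a b (dlsubmx L) (drsubmx L) by rewrite submxK.
(* The transpose of L preserves the form too, so the first row of L satisfies the mass-shell
   relation. *)
have sql : l ^+ 2 = 1 + dotv q q.
  have := lorentz_tr hL; rewrite LE /minkowski tr_block_mx !mulmx_block.
  rewrite !mulmx0 !mulmx1 !addr0 !add0r => /eq_block_mx[h _ _ _].
  have {}h : (a *m a^T + b *m - 1%:M *m b^T) 0 0 = 1 :> R by rewrite h !mxE eqxx.
  rewrite mulmxN mulmx1 mulNmx !mxE big_ord1 !mxE -expr2 in h.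
  rewrite -h -[LHS]addr0 -addrA; congr (_ + _); first by rewrite /l /a !mxE.
  rewrite addrC; apply/esym/eqP; rewrite subr_eq0; apply/eqP.
  by apply: eq_bigr => i _; rewrite !mxE mulrNN.
have -> : t = lorentz_prod q k.
  rewrite /lorentz_prod (energyP (ltW l0) sql) /t /X LE /four_vector mul_block_col col_mxKu.
  rewrite !mxE big_ord1 !mxE eqxx mulr1n; congr (_ + _); first by rewrite /l /a !mxE.
  rewrite /dotv -sumrN; by apply: eq_bigr => i _; rewrite !mxE mulNr opprK.
exact: le_trans ler01 (lorentz_prod_ge1 _ _).
Qed.

Lemma lorentz_prod_act R (L : 'M[R]_(1 + 3)) (k p : 'cV[R]_3) :
  lorentz L -> lorentz_prod (lorentz_act L k) (lorentz_act L p) = lorentz_prod k p.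
Proof.
by move=> hL; rewrite !lorentz_prodE -!lorentz_four_vector// minkowski_act.
Qed.

(** Evenness in l lets a density on R be folded onto [0, +oo[. *)
Lemma principal_even R (l k : R) :
  principal_integrand `|l| k = principal_integrand l k.
Proof.
rewrite /principal_integrand normr_eq0.
have [l0|l0] := leP 0 l; first by rewrite ger0_norm.
by rewrite ltr0_norm// !mulNr sinN invrN mulrNN.
Qed.

Lemma measurable_principal R (k : R) :
  measurable_fun setT (fun l : R => principal_integrand l k).
Proof.
have [k0|k0] := boolP (k == 0).
  rewrite (_ : (fun l => _) = cst 1); first exact: measurable_cst.
  by apply/funext => l; rewrite /principal_integrand k0.
rewrite (_ : (fun l => _) = fun l => if l == 0 then k / sinh k
  else sin (l * k) / (l * sinh k)); last first.
  by apply/funext => l; rewrite /principal_integrand (negbTE k0).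
apply: measurable_fun_ifT.
- exact: measurable_fun_eqr.
- exact: measurable_cst.
- apply: measurable_funM.
    exact: measurable_sinr.
  by apply: (measurableT_comp (@measurable_inv R)); exact: measurable_funM.
Qed.

Lemma measurable_arcosh R : measurable_fun setT (@arcosh R).
Proof.
apply: (measurableT_comp (@measurable_ln R)).
apply: measurable_funD => //.
apply: (measurableT_comp (cont_measurable (@sqrt_continuous R))).
by apply: measurable_funB => //; exact: measurable_funX.
Qed.

Lemma lorentz_prod_continuous R :
  continuous (fun x : 'cV[R]_3 * 'cV[R]_3 => lorentz_prod x.1 x.2).
Proof.
have c1 i : continuous (fun x : 'cV[R]_3 * 'cV[R]_3 => x.1 i 0).
  move=> x; apply: (@continuous_comp _ _ _ fst (fun M : 'cV[R]_3 => M i 0)).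
    exact: cvg_fst.
  exact: coord_continuous.
have c2 i : continuous (fun x : 'cV[R]_3 * 'cV[R]_3 => x.2 i 0).
  move=> x; apply: (@continuous_comp _ _ _ snd (fun M : 'cV[R]_3 => M i 0)).
    exact: cvg_snd.
  exact: coord_continuous.
have cs (u v : 'cV[R]_3 * 'cV[R]_3 -> 'I_3 -> R) :
    (forall i, continuous (u ^~ i)) -> (forall i, continuous (v ^~ i)) ->
    continuous (fun x => \sum_(i < 3) u x i * v x i).
  move=> cu cv x; apply: cvg_big => [|i _]; first exact: add_continuous.
  by apply: cvgM; [exact: cu|exact: cv].
have ce (h : 'cV[R]_3 * 'cV[R]_3 -> 'cV[R]_3) : (forall i, continuous (fun x => h x i 0)) ->
    continuous (fun x => energy (h x)).
  move=> ch x; apply: (@continuous_comp _ _ _ (fun x => 1 + dotv (h x) (h x)) Num.sqrt).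
    by apply: cvgD; [exact: cvg_cst|exact: (cs (fun x i => h x i 0) (fun x i => h x i 0))].
  exact: sqrt_continuous.
move=> x; apply: cvgB.
  by apply: cvgM; [exact: (ce fst)|exact: (ce snd)].
exact: (cs (fun x i => x.1 i 0) (fun x i => x.2 i 0)).
Qed.

Lemma measurable_lorentz_prod R :
  let T := g_sigma_algebraType (@open ('cV[R]_3 * 'cV[R]_3)%type) in
  measurable_fun [set: T] (fun x : T => lorentz_prod x.1 x.2).
Proof.
move=> T; apply: (measurability _ (RGenOpens.measurableE R)) => _ [_ [a [b ->]] <-].
rewrite setTI; apply: sub_sigma_algebra.
have /continuousP := @lorentz_prod_continuous R; apply; exact: interval_open.
Qed.

(** The density obtained above is a multiple of l^2 a(l). Its vanishing at 0 makes the conventions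
    at l = 0 harmless, and [rho l / l] is the integrable amplitude in front of sin (l k). *)
Definition spectral_weight R (rho : R -> R) : Prop :=
  [/\ forall l, 0 <= rho l, rho 0 = 0, igr rho, igr (fun l => rho l / l) & Int rho = 1].

Definition mixture R (rho : R -> R) (k : R) : R :=
  Int (fun l => principal_integrand l k * rho l).

Section mixture.
Context (R : realType) (rho : R -> R) (wrho : spectral_weight rho).

Let rho_ge0 l : 0 <= rho l. Proof. by case: wrho. Qed.
Let rho0 : rho 0 = 0. Proof. by case: wrho. Qed.
Let Irho : igr rho. Proof. by case: wrho. Qed.
Let Irhol : igr (fun l => rho l / l). Proof. by case: wrho. Qed.
Let Irho1 : Int rho = 1. Proof. by case: wrho. Qed.

Lemma igr_mixture (k : R) : 0 <= k -> igr (fun l => principal_integrand l k * rho l).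
Proof.
move=> k0; apply: (@igr_bounded_mul _ _ _ 1) => //; first exact: measurable_principal.
by move=> l; exact: norm_principal.
Qed.

Lemma mixture0 : mixture rho 0 = 1.
Proof.
rewrite -Irho1; apply: eq_Int => l.
by rewrite /principal_integrand eqxx mul1r.
Qed.

Lemma mixtureE (k : R) : k != 0 ->
  mixture rho k = Int (fun l => rho l / l * sin (l * k)) / sinh k.
Proof.
move=> k0; rewrite -IntZr; last first.
  apply: igr_le (igr_norm Irhol) => [|l].
    apply: measurable_funM; first exact: igr_measurable Irhol.
    exact: measurable_sinr.
  by rewrite normrM ler_piMr// sin_max.
apply: eq_Int => l; rewrite /principal_integrand (negbTE k0).
(* At l = 0 the principal integrand is k / sinh k, which [rho 0 = 0] cancels. *)
case: eqVneq => [->|l0]; first by rewrite rho0 !mulr0 !mul0r.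
by rewrite invfM; move: (sinh k) => s; ring.
Qed.

(** Away from k = 0 the mixture is a continuous sine integral divided by sinh k. *)
Lemma measurable_mixture : measurable_fun setT (mixture rho).
Proof.
have -> : mixture rho = fun k => if k == 0 then 1 else
    Int (fun l => rho l / l * sin (l * k)) * (sinh k)^-1.
  apply/funext => k; case: eqVneq => [->|k0]; first exact: mixture0.
  exact: mixtureE.
apply: measurable_fun_ifT.
- exact: measurable_fun_eqr.
- exact: measurable_cst.
- apply: measurable_funM; last first.
    apply: (measurableT_comp (@measurable_inv R)).
    by apply: cont_measurable; exact: sinh_cont.
  apply: cont_measurable; apply: (@continuous_Int _ _ (fun l => `|rho l / l|)); last exact: igr_norm.
  + move=> k; apply: measurable_funM; first exact: igr_measurable Irhol.
    exact: measurable_sinr.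
  + move=> l; apply: continuousM_fun; first exact: continuous_cst.
    exact: sin_mul_cont.
  + by move=> k l; rewrite normrM ler_piMr// sin_max.
Qed.

Local Open Scope complex_scope.

Lemma calG_mixture :
  calG (fun k p : 'cV[R]_3 => (mixture rho (arcosh (lorentz_prod k p)))%:C).
Proof.
split.
- split; last exact: measurable_cst.
  apply: (measurableT_comp measurable_mixture).
  apply: (measurableT_comp (@measurable_arcosh R)).
  exact: measurable_lorentz_prod.
- apply: (pd_positive_definite (K := fun k p : 'cV[R]_3 => mixture rho (arcosh (lorentz_prod k p)))).
    by move=> k p; rewrite lorentz_prodC.
  apply: (pd_Int (K := fun l k p => principal_integrand l (arcosh (lorentz_prod k p)) * rho l)).
    (* [pd_principal] covers l != 0; at l = 0 the weight vanishes. *)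
    move=> l; have [->|l0] := eqVneq l 0.
      by apply: eq_pd (@pd0 _ _) => k p; rewrite rho0 mulr0.
    by apply: eq_pd (pd_scale (rho_ge0 l) (pd_principal l0)) => k p; rewrite mulrC.
  by move=> k p; apply: igr_mixture; rewrite arcosh_ge0// lorentz_prod_ge1.
- by move=> L hL k p; rewrite lorentz_prod_act.
- rewrite lorentz_prod_id (_ : arcosh 1 = 0) ?mixture0//.
  by rewrite -[1](cosh0 R) coshK.
Qed.

End mixture.

(** * Probability measures with a density *)

Section density_probability.
Context (R : realType) (rho : R -> R).
Context (rho_ge0 : forall x, 0 <= rho x) (Irho : igr rho) (Irho1 : Int rho = 1).
Local Notation mu := (@lebesgue_measure R).

Definition density_prob (A : set (measurableTypeR R)) : \bar R :=
  (\int[mu]_(x in A) (rho x)%:E)%E.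

Let density0 : density_prob set0 = 0%E.
Proof. by rewrite /density_prob integral_set0. Qed.

Let density_ge0 A : (0 <= density_prob A)%E.
Proof. by apply: integral_ge0 => x _; rewrite lee_fin. Qed.

Let density_sigma_additive : semi_sigma_additive density_prob.
Proof.
move=> /= A mA tA mUA; rewrite /density_prob integral_bigcup//=; last first.
  by apply: (integrableS measurableT).
by apply: is_cvg_ereal_nneg_natsum_cond => n _ _; exact: density_ge0.
Qed.

HB.instance Definition _ := isMeasure.Build _ _ _
  density_prob density0 density_ge0 density_sigma_additive.

Let density_setT : density_prob [set: _] = 1%E.
Proof. by rewrite /density_prob -EFin_Int// Irho1. Qed.

HB.instance Definition _ :=
  @Measure_isProbability.Build _ _ R density_prob density_setT.

Let density_dominates : density_prob `<< mu.
Proof.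
apply/null_content_dominatesP => A mA muA0; apply: null_set_integral => //.
by apply: measurable_funTS; apply/measurable_EFinP; exact: igr_measurable.
Qed.

(** The Radon-Nikodym derivative of [density_prob] is rho almost everywhere, since both have the
    same integral over every measurable set. *)
Lemma integral_density_prob (f : R -> R) (M : R) :
  measurable_fun setT f -> (forall x, `|f x| <= M) ->
  density_prob.-integrable setT (EFin \o f) /\
  (\int[density_prob]_x (f x)%:E = (Int (fun x => f x * rho x))%:E)%E.
Proof.
move=> mf fM.
have mE : measurable_fun setT (EFin \o f) by exact/measurable_EFinP.
have If : density_prob.-integrable setT (EFin \o f).
  apply: measurable_bounded_integrable => //.
  - by rewrite (le_lt_trans (probability_le1 _ _)) ?ltry.
  - exists M; split; first exact: num_real.
    by move=> x Mx y _ /=; apply: le_trans (fM y) (ltW Mx).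
split=> //.
have mr : measurable_fun setT (fun x => (rho x)%:E).
  by apply/measurable_EFinP; exact: igr_measurable.
rewrite -(Radon_Nikodym_change_of_variables density_dominates)//.
rewrite EFin_Int; last first.
  by apply: (igr_bounded_mul mf fM).
under [RHS]eq_integral do rewrite EFinM.
apply: ae_eq_integral => //.
- exact: emeasurable_funM.
- exact: emeasurable_funM.
- apply: ae_eqe_mul2l => /=.
  rewrite Radon_NikodymE//=.
  case: cid => /= h [h1 h2 h3].
  apply: integral_ae_eq => //=.
  by move=> E _ mE'; rewrite -h3.
Qed.

(** The measure with density rho on R is pushed forward by the absolute value. *)
Lemma halfline_probability :
  exists P : probability (measurableTypeR R) R,
    P [set` `[0, +oo[] = 1%E /\
    forall (f : R -> R) (M : R), measurable_fun setT f -> (forall x, `|f x| <= M) ->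
      (\int[P]_(x in `[0%R, +oo[) (f x)%:E = (Int (fun x => f `|x| * rho x))%:E)%E.
Proof.
have mX : measurable_fun [set: measurableTypeR R]
    (Num.norm : measurableTypeR R -> measurableTypeR R).
  exact: normr_measurable.
pose X_mixin := isMeasurableFun.Build _ _ _ _ _ mX.
pose X : {mfun measurableTypeR R >-> measurableTypeR R} :=
  MeasurableFun.Pack (MeasurableFun.Class X_mixin).
have XT : X @^-1` [set` `[0, +oo[] = setT.
  by apply/seteqP; split => // x _ /=; rewrite in_itv/= normr_ge0.
exists (distribution density_prob X); split.
  transitivity (density_prob setT); last exact: density_setT.
  by rewrite -XT.
move=> f M mf fM.
have mfX : measurable_fun setT (fun x : R => f `|x|).
  by apply: (measurableT_comp mf); exact: normr_measurable.
have [I1 I2] := integral_density_prob mfX (fun x => fM `|x|).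
rewrite -I2 integral_pushforward ?XT//.
exact/measurable_EFinP.
Qed.

End density_probability.

(** * Non-extremality *)

Lemma causal_mixture R (g : R -> R) :
  {within `[1, +oo[, continuous g} -> g 1 = 1 ->
  positive_definite (causal_kernel g) ->
  exists rho, spectral_weight rho /\
    forall t, 1 <= t -> g t = mixture rho (arcosh t).
Proof.
(* g is continuous on [1, +oo[ only; the absolute value gives a continuous bounded function on all
   of R. *)
move=> gc g1 causal; pose f (r : R) := g (1 + `|r|).
have cf : continuous f.
  move=> r B /=; have r1 : `[1, +oo[%classic (1 + `|r|) by rewrite /= in_itv/= andbT lerDl.
  move=> nB; have := (@subspace_continuousP _ _ _ g).1 gc _ r1 B nB.
  move=> nb; have {}nb : nbhs (1 + `|r|) (fun y => `[1, +oo[%classic y -> B (g y)) := nb.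
  have cn : continuous (fun r : R => 1 + `|r|).
    by apply: continuousD_fun; [exact: continuous_cst|exact: norm_continuous].
  suff h : nbhs r (fun s => B (f s)) by exact: h.
  have h : nbhs r (fun s : R => `[1, +oo[%classic (1 + `|s|) -> B (g (1 + `|s|))) := cn r _ nb.
  apply: filterS h => s; apply.
  by rewrite /= in_itv/= andbT lerDl.
have f1 r : `|f r| <= 1 by apply: (causal_le1 g1 causal); rewrite lerDl.
have f01 : f 0 = 1 by rewrite /f normr0 addr0.
have pK eta : 0 < eta -> pd (laplace_kernel f eta).
  move=> eta0; apply: pd_horo_average => //.
  apply: eq_pd (pd_lightlike_kernel causal) => z z'.
  rewrite /lightlike_kernel lorentz_prod_horo /f; congr (_ * g (1 + _)).
  rewrite ger0_norm//.
  rewrite addr_ge0 ?subr_ge0 ?cosh_ge1// divr_ge0// mulr_ge0 ?expR_ge0//.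
  by rewrite addr_ge0// sqr_ge0.
have [rho [[crho rho0] rho_ge0 [Irho Irhol] Irho1 main]] := spectral_density cf f1 f01 pK.
have wrho : spectral_weight rho by [].
exists rho; split => // t t1.
have tK := arcoshK t1; have t0 := arcosh_ge0 t1.
have [e|k0] := eqVneq (arcosh t) 0.
  by rewrite e mixture0// (arcosh_eq0 t1 e).
have kp : 0 < arcosh t by rewrite lt_neqAle eq_sym k0.
have s0 : sinh (arcosh t) != 0 by rewrite gt_eqF//; apply: lt_le_trans (sinh_ge t0).
rewrite mixtureE// -main// tK mulfK// /f ger0_norm ?subr_ge0//.
by rewrite addrC subrK.
Qed.

Lemma ae_Int0 R (f : R -> R) : igr f ->
  {ae @lebesgue_measure R, forall x, f x = 0} -> Int f = 0.
Proof.
move=> If f0; rewrite -(Int0 R) /Int /Rintegral; congr fine.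
apply: ae_eq_integral => //.
- by apply/measurable_EFinP; exact: igr_measurable.
- by move: f0; apply: (@filterS _ _ (ae_filter_ringOfSetsType _)) => x -> _.
Qed.

(** A zero integral would force q rho, hence rho, to vanish almost everywhere, against
    [Int rho = 1]. *)
Lemma Int_mul_gt0 R (q rho : R -> R) : igr rho -> Int rho = 1 ->
  igr (fun l => q l * rho l) -> (forall l, 0 <= q l * rho l) ->
  {ae @lebesgue_measure R, forall l, q l * rho l = 0 -> rho l = 0} ->
  0 < Int (fun l => q l * rho l).
Proof.
move=> Irho Irho1 Iq q0 qr; rewrite lt_neqAle Int_ge0// andbT.
apply/negP => /eqP/esym /(Int_eq0 Iq q0) h.
have /(ae_Int0 Irho) : {ae @lebesgue_measure R, forall x, rho x = 0}.
  by move: h qr; apply: (@filterS2 _ _ (ae_filter_ringOfSetsType _)) => x hx; exact.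
by rewrite Irho1 => /eqP; rewrite oner_eq0.
Qed.

(** * Splitting a spectral weight *)

Section damping.
Context (R : realType) (rho : R -> R) (wrho : spectral_weight rho).

Let rho_ge0 l : 0 <= rho l. Proof. by case: wrho. Qed.
Let rho0 : rho 0 = 0. Proof. by case: wrho. Qed.
Let Irho : igr rho. Proof. by case: wrho. Qed.
Let Irhol : igr (fun l => rho l / l). Proof. by case: wrho. Qed.
Let Irho1 : Int rho = 1. Proof. by case: wrho. Qed.

Lemma reweight (q : R -> R) (w : R) : continuous q -> (forall l, 0 <= q l <= 1) ->
  0 < w -> Int (fun l => q l * rho l) = w ->
  spectral_weight (fun l => q l * rho l / w).
Proof.
move=> cq q01 w0 Iw.
have q1 l : `|q l| <= 1 by have /andP[q0 q1] := q01 l; rewrite ger0_norm.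
have Iq : igr (fun l => q l * rho l) by apply: igr_bounded_mul q1 Irho; exact: cont_measurable.
split.
- by move=> l; have /andP[q0 _] := q01 l; rewrite divr_ge0 ?mulr_ge0// ltW.
- by rewrite rho0 mulr0 mul0r.
- by apply: (@eq_igr _ (fun l => w^-1 * (q l * rho l))) => [l|]; [rewrite mulrC|exact: igrZ].
- apply: (@eq_igr _ (fun l => w^-1 * (q l * (rho l / l)))) => [l|].
    by rewrite mulrC !mulrA mulrAC.
  by apply: igrZ; apply: igr_bounded_mul q1 Irhol; exact: cont_measurable.
- by rewrite IntZr// Iw divff// gt_eqF.
Qed.

(** l^2 [damp l] is bounded, so the damped weight has a finite second moment whether or not rho has
    one. *)
Definition damp (l : R) : R := (1 + l ^+ 2)^-1.

Let damp0 l : 0 < damp l.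
Proof. by rewrite invr_gt0 ltr_pwDl// sqr_ge0. Qed.

Let damp1 l : damp l <= 1.
Proof. by rewrite invf_le1 ?lerDl ?sqr_ge0// ltr_pwDl// sqr_ge0. Qed.

Let damp_mul l : damp l * (1 + l ^+ 2) = 1.
Proof. by rewrite mulVf// gt_eqF// ltr_pwDl// sqr_ge0. Qed.

Let cdamp : continuous damp.
Proof.
move=> l; apply: cvgV; first by rewrite gt_eqF// ltr_pwDl// sqr_ge0.
by apply: cvgD; [exact: cvg_cst|exact: continuous_sqrf].
Qed.

Let w := Int (fun l => damp l * rho l).

Let Idamp : igr (fun l => damp l * rho l).
Proof.
apply: (@igr_bounded_mul _ _ _ 1) => //; first exact: cont_measurable.
by move=> l; rewrite gtr0_norm.
Qed.

Lemma damp_mass_gt0 : 0 < w.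
Proof.
apply: Int_mul_gt0 => //; first by move=> l; rewrite mulr_ge0// ltW.
apply: aeW => l /eqP; rewrite mulf_eq0 gt_eqF//=.
by move=> /eqP.
Qed.

Let IntC : Int (fun l => (1 - damp l) * rho l) = 1 - w.
Proof.
by rewrite -[X in _ = X - _]Irho1 -IntB//; apply: eq_Int => l; rewrite mulrBl mul1r.
Qed.

Lemma damp_mass_lt1 : w < 1.
Proof.
rewrite -subr_gt0 -IntC; apply: Int_mul_gt0 => //.
- apply: eq_igr (igrB Irho Idamp) => l; by rewrite mulrBl mul1r.
- by move=> l; rewrite mulr_ge0// subr_ge0.
(* 1 - damp vanishes only at l = 0, where rho vanishes as well. *)
apply: aeW => l /eqP; rewrite mulf_eq0 => /orP[|/eqP//].
rewrite subr_eq0 => /eqP e; have := damp_mul l; rewrite -e mul1r => /eqP.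
by rewrite -subr_eq0 addrAC subrr add0r sqrf_eq0 => /eqP ->.
Qed.

Definition damped (l : R) : R := damp l * rho l / w.
Definition undamped (l : R) : R := (1 - damp l) * rho l / (1 - w).

Lemma damped_weight : spectral_weight damped.
Proof.
apply: reweight => //; last exact: damp_mass_gt0.
by move=> l; rewrite (ltW (damp0 l)) damp1.
Qed.

Lemma undamped_weight : spectral_weight undamped.
Proof.
apply: (@reweight (fun l => 1 - damp l)).
- by apply: continuousD_fun; [exact: continuous_cst|exact: continuousN_fun].
- by move=> l; rewrite subr_ge0 damp1/= lerBlDr lerDl ltW.
- by rewrite subr_gt0 damp_mass_lt1.
- exact: IntC.
Qed.

Lemma mixture_split (k : R) : 0 <= k ->
  mixture rho k = w * mixture damped k + (1 - w) * mixture undamped k.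
Proof.
move=> k0; have I1 := igr_mixture damped_weight k0.
have I2 := igr_mixture undamped_weight k0.
rewrite -!IntZ// -IntD; [|exact: igrZ|exact: igrZ].
apply: eq_Int => l; rewrite /damped /undamped.
have w0 := damp_mass_gt0; have w1 := damp_mass_lt1.
have w1' : 1 - w != 0 by rewrite gt_eqF// subr_gt0.
have w0' : w != 0 by rewrite gt_eqF.
by move: (principal_integrand l k) (damp l) (rho l) w w0' w1' => a b c d d0 d1; field; rewrite d0 d1.
Qed.

(* Expanding sin to third order, the kernels of damped and rho can only agree
   near k = 0 if their second moments do; but damping strictly decreases the
   second moment. *)
Lemma damped_neq : exists2 k, 0 < k & mixture damped k <> mixture rho k.
Proof.
apply: contrapT => hne.
have E k : 0 < k -> mixture damped k = mixture rho k.
  by move=> k0; apply: contrapT => ne; apply: hne; exists k.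
have w0 := damp_mass_gt0; have w1 := damp_mass_lt1.
pose u (n : nat) : R := n.+1%:R^-1.
have u0 n : 0 < u n by rewrite invr_gt0.
have cu : u @ \oo --> 0 by exact: cvg_harmonic.
(* The scaled third-order remainder of the sine: it lies between 0 and its limit l^2 / 6, and its
   integral against a weight is determined by the mixture at u n. *)
pose Q n (l : R) := (u n - sin (l * u n) / l) / u n ^+ 3.
have Qb n l : l != 0 -> 0 <= Q n l <= l ^+ 2 / 6.
  wlog l0 : l / 0 < l => [hw|] ln0.
    have [l0|l0] := ltP 0 l; first exact: hw.
    have := hw (- l); rewrite oppr_gt0 lt_neqAle ln0 l0 oppr_eq0 ln0 => /(_ isT isT).
    by rewrite /Q mulNr sinN invrN mulrNN sqrrN.
  have lu : 0 <= l * u n by rewrite mulr_ge0// ltW.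
  have s1 := sin_le_id lu; have s2 := sin_ge_taylor lu.
  have un := u0 n; have u3 : 0 < u n ^+ 3 by rewrite exprn_gt0.
  rewrite /Q divr_ge0 ?(ltW u3)//=; last first.
    by rewrite subr_ge0 ler_pdivrMr// [leRHS]mulrC.
  rewrite ler_pdivrMr//; rewrite -(ler_pM2l l0) mulrBr mulrC.
  rewrite [l * (_ / l)]mulrC divfK//.
  move: (sin (l * u n)) (u n) s2 => s v s2; rewrite exprMn in s2.
  have -> : l * (l ^+ 2 / 6 * v ^+ 3) = l ^+ 3 * v ^+ 3 / 6 by field.
  rewrite mulrC; lra.
have Qlim (l : R) : l != 0 -> Q n l @[n --> \oo] --> l ^+ 2 / 6.
  wlog l0 : l / 0 < l => [hw|] ln0.
    have [l0|l0] := ltP 0 l; first exact: hw.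
    have := hw (- l); rewrite oppr_gt0 lt_neqAle ln0 l0 oppr_eq0 ln0 => /(_ isT isT).
    rewrite sqrrN; apply: eq_cvgr => // n.
    by rewrite /Q mulNr sinN invrN mulrNN.
  apply: (@squeeze_cvgr _ _ _ _ (fun n => l ^+ 2 / 6 - l ^+ 4 / 120 * u n ^+ 2) (fun=> l ^+ 2 / 6)).
  - apply: nearW => n; have /andP[_ ->] := Qb n l ln0; rewrite andbT.
    have lu : 0 <= l * u n by rewrite mulr_ge0// ltW.
    have s1 := sin_le_taylor lu.
    have un := u0 n; have u3 : 0 < u n ^+ 3 by rewrite exprn_gt0.
    rewrite /Q ler_pdivlMr//; rewrite -(ler_pM2l l0) [X in _ <= X]mulrBr.
    rewrite [l * (_ / l)]mulrC divfK//.
    move: (sin (l * u n)) (u n) s1 => s v s1; rewrite !exprMn in s1.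
    have -> : l * ((l ^+ 2 / 6 - l ^+ 4 / 120 * v ^+ 2) * v ^+ 3) =
      l ^+ 3 * v ^+ 3 / 6 - l ^+ 5 * v ^+ 5 / 120 by field.
    lra.
  - rewrite -[X in _ --> X]subr0; apply: cvgB; first exact: cvg_cst.
    rewrite -[X in _ --> X](mulr0 (l ^+ 4 / 120)); apply: cvgM; first exact: cvg_cst.
    have h : u n * u n @[n --> \oo] --> (0 * 0 : R) by exact: cvgM.
    by rewrite mulr0 in h; exact: h.
  - exact: cvg_cst.
have S (r : R -> R) n : spectral_weight r ->
    igr (fun l => Q n l * r l) /\
    Int (fun l => Q n l * r l) = (u n - sinh (u n) * mixture r (u n)) / u n ^+ 3.
  move=> wr; have [_ r0 Ir Irl r1] := wr.
  have un : u n != 0 by rewrite gt_eqF.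
  have s0 : sinh (u n) != 0.
    by rewrite gt_eqF//; apply: lt_le_trans (sinh_ge (ltW (u0 n))).
  have Is : igr (fun l => r l / l * sin (l * u n)).
    apply: igr_le (igr_norm Irl) => [|l].
      apply: measurable_funM; first exact: igr_measurable Irl.
      exact: measurable_sinr.
    by rewrite normrM ler_piMr// sin_max.
  have EQ l : (u n ^+ 3)^-1 * (u n * r l - r l / l * sin (l * u n)) = Q n l * r l.
    rewrite /Q; by move: (sin (l * u n)) (l^-1) (u n ^- 3) => s v z; ring.
  split; first by apply: eq_igr EQ _; apply: igrZ; apply: igrB => //; exact: igrZ.
  rewrite -(eq_Int EQ) IntZ; last by apply: igrB => //; exact: igrZ.
  rewrite IntB//; last exact: igrZ.
  by rewrite IntZ// r1 mulr1 mixtureE// [sinh _ * _]mulrC divfK// mulrC.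
have mQ n : measurable_fun setT (Q n).
  apply: measurable_funM => //; apply: measurable_funB => //; apply: measurable_funM.
    exact: measurable_sinr.
  exact: measurable_inv.
have [_ d0 Id Idl Id1] := damped_weight.
(* As l^2 damp l = 1 - damp l, the second moment of the damped weight is 1 / w - 1. *)
have sqd l : l ^+ 2 * damped l = w^-1 * (rho l - damp l * rho l).
  rewrite /damped -[X in _ * (X - _)]mul1r -[X in _ * (X * _ - _)](damp_mul l).
  by move: (damp l) => d; ring.
have Isqd : igr (fun l => l ^+ 2 * damped l).
  by apply: (@eq_igr _ (fun l => w^-1 * (rho l - damp l * rho l))) => //; apply: igrZ; exact: igrB.
have c1 : Int (fun l => Q n l * damped l) @[n --> \oo] --> Int (fun l => 6^-1 * (l ^+ 2 * damped l)).
  apply: (@Int_dct _ _ _ (fun l => l ^+ 2 * damped l)) => //.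
  - by move=> n; apply: measurable_funM => //; exact: igr_measurable Id.
  - move=> l; have [->|ln0] := eqVneq l 0.
      rewrite d0 !mulr0; apply: (eq_cvgr _ _ (cvg_cst (0 : R))) => // n.
      by rewrite mulr0.
    rewrite mulrA [6^-1 * _]mulrC; apply: cvgM; last exact: cvg_cst.
    exact: Qlim.
  - move=> n l; have [->|ln0] := eqVneq l 0; first by rewrite d0 !mulr0 normr0.
    have [dge _ _ _ _] := damped_weight.
    have /andP[q0 q1] := Qb n l ln0; rewrite (ger0_norm (mulr_ge0 q0 (dge l))).
    rewrite ler_wpM2r//; apply: le_trans q1 _; have := sqr_ge0 l; lra.
(* For rho no majorant is at hand; Fatou yields a finite second moment, at most that of the damped
   weight because the integrals of Q n agree. *)
have h : igr (fun l => 6^-1 * (l ^+ 2 * rho l)) /\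
    Int (fun l => 6^-1 * (l ^+ 2 * rho l)) <= Int (fun l => 6^-1 * (l ^+ 2 * damped l)).
  apply: (@Int_fatou _ (fun n l => Q n l * rho l) _ (fun n => Int (fun l => Q n l * damped l))) => //.
  - by move=> n; have [] := S rho n wrho.
  - move=> n l; have [->|ln0] := eqVneq l 0; first by rewrite rho0 mulr0.
    by have /andP[q0 _] := Qb n l ln0; rewrite mulr_ge0.
  - move=> l; have [->|ln0] := eqVneq l 0.
      rewrite rho0 !mulr0; apply: (eq_cvgr _ _ (cvg_cst (0 : R))) => // n.
      by rewrite mulr0.
    rewrite mulrA [6^-1 * _]mulrC; apply: cvgM; last exact: cvg_cst.
    exact: Qlim.
  - move=> n; have [_ ->] := S rho n wrho; have [_ ->] := S damped n damped_weight.
    by rewrite E.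
have [Ih leh] := h.
have Isq : igr (fun l => l ^+ 2 * rho l).
  by apply: eq_igr (igrZ 6 Ih) => l; rewrite mulrA divff ?mul1r.
have le1 : Int (fun l => l ^+ 2 * rho l) <= w^-1 - 1.
  rewrite !IntZ// ler_pM2l ?invr_gt0// in leh; apply: le_trans leh _.
  rewrite (eq_Int sqd) IntZ; last exact: igrB.
  by rewrite IntB// Irho1 mulrBr mulr1 mulVf// gt_eqF.
(* m and w are the integrals of (1 + l^2) rho and of rho / (1 + l^2). The bound just obtained means
   m w <= 1, against the strict Cauchy-Schwarz inequality m w > 1. *)
pose m := 1 + Int (fun l => l ^+ 2 * rho l).
have mw : m * w <= 1.
  rewrite -ler_pdivlMr// div1r /m; lra.
(* The square behind that inequality: q rho integrates to m (m w - 1), and q vanishes only where l^2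
   = m - 1, a null set. *)
pose q (l : R) := (1 + l ^+ 2 - m) ^+ 2 * damp l.
have qE l : q l * rho l = rho l + l ^+ 2 * rho l - 2 * m * rho l + m ^+ 2 * (damp l * rho l).
  rewrite /q; have := damp_mul l; move: (damp l) (l ^+ 2) => d x e.
  have -> : (1 + x - m) ^+ 2 * d * rho l = (1 + x) * (d * (1 + x)) * rho l
     - 2 * m * (d * (1 + x)) * rho l + m ^+ 2 * (d * rho l) by ring.
  by rewrite e; ring.
have Iq0 : igr (fun l => rho l + l ^+ 2 * rho l - 2 * m * rho l).
  by apply: igrB; [exact: igrD|exact: igrZ].
have Iq : igr (fun l => q l * rho l).
  apply: (@eq_igr _ (fun l => rho l + l ^+ 2 * rho l - 2 * m * rho l + m ^+ 2 * (damp l * rho l))).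
    by move=> l; rewrite qE.
  by apply: igrD => //; exact: igrZ.
have : 0 < Int (fun l => q l * rho l).
  apply: Int_mul_gt0 => //.
    by move=> l; rewrite mulr_ge0// mulr_ge0 ?sqr_ge0// ltW.
  pose s := Num.sqrt (m - 1).
  exists [set s; - s]; split.
  - by apply: measurableU; exact: measurable_set1.
  - apply: countable_lebesgue_measure0; exact: finite_set_countable.
  - move=> l /= /not_implyP[ql rn]; move/eqP : ql.
    rewrite mulf_eq0 => /orP[|/eqP //]; rewrite mulf_eq0 [damp l == 0]gt_eqF// orbF.
    rewrite sqrf_eq0 subr_eq0 => /eqP e.
    have m1 : m - 1 = l ^+ 2 by rewrite -e addrAC subrr add0r.
    rewrite /s m1 sqrtr_sqr.
    by have [l0|l0] := leP 0 l; [left; rewrite /= ger0_norm|right; rewrite /= ltr0_norm// opprK].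
rewrite (eq_Int qE) IntD//; last exact: igrZ.
rewrite IntB//; [|exact: igrD|exact: igrZ].
rewrite IntD// !IntZ// Irho1 -/w mulr1.
have m0 : 0 < m by rewrite ltr_pwDl// Int_ge0// => l; rewrite mulr_ge0// sqr_ge0.
rewrite -/m => h1; have h2 : m * (m * w) <= m * 1 by rewrite ler_wpM2l// ltW.
have h3 : m - 2 * m + m ^+ 2 * w = m * (m * w) - m by ring.
by move: h1; rewrite h3; lra.
Qed.

End damping.

Unset Implicit Arguments.

Theorem mainTheorem4 (R : realType) (g : R -> R)
    (g_cont : {within `[1, +oo[, continuous g})
    (g1 : g 1 = 1)
    (g_causal : positive_definite (causal_kernel g)) :
  calGP (breve g) /\ ~ extreme_point (@calG R) (breve g).
Proof.
have [rho [wrho gE]] := causal_mixture g_cont g1 g_causal.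
have breveE : breve g =
    fun k p => (mixture rho (arcosh (lorentz_prod k p)))%:C%C.
  apply/funext => k; apply/funext => p; rewrite /breve -gE//.
  exact: lorentz_prod_ge1.
have [rho_ge0 rho0 Irho Irhol Irho1] := wrho.
have GG : calG (breve g) by rewrite breveE; exact: calG_mixture.
split.
  split=> //; exists g; split=> //.
  have [mu [mu1 muE]] := halfline_probability rho_ge0 Irho Irho1.
  exists mu; split=> // t t1.
  rewrite (muE _ 1) ?gE//; last 2 first.
  - exact: measurable_principal.
  - by move=> l; apply: norm_principal; exact: arcosh_ge0.
  by congr EFin; apply: eq_Int => l; rewrite principal_even.
case=> _ ext.
have w0 := damp_mass_gt0 wrho; have w1 := damp_mass_lt1 wrho.
set w := Int _ in w0 w1.
have := ext _ _ w (calG_mixture (damped_weight wrho))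
  (calG_mixture (undamped_weight wrho)).
rewrite w0 w1 => /(_ isT) []//.
  move=> k p; rewrite breveE (mixture_split wrho); last first.
    by rewrite arcosh_ge0// lorentz_prod_ge1.
  by rewrite -!rmorphM -rmorphD.
(* Extremality would identify the kernel of the damped weight with that of g; evaluated at two
   points with Minkowski product cosh k, this contradicts the choice of k. *)
move=> AG _; have [k k0 []] := damped_neq wrho.
have := lorentz_prod_horo_arcosh (cosh_ge1 k).
move: (horo _) (horo _) => a b h.
have /complexI AB := congr1 (fun K => K b a) AG.
have {}AB : mixture (damped rho) (arcosh (lorentz_prod b a)) = g (lorentz_prod b a) := AB.
rewrite h (gE _ (cosh_ge1 k)) (coshK (ltW k0)) in AB.
exact: AB.
Qed.
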